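(* The cyclotomic quotient $H_n^f(A,z)$ is a symmetric algebra with trace map $\mathrm{tr}_f^n$, where $\mathrm{tr}_f^n\colon H_n^f(A,z)\to\Bbbk$ is the $\Bbbk$-linear map determined by $$X^\lambda\mathbf aT_w\mapsto\delta_{\lambda,0}\,\delta_{w,1}\,\mathrm{tr}^{\otimes n}(\mathbf a),\qquad \lambda\in\mathbb N^n\text{ with }\lambda_i<d\ \text{for all } i,\ \mathbf a\in A^{\otimes n},\ w\in S_n.$$
   Context: Conventions. $\Bbbk$ is a commutative ring of characteristic not equal to two, $z\in\Bbbk$, $\mathbb N$ is the set of nonnegative integers, and all tensor products are over $\Bbbk$. All algebras and modules are associative superalgebras and supermodules over $\Bbbk$; $\bar a$ is the parity of a homogeneous element $a$; $(a\otimes b)(c\otimes d)=(-1)^{\bar b\bar c}ac\otimes bd$. A symmetric (super)algebra $C$ with trace map $\mathrm{tr}$ means: $\mathrm{tr}\colon C\to\Bbbk$ is parity-preserving and linear ($\Bbbk$ in parity zero), $\mathrm{tr}(ab)=(-1)^{\bar a\bar b}\mathrm{tr}(ba)$ for homogeneous $a,b\in C$, and $a\mapsto(b\mapsto\mathrm{tr}(ab))$ is a parity-preserving isomorphism of $\Bbbk$-modules $C\to\mathrm{Hom}_\Bbbk(C,\Bbbk)$. $A$ is a symmetric superalgebra with trace $\mathrm{tr}$, free over $\Bbbk$ with a homogeneous (necessarily finite) basis $B$, and dual basis $\{b^\vee\}$ given by $\mathrm{tr}(a^\vee b)=\delta_{a,b}$ for $a,b\in B$. Fix an integer $n\ge1$.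 For $a\in A$, $a_i=1^{\otimes(i-1)}\otimes a\otimes1^{\otimes(n-i)}\in A^{\otimes n}$; $t_{i,j}=\sum_{b\in B}b_ib_j^\vee$ for $1\le i\ne j\le n$. $S_n$ acts on $A^{\otimes n}$ by superpermutation of factors; $s_i=(i,i+1)$. $H_n(A,z)$ is the algebra generated by $A^{\otimes n}$ and even elements $T_1,\dots,T_{n-1}$ (free product) modulo: $T_iT_j=T_jT_i$ for $|i-j|>1$; $T_iT_{i+1}T_i=T_{i+1}T_iT_{i+1}$; $T_i^2=zt_{i,i+1}T_i+1$; $T_i\mathbf a=s_i(\mathbf a)T_i$ for $\mathbf a\in A^{\otimes n}$ (so $H_1(A,z)=A$). $H_n^{\mathrm{aff}}(A,z)$ is the free product of $\Bbbk[X_1^{\pm1},\dots,X_n^{\pm1}]$ ($X_i$ even) and $H_n(A,z)$ modulo: $T_iX_j=X_jT_i$ for $j\ne i,i+1$; $T_iX_iT_i=X_{i+1}$; $X_i\mathbf a=\mathbf aX_i$ for $\mathbf a\in A^{\otimes n}$. For $w\in S_n$ with reduced expression $w=s_{i_1}\cdots s_{i_k}$, $T_w=T_{i_1}\cdots T_{i_k}$. For $\lambda\in\mathbb N^n$, $X^\lambda=X_1^{\lambda_1}\cdots X_n^{\lambda_n}$. Cyclotomic quotients. Let $Z(A)=\{a: ab=(-1)^{\bar a\bar b}ba\ \forall b\in A\}$ and $Z(A)_0$ its even part. Identify $A$ with $A\otimes1^{\otimes(n-1)}\subseteq A^{\otimes n}$. Fix a monic polynomial $f=X_1^d+a_{(d-1)}X_1^{d-1}+\dots+a_{(0)}$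 of degree $d\ge1$ with all $a_{(i)}\in Z(A)_0$ and $a_{(0)}$ invertible. $H_n^f(A,z)=H_n^{\mathrm{aff}}(A,z)/\langle f\rangle$, with $\langle f\rangle$ the two-sided ideal generated by $f$. The images of $X^\lambda\mathbf aT_w$ with $\lambda\in\mathbb N^n$, $\lambda_i<d$ for all $i$, $\mathbf a\in B^{\otimes n}$ (pure tensors of elements of $B$), $w\in S_n$, form a $\Bbbk$-basis of $H_n^f(A,z)$, so $\mathrm{tr}_f^n$ is well defined. *)

(* Defs.v *)
From HB Require Import structures.
From mathcomp Require Import all_boot all_order all_fingroup all_algebra.
From mathcomp Require Import finmap generic_quotient monalg boolp.

Set Implicit Arguments.
Unset Strict Implicit.
Unset Printing Implicit Defensive.
Import GRing.Theory.
Local Open Scope ring_scope.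
Local Open Scope quotient_scope.


(* [algType k] requires 1 != 0, which is not known beforehand for a quotient   *)
(* by a two-sided ideal.                                                       *)
HB.mixin Record PzRing_isPzAlgebra (k : comNzRingType) V of GRing.PzRing V := {
  alg_scale : k -> V -> V;
  alg_scaleA : forall a b v, alg_scale a (alg_scale b v) = alg_scale (a * b) v;
  alg_scale1 : left_id 1 alg_scale;
  alg_scaleDr : right_distributive alg_scale +%R;
  alg_scaleDl : forall v, {morph alg_scale^~ v : a b / a + b};
  alg_scaleAl : forall c (u v : V), alg_scale c (u * v) = alg_scale c u * v;
  alg_scaleAr : forall c (u v : V), alg_scale c (u * v) = u * alg_scale c v
}.

#[short(type="pzAlgType")]
HB.structure Definition PzAlgebra (k : comNzRingType) :=
  {V of GRing.PzRing V & PzRing_isPzAlgebra k V}.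

(* The library has no join of pzRingType and lmodType strictly above           *)
(* lSemiAlgType, hence the module structure is not inherited but derived.      *)
#[non_forgetful_inheritance, warnings="-redundant-canonical-projection"]
HB.instance Definition _ (k : comNzRingType) (V : pzAlgType k) :=
  GRing.Zmodule_isLmodule.Build k (PzAlgebra.sort V)
    alg_scaleA alg_scale1 alg_scaleDr alg_scaleDl.

Section PzAlgebraTheory.
Variables (k : comNzRingType) (V : pzAlgType k).
Implicit Types (c : k) (u v : V).
Lemma pz_scalerAl c u v : c *: (u * v) = (c *: u) * v.
Proof. exact: alg_scaleAl. Qed.
Lemma pz_scalerAr c u v : c *: (u * v) = u * (c *: v).
Proof. exact: alg_scaleAr. Qed.
End PzAlgebraTheory.


(* [par p a]: the element [a] is homogeneous of parity [p] ([true] is odd);    *)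
(* 0 is homogeneous of both parities.                                          *)
Record is_superalgebra (k : comNzRingType) (C : pzAlgType k)
    (par : bool -> C -> Prop) : Prop := IsSuperalgebra {
  par_0 : forall p, par p 0;
  par_D : forall p a b, par p a -> par p b -> par p (a + b);
  par_Z : forall p c a, par p a -> par p (c *: a);
  par_1 : par false 1;
  par_M : forall p q a b, par p a -> par q b -> par (p (+) q) (a * b);
  par_span : forall a, exists a0 a1, [/\ par false a0, par true a1 & a = a0 + a1];
  par_direct : forall a, par false a -> par true a -> a = 0
}.

(* The last two fields say that a |-> (b |-> tr (a * b)) is a parity-preserving *)
(* bijection from C onto Hom_k(C, k), where a functional has parity p when it   *)
(* vanishes on elements of the other parity (k being in parity zero).           *)
Record is_symmetric_superalgebra (k : comNzRingType) (C : pzAlgType k)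
    (par : bool -> C -> Prop) (tr : {scalar C}) : Prop := IsSymmetric {
  sym_super : is_superalgebra par;
  tr_even : forall a, par true a -> tr a = 0;
  tr_supersym : forall p q a b, par p a -> par q b ->
    tr (a * b) = (-1) ^+ (p && q) * tr (b * a);
  tr_dual_bij : forall phi : {scalar C},
    exists! a : C, forall b : C, tr (a * b) = phi b;
  tr_dual_par : forall p a, par p a ->
    forall b, par (~~ p) b -> tr (a * b) = 0
}.

(* Homogeneous elements of parity p of Z(C). *)
Definition supercentral (k : comNzRingType) (C : pzAlgType k)
    (par : bool -> C -> Prop) (p : bool) (a : C) : Prop :=
  par p a /\
  forall q b, par q b -> a * b = (-1) ^+ (p && q) *: (b * a).

Definition is_basis (k : comNzRingType) (V : lmodType k) (I : finType)
    (B : I -> V) : Prop :=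
  forall v : V, exists! c : {ffun I -> k}, v = \sum_i c i *: B i.


Section IdealQuotient.
Variables (k : comNzRingType) (C : pzAlgType k) (S : C -> Prop).

Inductive ideal_gen : C -> Prop :=
| ideal_in x : S x -> ideal_gen x
| ideal_0 : ideal_gen 0
| ideal_D x y : ideal_gen x -> ideal_gen y -> ideal_gen (x + y)
| ideal_M a x b : ideal_gen x -> ideal_gen (a * x * b).

Definition idealp : {pred C} := [pred x | `[< ideal_gen x >]].

Fact idealp_zmod_closed : zmod_closed idealp.
Proof.
split=> [|x y /asboolP Ix /asboolP Iy]; apply/asboolP; first exact: ideal_0.
apply: ideal_D => //; have -> : - y = -1 * y * 1 by rewrite mulr1 mulN1r.
exact: ideal_M.
Qed.
HB.instance Definition _ := GRing.isZmodClosed.Build C idealp idealp_zmod_closed.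

Definition ideal_quotient : Type := {ideal_quot idealp}.
HB.instance Definition _ := GRing.Zmodule.on ideal_quotient.

Definition quo (x : C) : ideal_quotient := \pi_({ideal_quot idealp}) x.

Lemma quoP x y : quo x = quo y <-> ideal_gen (x - y).
Proof.
split=> [/eqP|Ixy]; first by rewrite /quo -Quotient.idealrBE => /asboolP.
by apply/eqP; rewrite /quo -Quotient.idealrBE; apply/asboolP.
Qed.

Lemma quo_surj (u : ideal_quotient) : exists x, u = quo x.
Proof. by exists (repr u); rewrite /quo reprK. Qed.

Lemma quoD x y : quo (x + y) = quo x + quo y.
Proof. by rewrite /quo !piE. Qed.

Definition quo_one : ideal_quotient := quo 1.
Definition quo_mul (u v : ideal_quotient) : ideal_quotient :=
  quo (repr u * repr v).
Definition quo_scale (c : k) (u : ideal_quotient) : ideal_quotient :=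
  quo (c *: repr u).

Lemma ideal_repr x : ideal_gen (repr (quo x) - x).
Proof. by apply/quoP; rewrite /quo reprK. Qed.

Lemma quo_mulE x y : quo_mul (quo x) (quo y) = quo (x * y).
Proof.
apply/quoP; set x' := repr _; set y' := repr _.
have -> : x' * y' - x * y = 1 * (x' - x) * y' + x * (y' - y) * 1.
  by rewrite mul1r mulr1 mulrBl mulrBr addrA subrK.
by apply: ideal_D; apply: ideal_M; apply: ideal_repr.
Qed.

Lemma quo_scaleE c x : quo_scale c (quo x) = quo (c *: x).
Proof.
apply/quoP; rewrite -scalerBr; set y := _ - x.
have -> : c *: y = (c *: (1 : C)) * y * 1 by rewrite mulr1 -pz_scalerAl mul1r.
by apply: ideal_M; apply: ideal_repr.
Qed.

Fact quo_mulA : associative quo_mul.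
Proof.
move=> u v w; have [[x ->] [[y ->] [t ->]]] := (quo_surj u, (quo_surj v, quo_surj w)).
by rewrite !quo_mulE mulrA.
Qed.
Fact quo_mul1 : left_id quo_one quo_mul.
Proof. by move=> u; have [x ->] := quo_surj u; rewrite quo_mulE mul1r. Qed.
Fact quo_mulr1 : right_id quo_one quo_mul.
Proof. by move=> u; have [x ->] := quo_surj u; rewrite quo_mulE mulr1. Qed.
Fact quo_mulDl : left_distributive quo_mul +%R.
Proof.
move=> u v w; have [[x ->] [[y ->] [t ->]]] := (quo_surj u, (quo_surj v, quo_surj w)).
by rewrite -quoD !quo_mulE mulrDl quoD.
Qed.
Fact quo_mulDr : right_distributive quo_mul +%R.
Proof.
move=> u v w; have [[x ->] [[y ->] [t ->]]] := (quo_surj u, (quo_surj v, quo_surj w)).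
by rewrite -quoD !quo_mulE mulrDr quoD.
Qed.
HB.instance Definition _ := GRing.Zmodule_isPzRing.Build ideal_quotient
  quo_mulA quo_mul1 quo_mulr1 quo_mulDl quo_mulDr.

Fact quo_scaleA a b u : quo_scale a (quo_scale b u) = quo_scale (a * b) u.
Proof. by have [x ->] := quo_surj u; rewrite !quo_scaleE scalerA. Qed.
Fact quo_scale1 : left_id 1 quo_scale.
Proof. by move=> u; have [x ->] := quo_surj u; rewrite quo_scaleE scale1r. Qed.
Fact quo_scaleDr : right_distributive quo_scale +%R.
Proof.
move=> c u v; have [[x ->] [y ->]] := (quo_surj u, quo_surj v).
by rewrite -quoD !quo_scaleE scalerDr quoD.
Qed.
Fact quo_scaleDl u : {morph quo_scale^~ u : a b / a + b}.
Proof.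
by move=> a b /=; have [x ->] := quo_surj u; rewrite !quo_scaleE scalerDl quoD.
Qed.
Lemma quoM x y : quo (x * y) = quo x * quo y.
Proof. by rewrite -quo_mulE. Qed.
Lemma quo1 : quo 1 = 1. Proof. by []. Qed.

Fact quo_scaleAl c (u v : ideal_quotient) :
  quo_scale c (u * v) = quo_scale c u * v.
Proof.
have [[x ->] [y ->]] := (quo_surj u, quo_surj v).
by rewrite -quoM !quo_scaleE -quoM pz_scalerAl.
Qed.
Fact quo_scaleAr c (u v : ideal_quotient) :
  quo_scale c (u * v) = u * quo_scale c v.
Proof.
have [[x ->] [y ->]] := (quo_surj u, quo_surj v).
by rewrite -quoM !quo_scaleE -quoM pz_scalerAr.
Qed.
HB.instance Definition _ := PzRing_isPzAlgebra.Build k ideal_quotient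
  quo_scaleA quo_scale1 quo_scaleDr quo_scaleDl quo_scaleAl quo_scaleAr.

Definition quotient_alg : pzAlgType k := ideal_quotient.

Lemma quoZ c x : quo (c *: x) = c *: (quo x : quotient_alg).
Proof. by rewrite -quo_scaleE. Qed.

Definition quo_par (par : bool -> C -> Prop) (p : bool) (u : quotient_alg) :
    Prop :=
  exists2 x, par p x & u = quo x.

End IdealQuotient.


Section FreeAlgebra.
Variable k : comNzRingType.

Fact malg_scalerAr (K : monomType) c (u v : {malg k[K]}) :
  c *: (u * v) = u * (c *: v).
Proof.
apply/malgP=> m; rewrite mcoeffZ mcoeffMl.
rewrite (mcoeffMlw m (fsubset_refl _) (msuppZ_le c v)) mulr_sumr.
apply: eq_bigr => i _; rewrite mulr_sumr; apply: eq_bigr => j _.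
by rewrite mcoeffZ mulrnAr mulrCA.
Qed.

HB.instance Definition _ (K : monomType) :=
  PzRing_isPzAlgebra.Build k {malg k[K]} (@scalerA k _) (@scale1r k _)
    (@scalerDr k _) (fun v a b => scalerDl v a b) (@scalerAl k _)
    (@malg_scalerAr K).

Variable G : choiceType.

Definition free_alg : pzAlgType k := {malg k[{fmonom G}]}.

Definition gen (g : G) : free_alg := << fmu g >> : {malg k[{fmonom G}]}.

(* The grading of the free algebra in which [gen g] is homogeneous of parity p *)
(* whenever [gpar p g]; the other generators are not required to be            *)
(* homogeneous.                                                                *)
Inductive free_par (gpar : bool -> G -> Prop) : bool -> free_alg -> Prop :=
| free_par_gen p g : gpar p g -> free_par gpar p (gen g)
| free_par_1 : free_par gpar false 1
| free_par_0 p : free_par gpar p 0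
| free_par_D p x y :
    free_par gpar p x -> free_par gpar p y -> free_par gpar p (x + y)
| free_par_Z p c x : free_par gpar p x -> free_par gpar p (c *: x)
| free_par_M p q x y :
    free_par gpar p x -> free_par gpar q y -> free_par gpar (p (+) q) (x * y).

End FreeAlgebra.


Section AffineHecke.
Variables (k : comNzRingType) (A : pzAlgType k) (par : bool -> A -> Prop).
Variables (I : finType) (B Bd : I -> A).
(* n.+1 is the number of tensor factors, which are indexed from 0. *)
Variables (n : nat) (z : k).

Definition hecke_gen : choiceType :=
  ({ffun 'I_n.+1 -> A} + 'I_n + 'I_n.+1 + 'I_n.+1)%type.

Let F : pzAlgType k := free_alg k hecke_gen.

Definition gtens (a : {ffun 'I_n.+1 -> A}) : F := gen k (inl (inl (inl a))).
Definition gT (i : 'I_n) : F := gen k (inl (inl (inr i))).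
Definition gX (j : 'I_n.+1) : F := gen k (inl (inr j)).
Definition gXV (j : 'I_n.+1) : F := gen k (inr j).

(* The two factors exchanged by the simple transposition number i. *)
Definition lft (i : 'I_n) : 'I_n.+1 := widen_ord (leqnSn n) i.
Definition rgt (i : 'I_n) : 'I_n.+1 := lift ord0 i.
Definition simple_tr (i : 'I_n) : 'S_n.+1 := tperm (lft i) (rgt i).

Definition set_factor (a : {ffun 'I_n.+1 -> A}) (j : 'I_n.+1) (x : A) :
    {ffun 'I_n.+1 -> A} :=
  [ffun l => if l == j then x else a l].

Definition in_factor (j : 'I_n.+1) (x : A) : {ffun 'I_n.+1 -> A} :=
  set_factor [ffun => 1] j x.

Definition teleporter (i j : 'I_n.+1) : F :=
  \sum_b gtens (in_factor i (B b)) * gtens (in_factor j (Bd b)).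

Definition homog_tensor (p : 'I_n.+1 -> bool) (a : {ffun 'I_n.+1 -> A}) : Prop :=
  forall j, par (p j) (a j).

(* (-1)^e is the sign in                                                        *)
(* (a_1 (x) ... (x) a_n)(c_1 (x) ... (x) c_n) =                                 *)
(*   (-1)^e a_1 c_1 (x) ... (x) a_n c_n.                                        *)
Definition koszul (p q : 'I_n.+1 -> bool) : nat :=
  (\sum_(i < n.+1) \sum_(j < n.+1 | j < i) (p i && q j))%N.

(* The algebra A^{(x) n} is spanned by the pure tensors subject to             *)
(* multilinearity, with the product of homogeneous pure tensors given by the   *)
(* Koszul sign rule; it is presented by these relations.                       *)
Inductive tensor_relation : F -> F -> Prop :=
| tens_add a j x y : tensor_relation
    (gtens (set_factor a j (x + y)))
    (gtens (set_factor a j x) + gtens (set_factor a j y))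
| tens_scale a j (c : k) x : tensor_relation
    (gtens (set_factor a j (c *: x))) (c *: gtens (set_factor a j x))
| tens_one : tensor_relation (gtens [ffun => 1]) 1
| tens_mul p q a c : homog_tensor p a -> homog_tensor q c -> tensor_relation
    (gtens a * gtens c)
    ((-1) ^+ koszul p q *: gtens [ffun j => a j * c j]).

(* H_n(A, z): the second constructor onwards gives the relations imposed on    *)
(* the free product of A^{(x) n} and the T_i; wreath_act states                *)
(* T_i a = s_i(a) T_i for homogeneous pure tensors, the sign being that of the *)
(* superpermutation.                                                           *)
Inductive wreath_relation : F -> F -> Prop :=
| wreath_tens x y : tensor_relation x y -> wreath_relation x y
| wreath_comm (i j : 'I_n) : (i.+1 < j)%N || (j.+1 < i)%N ->
    wreath_relation (gT i * gT j) (gT j * gT i)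
| wreath_braid (i j : 'I_n) : j = i.+1 :> nat ->
    wreath_relation (gT i * gT j * gT i) (gT j * gT i * gT j)
| wreath_quad i : wreath_relation
    (gT i * gT i) (z *: (teleporter (lft i) (rgt i) * gT i) + 1)
| wreath_act i p a : homog_tensor p a -> wreath_relation
    (gT i * gtens a)
    ((-1) ^+ (p (lft i) && p (rgt i)) *:
       (gtens [ffun j => a (simple_tr i j)] * gT i)).

Inductive affine_relation : F -> F -> Prop :=
| aff_wreath x y : wreath_relation x y -> affine_relation x y
| aff_XV j : affine_relation (gX j * gXV j) 1
| aff_VX j : affine_relation (gXV j * gX j) 1
| aff_XX j l : affine_relation (gX j * gX l) (gX l * gX j)
| aff_TX i j : j != lft i -> j != rgt i ->
    affine_relation (gT i * gX j) (gX j * gT i)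
| aff_TXT i : affine_relation (gT i * gX (lft i) * gT i) (gX (rgt i))
| aff_Xtens j a : affine_relation (gX j * gtens a) (gtens a * gX j).

Definition affine_hecke : pzAlgType k :=
  quotient_alg (fun x : F => exists u v, affine_relation u v /\ x = u - v).

Definition aff_cls (x : F) : affine_hecke := quo _ x.

Inductive hecke_gen_par : bool -> hecke_gen -> Prop :=
| par_tens p a : homog_tensor p a ->
    hecke_gen_par (\big[addb/false]_j p j) (inl (inl (inl a)))
| par_T i : hecke_gen_par false (inl (inl (inr i)))
| par_X j : hecke_gen_par false (inl (inr j))
| par_XV j : hecke_gen_par false (inr j).

Definition affine_par : bool -> affine_hecke -> Prop :=
  quo_par (free_par hecke_gen_par).

Variables (d : nat) (f : 'I_d -> A).

(* The monic polynomial X_1^d + \sum_(i < d) f_i X_1^i. *)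
Definition cyclo_poly : affine_hecke :=
  aff_cls (gX ord0) ^+ d +
  \sum_(i < d) aff_cls (gtens (in_factor ord0 (f i))) * aff_cls (gX ord0) ^+ i.

Definition cyclo_hecke : pzAlgType k :=
  quotient_alg (fun x : affine_hecke => x = cyclo_poly).

Definition cyc_cls (x : affine_hecke) : cyclo_hecke := quo _ x.

Definition cyclo_par : bool -> cyclo_hecke -> Prop := quo_par affine_par.

Definition cX (j : 'I_n.+1) : cyclo_hecke := cyc_cls (aff_cls (gX j)).
Definition cT (i : 'I_n) : cyclo_hecke := cyc_cls (aff_cls (gT i)).
Definition ctens (a : {ffun 'I_n.+1 -> A}) : cyclo_hecke :=
  cyc_cls (aff_cls (gtens a)).

Definition reduced_expression (w : 'S_n.+1) (s : seq 'I_n) : Prop :=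
  w = (\prod_(i <- s) simple_tr i)%g /\
  forall s', w = (\prod_(i <- s') simple_tr i)%g -> (size s <= size s')%N.

(* X^lam a T_w for a pure tensor a and T_w computed from the reduced           *)
(* expression s of w; pure tensors span A^{(x) n}, on which tr^{(x) n} is the  *)
(* product of the traces of the factors.                                       *)
Definition is_cyclo_trace (trA : {scalar A}) (tr : {scalar cyclo_hecke}) : Prop :=
  forall (lam : {ffun 'I_n.+1 -> nat}) (a : {ffun 'I_n.+1 -> A})
    (w : 'S_n.+1) (s : seq 'I_n),
  (forall j, lam j < d)%N -> reduced_expression w s ->
  tr ((\prod_j cX j ^+ lam j) * ctens a * (\prod_(i <- s) cT i)) =
  (lam == [ffun => 0%N])%:R * (w == 1%g)%:R * \prod_j trA (a j).

End AffineHecke.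

(* Main.v *)
(* The trace is constructed from a tower of induced modules. From a module N   *)
(* over the algebra on n strands one writes down explicitly the induced module  *)
(* on n+1 strands, a sum of n+1 copies of N (x) A[Y]/f, with maps R and E       *)
(* between N and the induced module commuting with the algebra on n strands.    *)
(* Iterating from the base ring gives a vector v and a functional e with        *)
(* tr h = e (h v). Let H_m be generated by the first m strands. The maps R and  *)
(* E show that tr (x T y) = 0 and tr (x a X^j y) = delta_(j,0) tr a tr (x y)    *)
(* for x, y in H_m, 0 <= j < d, where T, a, X sit at the last strand of H_m+1.  *)
(* As H_m+1 = H_m T H_m + sum_j H_m A X^j, these rules determine tr; they give  *)
(* the supersymmetry by induction on m, for products with generators. For the   *)
(* duality, H_m+1 is spanned over H_m, on the left by a family e and on the     *)
(* right by a family g, whose Gram matrix is unitriangular because powers X^j   *)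
(* are paired with powers X^(-l), X being invertible. Finally a reduced word is *)
(* braid equivalent to a canonical one, a product of descending runs, on which  *)
(* the trace is computed strand by strand.                                      *)
From HB Require Import structures.
Require Import Defs.
From mathcomp Require Import all_boot all_fingroup all_algebra.
From mathcomp Require Import finmap generic_quotient monalg boolp.
From mathcomp Require Import zify ring.
Set Implicit Arguments.
Unset Strict Implicit.
Unset Printing Implicit Defensive.
Import GRing.Theory.
Local Open Scope ring_scope.

(** * Linear endomorphisms, dual bases and teleporters *)

(** Number the strands from 0, let X_i be the polynomial generator on strand i, and let H_m be the
    subalgebra generated by the first m strands. The trace is a composite of conditional
    expectations from H_(m+1) to H_m that kill H_m T_(m-1) H_m and send a X_m^j, with a on strand m
    and j < d, to tr(a) if j = 0 and to 0 otherwise.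

    These expectations are read off from modules. A module N over n strands yields one over n+1
    strands, made of n+1 copies of N (x) A[Y]/f indexed by the position of a new strand. The
    identity [ak_relation] dictates how X_0 acts there; the relations are verified in [ten_ind] for
    N (x) A[Y]/f and in [ind_hecke] for the sum of the copies. Only the relations of [hecke_datum]
    have to be checked: X_0 is their only polynomial generator, and X_0 T_0 X_0 T_0 = T_0 X_0 T_0
    X_0 stands for the commutation of the X_i. By [cyclo_lift] such data, with X_0 invertible, give
    representations of the cyclotomic algebra.

    The map [stepR] adds a strand in the last position and [stepE] closes it. Both commute with the
    algebra on the old strands, and [stepE_TR], [stepE_AR], [stepE_loop] evaluate what lies between
    them. Iterating from k gives functionals tr_m on H_m with the rules [tau_T] and [tau_loop]. The
    decomposition [mackey], H_(m+1) = H_m T_(m-1) H_m plus the sum over j < d of the H_m A X_m^j,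
    makes these rules a complete recursion ([trX]).

    Supersymmetry follows by induction on m ([ssym_step]): the elements that supercommute with
    everything under the trace are closed under products, so generators suffice, and the crossing
    T_(m-1) is dealt with by [tr_TuTu].

    For the duality, H_(m+1) is spanned over H_m by a family e on the left and a family g on the
    right whose Gram matrix is unitriangular ([triangular]). Part of it comes from one strand below,
    as T e_j and g_j T ([tblock_step]); the rest consists of the b^vee X_m^j against the X_m^(-l) b
    ([tri_tblock]). A unitriangular Gram matrix carries injectivity and surjectivity of the duality
    map from m to m+1 ([tri_inj], [tri_surj], [tr_perfect]).

    Finally a reduced word is braid equivalent to a product of descending runs ([reduced_canon]), on
    which the trace is computed strand by strand ([tr_mono]); the corresponding monomials span
    ([mono_span]), which gives uniqueness. *)

Record lendo (k : comNzRingType) (V : lmodType k) : Type :=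
  Lendo { lendo_fun :> V -> V; lendo_linear : linear lendo_fun }.

Section Lendo.
Variables (k : comNzRingType) (V : lmodType k).
Implicit Types (f g h : lendo V).

HB.instance Definition _ := gen_eqMixin (lendo V).
HB.instance Definition _ := gen_choiceMixin (lendo V).
HB.instance Definition _ f :=
  GRing.isLinear.Build k V V *:%R (lendo_fun f) (lendo_linear f).

Lemma lendoP f g : f =1 g -> f = g.
Proof.
case: f g => [f lf] [g lg] /= /funext efg; case: _ / efg lg => lg.
by rewrite (Prop_irrelevance lf lg).
Qed.

Fact lendo0_subproof : linear (fun _ : V => 0 : V).
Proof. by move=> a u v; rewrite scaler0 addr0. Qed.
Fact lendoN_subproof f : linear (fun v => - f v).
Proof. by move=> a u v; rewrite linearP opprD scalerN. Qed.
Fact lendoD_subproof f g : linear (fun v => f v + g v).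
Proof. by move=> a u v; rewrite !linearP scalerDr addrACA. Qed.
Fact lendo1_subproof : linear (fun v : V => v).
Proof. by []. Qed.
Fact lendoM_subproof f g : linear (fun v => f (g v)).
Proof. by move=> a u v; rewrite !linearP. Qed.
Fact lendoZ_subproof c f : linear (fun v => c *: f v).
Proof. by move=> a u v; rewrite linearP scalerDr !scalerA mulrC. Qed.

Definition lendo0 := Lendo lendo0_subproof.
Definition lendoN f := Lendo (lendoN_subproof f).
Definition lendoD f g := Lendo (lendoD_subproof f g).
Definition lendo1 := Lendo lendo1_subproof.
Definition lendoM f g := Lendo (lendoM_subproof f g).
Definition lendoZ c f := Lendo (lendoZ_subproof c f).

Fact lendo_addA : associative lendoD.
Proof. by move=> f g h; apply: lendoP => v; exact: addrA. Qed.
Fact lendo_addC : commutative lendoD.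
Proof. by move=> f g; apply: lendoP => v; exact: addrC. Qed.
Fact lendo_add0 : left_id lendo0 lendoD.
Proof. by move=> f; apply: lendoP => v; exact: add0r. Qed.
Fact lendo_addN : left_inverse lendo0 lendoN lendoD.
Proof. by move=> f; apply: lendoP => v; exact: addNr. Qed.
HB.instance Definition _ :=
  GRing.isZmodule.Build (lendo V) lendo_addA lendo_addC lendo_add0 lendo_addN.

Fact lendo_mulA : associative lendoM. Proof. by move=> f g h; apply: lendoP. Qed.
Fact lendo_mul1 : left_id lendo1 lendoM. Proof. by move=> f; apply: lendoP. Qed.
Fact lendo_mulr1 : right_id lendo1 lendoM. Proof. by move=> f; apply: lendoP. Qed.
Fact lendo_mulDl : left_distributive lendoM +%R.
Proof. by move=> f g h; apply: lendoP. Qed.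
Fact lendo_mulDr : right_distributive lendoM +%R.
Proof. by move=> f g h; apply: lendoP => v; exact: linearD. Qed.
HB.instance Definition _ := GRing.Zmodule_isPzRing.Build (lendo V)
  lendo_mulA lendo_mul1 lendo_mulr1 lendo_mulDl lendo_mulDr.

Fact lendo_scaleA a b f : lendoZ a (lendoZ b f) = lendoZ (a * b) f.
Proof. by apply: lendoP => v /=; rewrite scalerA. Qed.
Fact lendo_scale1 : left_id 1 lendoZ.
Proof. by move=> f; apply: lendoP => v /=; rewrite scale1r. Qed.
Fact lendo_scaleDr : right_distributive lendoZ +%R.
Proof. by move=> c f g; apply: lendoP => v; exact: scalerDr. Qed.
Fact lendo_scaleDl f : {morph lendoZ^~ f : a b / a + b}.
Proof. by move=> a b; apply: lendoP => v; exact: scalerDl. Qed.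
Fact lendo_scaleAl c f g : lendoZ c (f * g) = lendoZ c f * g.
Proof. exact: lendoP. Qed.
Fact lendo_scaleAr c f g : lendoZ c (f * g) = f * lendoZ c g.
Proof. by apply: lendoP => v /=; rewrite linearZ. Qed.
HB.instance Definition _ := PzRing_isPzAlgebra.Build k (lendo V)
  lendo_scaleA lendo_scale1 lendo_scaleDr lendo_scaleDl lendo_scaleAl
  lendo_scaleAr.

Definition lendo_alg : pzAlgType k := lendo V.

Lemma lendo0E v : (0 : lendo_alg) v = 0. Proof. by []. Qed.
Lemma lendo1E v : (1 : lendo_alg) v = v. Proof. by []. Qed.
Lemma lendoDE (f g : lendo_alg) v : (f + g) v = f v + g v. Proof. by []. Qed.
Lemma lendoNE (f : lendo_alg) v : (- f) v = - f v. Proof. by []. Qed.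
Lemma lendoME (f g : lendo_alg) v : (f * g) v = f (g v). Proof. by []. Qed.
Lemma lendoZE c (f : lendo_alg) v : (c *: f) v = c *: f v. Proof. by []. Qed.
Lemma lendo_sumE (J : Type) (r : seq J) (P : pred J) (F : J -> lendo_alg) v :
  (\sum_(i <- r | P i) F i) v = \sum_(i <- r | P i) F i v.
Proof.
elim/big_rec2: _ => [|i u w _ <-]; first exact: lendo0E.
exact: lendoDE.
Qed.
Definition lendoE := (lendo0E, lendo1E, lendoDE, lendoNE, lendoME, lendoZE, lendo_sumE).

Lemma lendo_v0 f : f 0 = 0. Proof. exact: linear0. Qed.
Lemma lendo_vD f u v : f (u + v) = f u + f v. Proof. exact: linearD. Qed.
Lemma lendo_vN f v : f (- v) = - f v. Proof. exact: linearN. Qed.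
Lemma lendo_vB f u v : f (u - v) = f u - f v. Proof. exact: linearB. Qed.
Lemma lendo_vZ f c v : f (c *: v) = c *: f v. Proof. exact: linearZ. Qed.
Lemma lendo_vsum f (J : Type) (r : seq J) (P : pred J) (F : J -> V) :
  f (\sum_(i <- r | P i) F i) = \sum_(i <- r | P i) f (F i).
Proof. exact: linear_sum. Qed.
End Lendo.

Definition mk_linear (k : comNzRingType) (U V : lmodType k) (g : U -> V)
    (lg : linear g) : {linear U -> V} :=
  HB.pack g (GRing.isLinear.Build k U V *:%R g lg).

Definition mk_scalar (k : comNzRingType) (U : lmodType k) (g : U -> k)
    (lg : linear_for *%R g) : {scalar U} :=
  HB.pack g (GRing.isLinear.Build k U k *%R g lg).

(* The linearity lemmas of the library leave a non-simplified structure around *)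
(* the linear map; these variants do not.                                      *)
Section LinearSimpl.
Variables (k : comNzRingType) (U V : lmodType k) (r : {linear U -> V}).
Lemma linZ c u : r (c *: u) = c *: r u. Proof. exact: linearZ. Qed.
Lemma linN u : r (- u) = - r u. Proof. exact: linearN. Qed.
Lemma lin_sum (J : Type) (s : seq J) (P : pred J) (F : J -> U) :
  r (\sum_(i <- s | P i) F i) = \sum_(i <- s | P i) r (F i).
Proof. exact: linear_sum. Qed.
End LinearSimpl.

Record dual_bases (k : comNzRingType) (A : pzAlgType k)
    (par : bool -> A -> Prop) (trA : {scalar A}) (I : finType)
    (B Bd : I -> A) : Prop := DualBases {
  db_sym : is_symmetric_superalgebra par trA;
  db_basis : is_basis B;
  db_homog : forall b, exists p, par p (B b);
  db_dual : forall a b, trA (Bd a * B b) = (a == b)%:R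
}.

Section SuperAlgebra.
Variables (k : comNzRingType) (A : pzAlgType k) (par : bool -> A -> Prop).
Hypothesis sA : is_superalgebra par.

Lemma par_linear_eq (V : lmodType k) (g h : {linear A -> V}) :
  (forall p a, par p a -> g a = h a) -> g =1 h.
Proof.
move=> gh a; have [a0 [a1 [p0 p1 ->]]] := par_span sA a.
by rewrite !linearD (gh _ _ p0) (gh _ _ p1).
Qed.
End SuperAlgebra.

Section DualBases.
Variables (k : comNzRingType) (A : pzAlgType k) (par : bool -> A -> Prop).
Variables (trA : {scalar A}) (I : finType) (B Bd : I -> A).
Hypothesis HA : dual_bases par trA B Bd.
Let sA : is_superalgebra par := sym_super (db_sym HA).

Let db_dualE a b : trA (Bd a * B b) = (a == b)%:R.
Proof. exact: db_dual HA a b. Qed.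

Lemma crdE a : a = \sum_b trA (Bd b * a) *: B b.
Proof.
have [c [ac _]] := db_basis HA a.
rewrite {1}ac; apply: eq_bigr => b _; congr (_ *: _); rewrite ac mulr_sumr.
rewrite linear_sum (bigD1 b) //= -pz_scalerAr linearZ /= db_dualE eqxx mulr1.
rewrite big1 ?addr0 // => i nib.
by rewrite -pz_scalerAr linearZ /= db_dualE eq_sym (negPf nib) mulr0.
Qed.

Lemma eq_trA a a' : (forall b, trA (a * B b) = trA (a' * B b)) -> a = a'.
Proof.
move=> aa'.
have phiP : linear_for *%R (fun b => trA (a * b)).
  by move=> c u v; rewrite mulrDr -pz_scalerAr linearP.
have [x [_ xu]] := tr_dual_bij (db_sym HA) (mk_scalar phiP).
rewrite -(xu a) // -(xu a') // => b /=.
rewrite (crdE b) !mulr_sumr !linear_sum; apply: eq_bigr => i _.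
by rewrite -!pz_scalerAr !linearZ /= aa'.
Qed.

Lemma crd_dualE a : a = \sum_b trA (a * B b) *: Bd b.
Proof.
apply: eq_trA => b; rewrite mulr_suml linear_sum (bigD1 b) //=.
rewrite -pz_scalerAl linearZ /= db_dualE eqxx mulr1.
rewrite big1 ?addr0 // => i nib.
by rewrite -pz_scalerAl linearZ /= db_dualE (negPf nib) mulr0.
Qed.

Definition pb (b : I) : bool := `[< par true (B b) >].

Lemma par_B b : par (pb b) (B b).
Proof.
rewrite /pb; case: asboolP => // np; have [[] pB //] := db_homog HA b.
Qed.

Lemma tr_odd p q a b : par p a -> par q b -> p (+) q -> trA (a * b) = 0.
Proof.
move=> pa qb pq; apply: tr_even (db_sym HA) _ _.
by rewrite -pq; exact: par_M.
Qed.

(** The component of b^vee of the wrong parity pairs to 0 with every c of the parity of b, for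
    parity reasons. It also pairs to 0 with every other c, since tr(b^vee c) = 0 and the component
    of the right parity contributes nothing. So it vanishes by nondegeneracy. *)
Lemma par_Bd b : par (pb b) (Bd b).
Proof.
have [a0 [a1 [p0 p1 e]]] := par_span sA (Bd b).
have key p (x y : A) : par p x -> par (~~ p) y -> Bd b = x + y ->
    pb b = p -> par (pb b) (Bd b).
  move=> px py exy pbE; rewrite exy pbE; suff -> : y = 0 by rewrite addr0.
  apply: eq_trA => c; rewrite mul0r linear0.
  have [->|ncb] := eqVneq c b.
    by apply: tr_odd py (par_B b) _; rewrite pbE; case: (p).
  have [epc|npc] := eqVneq (pb c) p.
    by apply: tr_odd py (par_B c) _; rewrite epc; case: (p).
  have := db_dualE b c; rewrite exy mulrDl linearD (tr_odd px (par_B c)) ?add0r.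
    by move=> /= ->; rewrite eq_sym (negPf ncb).
  by case: (p) (pb c) npc => [] [].
have [pbE|pbE] := boolP (pb b).
  by rewrite -[true]pbE; apply: (key true a1 a0) => //; rewrite addrC.
by rewrite -(negbTE pbE); apply: (key false a0 a1) => //; rewrite (negbTE pbE).
Qed.

Lemma crd_odd p a b : par p a -> pb b != p -> trA (Bd b * a) = 0.
Proof.
by move=> pa nb; apply: tr_odd (par_Bd b) pa _; case: (p) (pb b) nb => [] [].
Qed.

Lemma trA_C p q a b : par p a -> par q b ->
  trA (a * b) = (-1) ^+ (p && q) * trA (b * a).
Proof. by move=> pa qb; exact: (tr_supersym (db_sym HA) pa qb). Qed.

Section Twist.
Variable p : bool.
(** The sign that a homogeneous element gets when it passes something of parity p, extended linearly
    to all of A through the coordinates in the homogeneous basis. *)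
Fact twist_subproof : {t : {linear A -> A} |
  forall a, t a = \sum_b ((-1) ^+ (p && pb b) * trA (Bd b * a)) *: B b}.
Proof.
have L : linear (fun a => \sum_b ((-1) ^+ (p && pb b) * trA (Bd b * a)) *: B b).
  move=> c u v; rewrite scaler_sumr -big_split; apply: eq_bigr => b _ /=.
  rewrite mulrDr -pz_scalerAr linearP scalerA -scalerDl /=; congr (_ *: _).
  by rewrite mulrDr mulrCA.
by exists (mk_linear L).
Qed.
Definition twist := sval twist_subproof.
Lemma twistE q a : par q a -> twist a = (-1) ^+ (p && q) *: a.
Proof.
move=> qa; rewrite (svalP twist_subproof) {2}(crdE a) scaler_sumr; apply: eq_bigr => b _ /=.
have [->|nb] := eqVneq (pb b) q; first by rewrite scalerA.
by rewrite (crd_odd qa nb) mulr0 !scale0r scaler0.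
Qed.
End Twist.

(* For r1, r2 the inclusions of the tensor factors i, j this is t_(i,j). *)
Definition tel (E : pzAlgType k) (r1 r2 : A -> E) : E :=
  \sum_b r1 (B b) * r2 (Bd b).

(** * Teleporters and the movement of labels along them *)

Section Teleporter.
Variable E : pzAlgType k.
Implicit Types r : {linear A -> E}.

Definition scomm r1 r2 := forall p q a b, par p a -> par q b ->
  r1 a * r2 b = (-1) ^+ (p && q) *: (r2 b * r1 a).

Definition amorph r := r 1 = 1 /\ forall a b, r (a * b) = r a * r b.

Lemma scommC r1 r2 : scomm r1 r2 -> scomm r2 r1.
Proof.
move=> C p q a b pa qb; rewrite (C q p) // scalerA andbC.
by rewrite -exprD addnn -signr_odd odd_double scale1r.
Qed.

(** Expanding the elements of the basis in the dual basis on both sides, the sign from the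
    supersymmetry of tr cancels the sign of exchanging the two legs. *)
Lemma telC r1 r2 : scomm r1 r2 -> tel r1 r2 = tel r2 r1.
Proof.
move=> C; rewrite /tel.
under eq_bigr => b _ do rewrite {1}(crd_dualE (B b)) linear_sum mulr_suml.
rewrite exchange_big; apply: eq_bigr => c _ /=.
rewrite [r2 (B c)](congr1 r2 (crd_dualE (B c))) linear_sum mulr_suml.
apply: eq_bigr => b _; rewrite !linearZ /= -!pz_scalerAl.
rewrite (trA_C (par_B b) (par_B c)) (C _ _ _ _ (par_Bd c) (par_Bd b)) scalerA.
by rewrite mulrAC andbC -exprD addnn -signr_odd odd_double mul1r.
Qed.

(** Both sides are the sum over b, c of tr(c^vee a b) times r1(c) r2(b^vee). *)
Lemma tel_mull r1 r2 a : amorph r1 -> amorph r2 ->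
  r1 a * tel r1 r2 = tel r1 r2 * r2 a.
Proof.
move=> [_ M1] [_ M2]; rewrite mulr_sumr mulr_suml.
under eq_bigr => b _ do
  rewrite mulrA -M1 (crdE (a * B b)) linear_sum mulr_suml.
rewrite exchange_big; apply: eq_bigr => c _ /=.
rewrite -mulrA -M2 (crd_dualE (Bd c * a)) linear_sum mulr_sumr.
apply: eq_bigr => b _.
by rewrite !linearZ /= -pz_scalerAl -pz_scalerAr mulrA.
Qed.

Lemma tel_mulr r1 r2 a : scomm r1 r2 -> amorph r1 -> amorph r2 ->
  r2 a * tel r1 r2 = tel r1 r2 * r1 a.
Proof. by move=> C A1 A2; rewrite telC // tel_mull. Qed.

(** As b and b^vee have the same parity, the signs from passing the two legs cancel. *)
Lemma tel_comm r1 r2 r3 a : scomm r1 r3 -> scomm r2 r3 ->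
  r3 a * tel r1 r2 = tel r1 r2 * r3 a.
Proof.
move=> C1 C2; have L1 : linear (fun a => r3 a * tel r1 r2).
  by move=> c u v; rewrite linearP mulrDl pz_scalerAl.
have L2 : linear (fun a => tel r1 r2 * r3 a).
  by move=> c u v; rewrite linearP mulrDr pz_scalerAr.
apply: (par_linear_eq sA (g := mk_linear L1) (h := mk_linear L2)) => p {}a pa /=.
rewrite mulr_sumr mulr_suml; apply: eq_bigr => b _.
rewrite mulrA (scommC C1 pa (par_B b)) -pz_scalerAl -mulrA.
rewrite (scommC C2 pa (par_Bd b)) -pz_scalerAr scalerA.
by rewrite -exprD addnn -signr_odd odd_double scale1r mulrA.
Qed.

Lemma tel_intertwine (u : E) (r1 r2 r1' r2' : A -> E) :
  (forall a, u * r1 a = r1' a * u) -> (forall a, u * r2 a = r2' a * u) ->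
  u * tel r1 r2 = tel r1' r2' * u.
Proof.
move=> h1 h2; rewrite mulr_sumr mulr_suml; apply: eq_bigr => b _.
by rewrite mulrA h1 -mulrA h2 mulrA.
Qed.
End Teleporter.
End DualBases.

(** * The Ariki-Koike presentation *)

Lemma addrB_cancel (V : zmodType) (w p q r : V) :
  w - (p + r) - (w - (q + r)) = q - p.
Proof. by rewrite opprB addrC addrA subrK opprD addrACA subrr addr0. Qed.

Section HeckeDatum.
Variables (k : comNzRingType) (A : pzAlgType k) (par : bool -> A -> Prop).
Variables (trA : {scalar A}) (I : finType) (B Bd : I -> A).
Hypothesis HA : dual_bases par trA B Bd.
Variables (z : k) (d : nat) (f : 'I_d -> A).

Section Def.
Variable E : pzAlgType k.

(* A representation of the cyclotomic algebra on n strands in terms of the      *)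
(* generators A_l, T_i and the first polynomial generator only; this is the     *)
(* Ariki-Koike presentation.                                                    *)
Record hecke_datum (n : nat) (rA : nat -> {linear A -> E}) (rT : nat -> E)
    (rX : E) : Prop := HeckeDatum {
  hd_A : forall l, (l < n)%N -> amorph (rA l);
  hd_AC : forall l m, (l < n)%N -> (m < n)%N -> l != m ->
    scomm par (rA l) (rA m);
  hd_TAl : forall i a, (i.+1 < n)%N -> rT i * rA i a = rA i.+1 a * rT i;
  hd_TAr : forall i a, (i.+1 < n)%N -> rT i * rA i.+1 a = rA i a * rT i;
  hd_TA : forall i l a, (i.+1 < n)%N -> (l < n)%N -> l != i -> l != i.+1 ->
    rT i * rA l a = rA l a * rT i;
  hd_quad : forall i, (i.+1 < n)%N ->
    rT i * rT i = z *: (tel B Bd (rA i) (rA i.+1) * rT i) + 1;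
  hd_braid : forall i, (i.+2 < n)%N ->
    rT i * rT i.+1 * rT i = rT i.+1 * rT i * rT i.+1;
  hd_TT : forall i j, (i.+1 < j)%N -> (j.+1 < n)%N -> rT i * rT j = rT j * rT i;
  hd_XA : forall l a, (l < n)%N -> rX * rA l a = rA l a * rX;
  hd_XT : forall i, (0 < i)%N -> (i.+1 < n)%N -> rX * rT i = rT i * rX;
  hd_XTXT : (1 < n)%N -> rX * rT 0%N * rX * rT 0%N = rT 0%N * rX * rT 0%N * rX;
  hd_cyc : (0 < n)%N ->
    rX ^+ d + \sum_(i < d) rA 0%N (f i) * rX ^+ i = 0
}.

Lemma commZ (c : k) (x y : E) : GRing.comm x y -> GRing.comm x (c *: y).
Proof. by rewrite /GRing.comm => xy; rewrite -pz_scalerAr xy pz_scalerAl. Qed.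

Lemma comm_inv (x y y' : E) : y * y' = 1 -> y' * y = 1 -> GRing.comm x y ->
  GRing.comm x y'.
Proof.
move=> yy' y'y xy; rewrite /GRing.comm -[x in LHS]mul1r -y'y -!mulrA.
by congr (_ * _); rewrite mulrA -xy -mulrA yy' mulr1.
Qed.

Lemma comm_conj (u x a b : E) : u * a = b * u -> u * b = a * u ->
  GRing.comm x b -> GRing.comm (u * x * u) a.
Proof.
move=> ua ub xb; rewrite /GRing.comm -mulrA ua mulrA -(mulrA u) xb !mulrA.
by rewrite ub.
Qed.

(** * Consequences of the presentation: the polynomial generators and their commutation rules *)

Section Theory.
Variables (n : nat) (rA : nat -> {linear A -> E}) (rT : nat -> E) (rX : E).
Hypothesis Hd : hecke_datum n rA rT rX.

Local Notation tl l m := (tel B Bd (rA l) (rA m)).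
(** The inverse of T_i, solved from the quadratic relation. *)
Definition Tinv (i : nat) : E := rT i - z *: tl i i.+1.
(** The generator X_j, in the manner of Jucys-Murphy elements. *)
Fixpoint jm (j : nat) : E := if j is i.+1 then rT i * jm i * rT i else rX.

Lemma tlC l m : (l < n)%N -> (m < n)%N -> l != m -> tl l m = tl m l.
Proof. by move=> ln mn nlm; apply: (telC HA); apply: (hd_AC Hd). Qed.

Lemma commT_tl i : (i.+1 < n)%N -> GRing.comm (rT i) (tl i i.+1).
Proof.
move=> iN; rewrite /GRing.comm.
rewrite (tel_intertwine B Bd (fun a => hd_TAl Hd a iN) (fun a => hd_TAr Hd a iN)).
by congr (_ * _); apply: tlC => //; lia.
Qed.

Lemma quadE i : (i.+1 < n)%N -> rT i * rT i = z *: (tl i i.+1 * rT i) + 1.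
Proof. exact: (hd_quad Hd). Qed.

Lemma TinvT i : (i.+1 < n)%N -> Tinv i * rT i = 1.
Proof. by move=> iN; rewrite mulrBl quadE // -pz_scalerAl addrC addKr. Qed.

Lemma TTinv i : (i.+1 < n)%N -> rT i * Tinv i = 1.
Proof.
by move=> iN; rewrite mulrBr quadE // -pz_scalerAr (commT_tl iN) addrC addKr.
Qed.

Lemma jmA j l a : (j < n)%N -> (l < n)%N -> GRing.comm (jm j) (rA l a).
Proof.
elim: j l => [|j IH] l jn ln /=; first exact: (hd_XA Hd).
have [->|nlj] := eqVneq l j.
  by apply: (comm_conj (hd_TAl Hd a jn) (hd_TAr Hd a jn)); apply: IH; lia.
have [->|nlj'] := eqVneq l j.+1.
  by apply: (comm_conj (hd_TAr Hd a jn) (hd_TAl Hd a jn)); apply: IH; lia.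
have cT : GRing.comm (rT j) (rA l a) by exact: (hd_TA Hd).
apply: commr_sym; do 2?apply: commrM; apply: commr_sym => //.
by apply: IH; lia.
Qed.

Lemma comm_tel (x : E) (r1 r2 : A -> E) : (forall a, GRing.comm x (r1 a)) ->
  (forall a, GRing.comm x (r2 a)) -> GRing.comm x (tel B Bd r1 r2).
Proof.
move=> cl cm; rewrite /GRing.comm mulr_sumr mulr_suml; apply: eq_bigr => b _.
by rewrite mulrA cl -mulrA cm mulrA.
Qed.

Lemma jm_tl j l m : (j < n)%N -> (l < n)%N -> (m < n)%N ->
  GRing.comm (jm j) (tl l m).
Proof. by move=> jn ln mn; apply: comm_tel => a; apply: jmA. Qed.

Lemma TTC i j : (i.+1 < j)%N || (j.+1 < i)%N -> (i.+1 < n)%N -> (j.+1 < n)%N ->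
  GRing.comm (rT i) (rT j).
Proof.
by case/orP=> ij iN jN; [apply: (hd_TT Hd) | apply: commr_sym; apply: (hd_TT Hd)].
Qed.

Lemma braid i : (i.+2 < n)%N ->
  rT i * (rT i.+1 * rT i) = rT i.+1 * (rT i * rT i.+1).
Proof. by move=> iN; rewrite !mulrA; apply: (hd_braid Hd). Qed.

Lemma jmT_gt i j : (j < i)%N -> (i.+1 < n)%N -> GRing.comm (rT i) (jm j).
Proof.
elim: j => [|j IH] ji iN /=; first by apply: commr_sym; apply: (hd_XT Hd).
have c1 : GRing.comm (rT i) (rT j) by apply: TTC; lia.
by do 2?apply: commrM => //; apply: IH => //; exact: ltnW.
Qed.

(** The case j = i+2 is the braid relation: T_i passes T_(i+1) T_i as T_(i+1), commutes in that form
    with X_i, and becomes T_i again on the other side. Higher j follow by conjugation. *)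
Lemma jmT_lt i j : (i.+1 < j)%N -> (j < n)%N -> GRing.comm (rT i) (jm j).
Proof.
elim: j => [|j IH] ij jn //=; have [ej|nij] := eqVneq i.+1 j; last first.
  have c1 : GRing.comm (rT i) (rT j) by apply: TTC; lia.
  by do 2?apply: commrM => //; apply: IH; lia.
rewrite -{}ej in jn *; rewrite /= /GRing.comm.
rewrite !mulrA (hd_braid Hd) // -!mulrA; congr (_ * (_ * _)).
have c1 : rT i.+1 * jm i = jm i * rT i.+1 by apply: jmT_gt; lia.
by rewrite mulrA c1 -!mulrA braid.
Qed.

Lemma jmT i j : (i.+1 < n)%N -> (j < n)%N -> j != i -> j != i.+1 ->
  GRing.comm (rT i) (jm j).
Proof.
move=> iN jn ji ji'; have [lt|ge] := ltnP j i; first exact: jmT_gt.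
by apply: jmT_lt; lia.
Qed.

(** For X_0 and X_1 this is the relation [hd_XTXT]; the other cases follow from it by conjugation
    with crossings that commute with the other factor. *)
Lemma jm_comm i j : (i < n)%N -> (j < n)%N -> GRing.comm (jm i) (jm j).
Proof.
wlog le : i j / (i < j)%N => [W|].
  have [lt|gt|->] := ltngtP i j; first exact: W; last by [].
  by move=> iN jn; apply: commr_sym; apply: W.
elim: i j le => [|i IH] j ij iN jn /=.
  case: j ij jn => // j _; elim: j => [|j IHj] jn /=.
    rewrite /GRing.comm !mulrA; exact: (hd_XTXT Hd).
  have c1 : GRing.comm rX (rT j.+1) by apply: (hd_XT Hd).
  by do 2?apply: commrM => //; apply: IHj; lia.
have c1 : GRing.comm (rT i) (jm j) by apply: jmT; lia.
apply: commr_sym; do 2?apply: commrM; apply: commr_sym => //.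
by apply: IH; lia.
Qed.

Lemma T_jm i : (i.+1 < n)%N ->
  rT i * jm i = jm i.+1 * rT i - z *: (tl i i.+1 * jm i.+1).
Proof.
move=> iN; have c1 : tl i i.+1 * jm i.+1 = jm i.+1 * tl i i.+1.
  by apply: commr_sym; apply: jm_tl; lia.
by rewrite c1 pz_scalerAr -mulrBr -/(Tinv i) /= -[RHS]mulrA TTinv // mulr1.
Qed.

(** Obtained by iterating [T_jm]. It matters later that the exponents of X_(i+1) in the sum run from
    1 to j, so that 0 does not occur. *)
Lemma T_jmX i j : (i.+1 < n)%N ->
  rT i * jm i ^+ j = jm i.+1 ^+ j * rT i
    - z *: (tl i i.+1 * \sum_(l < j) jm i ^+ (j - l.+1) * jm i.+1 ^+ l.+1).
Proof.
move=> iN; elim: j => [|j IH].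
  by rewrite big_ord0 mulr0 scaler0 subr0 !expr0 mulr1 mul1r.
rewrite exprSr mulrA IH mulrBl -mulrA T_jm // mulrBr mulrA -exprSr.
rewrite -addrA -opprD; congr (_ - _).
rewrite -pz_scalerAr -pz_scalerAl -scalerDr -mulrA; congr (_ *: _).
have c1 : jm i.+1 ^+ j * tl i i.+1 = tl i i.+1 * jm i.+1 ^+ j.
  by apply: commr_sym; apply: commrX; apply: commr_sym; apply: jm_tl; lia.
rewrite mulrA c1 -mulrA -mulrDr -exprSr; congr (_ * _).
have jE : (j.+1 - j.+1 = 0)%N by rewrite subnn.
rewrite big_ord_recr [nat_of_ord ord_max]/= jE expr0 mul1r addrC; congr (_ + _).
rewrite mulr_suml; apply: eq_bigr => l _.
have -> : (j.+1 - l.+1 = (j - l.+1).+1)%N by have := ltn_ord l; lia.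
have c2 : GRing.comm (jm i) (jm i.+1 ^+ l.+1).
  by apply: commrX; apply: jm_comm; lia.
by rewrite -!mulrA -c2 mulrA -exprSr.
Qed.

Lemma T_jmXr i j : (i.+1 < n)%N ->
  rT i * jm i.+1 ^+ j = jm i ^+ j * rT i
    + z *: (tl i i.+1 * \sum_(l < j) jm i ^+ (j - l.+1) * jm i.+1 ^+ l.+1).
Proof.
move=> iN; elim: j => [|j IH].
  by rewrite big_ord0 mulr0 scaler0 addr0 !expr0 mulr1 mul1r.
have TX : rT i * jm i.+1 = jm i * rT i + z *: (tl i i.+1 * jm i.+1).
  rewrite {1}/jm -/(jm i) !mulrA quadE // !mulrDl !mul1r addrC; congr (_ + _).
  by rewrite -!pz_scalerAl -!mulrA.
rewrite exprSr mulrA IH mulrDl -mulrA TX mulrDr mulrA -exprSr -addrA.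
congr (_ + _); rewrite -pz_scalerAr -pz_scalerAl -scalerDr; congr (_ *: _).
have c1 : jm i ^+ j * tl i i.+1 = tl i i.+1 * jm i ^+ j.
  by apply: commr_sym; apply: commrX; apply: commr_sym; apply: jm_tl; lia.
rewrite mulrA c1 -!mulrA -mulrDr; congr (_ * _).
rewrite big_ord_recl [nat_of_ord ord0]/= subn1 expr1 [j.+1.-1]/=; congr (_ + _).
rewrite mulr_suml; apply: eq_bigr => l _; rewrite -mulrA -exprSr.
by rewrite [nat_of_ord (lift _ _)]/= /bump /= add1n subSS.
Qed.

Local Notation X := rX.
Local Notation T := (rT 0%N).
Local Notation t := (tl 0%N 1%N).
Local Notation c := (T * X - X * T).

(** The commutator of T_0 and X_0 intertwines X_0 and X_1: in T X T (T X - X T) the quadratic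
    relation gives the same teleporter term twice, and the two cancel. *)
Lemma jm1_c j : (1 < n)%N -> jm 1 ^+ j * c = c * X ^+ j.
Proof.
move=> n1; elim: j => [|j IH]; first by rewrite !expr0 mulr1 mul1r.
have n0 : (0 < n)%N by exact: ltnW.
suff H : jm 1 * c = c * X.
  by rewrite exprSr -mulrA H mulrA IH -mulrA -exprSr.
rewrite mulrBr mulrBl /=.
have cXT : T * X * T * X = X * T * X * T by rewrite (hd_XTXT Hd).
have cX : X * t = t * X by apply: (jm_tl (j := 0)).
have cT : T * t = t * T by apply: commT_tl.
have q : T * T = z *: (t * T) + 1 by apply: quadE.
have -> : T * X * T * (T * X) = z *: (t * (T * X * T * X)) + T * X * X.
  rewrite !mulrA -(mulrA (T * X)) q mulrDr mulr1 mulrDl; congr (_ + _).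
  rewrite -pz_scalerAr -pz_scalerAl !mulrA; congr (_ *: _); congr (_ * _ * _).
  by rewrite -mulrA cX mulrA cT.
have -> : T * X * T * (X * T) = z *: (t * (T * X * T * X)) + X * T * X.
  have -> : T * X * T * (X * T) = X * T * X * (T * T) by rewrite !mulrA cXT.
  rewrite q mulrDr mulr1 -pz_scalerAr cXT; congr (_ *: _ + _).
  by rewrite mulrA -(mulrA (X * T) X t) cX !mulrA -(mulrA X T t) cT mulrA cX.
by rewrite opprD addrACA subrr add0r.
Qed.

(** This measures how far T X^j T is from commuting with X, and is the source of the action of X_0
    on the induced module. The induction on j writes T X^(j+1) T as X (T X^j T) + X_1^j u T with u =
    T X - X T. *)
Lemma ak_relation j : (1 < n)%N ->
  T * X ^+ j * T * X - X * T * X ^+ j * T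
    = z *: (t * (X ^+ j * T * X - X * T * X ^+ j)).
Proof.
move=> n1.
have cX : X * t = t * X by apply: (jm_tl (j := 0)) => //; exact: ltnW.
have cT : T * t = t * T by apply: commT_tl.
have q : T * T = z *: (t * T) + 1 by apply: quadE.
have [u uE] : exists u, u = c by exists c.
have Ju i : jm 1 ^+ i * u = u * X ^+ i by rewrite uE jm1_c.
have XT : T * X = X * T + u by rewrite uE addrC subrK.
have cXJ : X * jm 1 ^+ j = jm 1 ^+ j * X.
  by apply: commrX; apply: (jm_comm (i := 0)) => //; exact: ltnW.
elim: j cXJ => [|j IH] cXJ.
  rewrite expr0 !mulr1 mul1r q -mulrA q mulrDl mulrDr mulr1 mul1r opprD addrACA.
  rewrite subrr addr0 -pz_scalerAl -pz_scalerAr -scalerBr; congr (_ *: _).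
  by rewrite mulrBr !mulrA cX.
have {}cXJ : X * jm 1 ^+ j = jm 1 ^+ j * X.
  by apply: commrX; apply: (jm_comm (i := 0)) => //; exact: ltnW.
have -> : T * X ^+ j.+1 * T = X * (T * X ^+ j * T) + jm 1 ^+ j * u * T.
  by rewrite exprS Ju (mulrA T) XT !mulrDl !mulrA.
have -> : X * T * X ^+ j.+1 * T
    = X * (X * T * X ^+ j * T) + X * jm 1 ^+ j * u * T.
  rewrite -(mulrA X (jm 1 ^+ j)) Ju exprS !mulrA -(mulrA X T) XT.
  by rewrite mulrDr !mulrDl !mulrA.
have -> : X ^+ j.+1 * T * X - X * T * X ^+ j.+1
    = X * (X ^+ j * T * X - X * T * X ^+ j) - X * u * X ^+ j.
  rewrite !exprS mulrBr !mulrA -addrA -opprD; congr (_ - _).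
  by rewrite -(mulrA X T) XT mulrDr mulrDl !mulrA.
rewrite mulrDl opprD addrACA.
have -> : X * (T * X ^+ j * T) * X - X * (X * T * X ^+ j * T)
    = X * (T * X ^+ j * T * X - X * T * X ^+ j * T) by rewrite mulrBr !mulrA.
rewrite IH // -pz_scalerAr mulrA cX -(mulrA t X).
rewrite [in RHS]mulrBr scalerBr; congr (_ + _).
have e : u * (T * X) - X * (u * T) = - (z *: (t * (X * u))).
  have XTXT : T * X * T * X = X * T * X * T by rewrite (hd_XTXT Hd).
  have X1 : X * T * T * X = z *: (t * (X * (T * X))) + X * X.
    rewrite -(mulrA X) q mulrDr mulr1 mulrDl -pz_scalerAr -pz_scalerAl.
    by rewrite mulrA cX -!mulrA.
  have X2 : X * X * T * T = z *: (t * (X * (X * T))) + X * X.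
    rewrite -(mulrA (X * X)) q mulrDr mulr1 -pz_scalerAr -(mulrA X).
    by rewrite (mulrA X t) cX !mulrA cX.
  rewrite uE mulrBl (mulrBl T) (mulrBr X) !mulrA XTXT X1 X2.
  rewrite addrB_cancel (mulrBr (t * X)) scalerBr !mulrA opprB //.
have -> : jm 1 ^+ j * u * T * X - X * jm 1 ^+ j * u * T
    = jm 1 ^+ j * (u * (T * X) - X * (u * T)) by rewrite mulrBr !mulrA cXJ.
have cJt : jm 1 ^+ j * t = t * jm 1 ^+ j.
  apply: commr_sym; apply: commrX; apply: commr_sym; apply: jm_tl => //.
  exact: ltnW.
rewrite e mulrN -pz_scalerAr; congr (- (_ *: _)).
by rewrite mulrA cJt -!mulrA (mulrA _ X u) -cXJ -!mulrA Ju.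
Qed.

(** Here [sup j] is T_(j-1) ... T_0, [sdn j] is T_0 ... T_(j-1), and [sinv j] is the inverse of
    [sdn j]; they carry one strand between the positions 0 and j. *)
Fixpoint sup (j : nat) : E := if j is i.+1 then rT i * sup i else 1.
Fixpoint sdn (j : nat) : E := if j is i.+1 then sdn i * rT i else 1.
Fixpoint sinv (j : nat) : E := if j is i.+1 then Tinv i * sinv i else 1.

Lemma sdn_sinv j : (j < n)%N -> sdn j * sinv j = 1.
Proof.
elim: j => [|j IH] jn /=; first by rewrite mulr1.
by rewrite mulrA -(mulrA (sdn j)) TTinv // mulr1 IH //; lia.
Qed.

Lemma inv_swap (u u' x y : E) : u * u' = 1 -> u' * u = 1 -> u * x = y * u ->
  x * u' = u' * y.
Proof.
by move=> uu' u'u ux; rewrite -[x in LHS]mul1r -u'u -(mulrA u') ux -!mulrA uu' mulr1.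
Qed.

Lemma Tinv_Al i a : (i.+1 < n)%N -> rA i a * Tinv i = Tinv i * rA i.+1 a.
Proof.
by move=> iN; apply: (inv_swap (TTinv iN) (TinvT iN)); apply: (hd_TAl Hd).
Qed.
Lemma Tinv_Ar i a : (i.+1 < n)%N -> rA i.+1 a * Tinv i = Tinv i * rA i a.
Proof.
by move=> iN; apply: (inv_swap (TTinv iN) (TinvT iN)); apply: (hd_TAr Hd).
Qed.
Lemma Tinv_comm i (x : E) : (i.+1 < n)%N -> GRing.comm x (rT i) ->
  GRing.comm x (Tinv i).
Proof. by move=> iN; apply: comm_inv; [apply: TTinv | apply: TinvT]. Qed.

Lemma sinv_comm j (x : E) : (j < n)%N ->
  (forall i, (i < j)%N -> GRing.comm x (rT i)) -> GRing.comm x (sinv j).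
Proof.
elim: j => [|j IH] jn xT /=; first exact: commr1.
apply: commrM; first by apply: Tinv_comm => //; apply: xT.
by apply: IH => [|i ij]; [|apply: xT]; lia.
Qed.

(** Conjugation by [sdn j] shifts the strands below j up by one; [sinv_A0] says that strand j goes
    to 0, and [sinv_T] is the same shift for crossings. *)
Lemma sinv_A j l a : (l < j)%N -> (j < n)%N ->
  rA l a * sinv j = sinv j * rA l.+1 a.
Proof.
elim: j => // j IH lj jn /=; have [->|nlj] := eqVneq l j.
  rewrite mulrA Tinv_Al // -!mulrA; congr (_ * _).
  apply: sinv_comm => [|i ij]; first by lia.
  by apply/commr_sym/(hd_TA Hd); lia.
have c1 : rA l a * Tinv j = Tinv j * rA l a.
  by apply: Tinv_comm => //; apply/commr_sym/(hd_TA Hd); lia.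
by rewrite mulrA c1 -!mulrA IH //; lia.
Qed.

Lemma sinv_A0 j a : (j < n)%N -> rA j a * sinv j = sinv j * rA 0%N a.
Proof.
elim: j => [|j IH] jn /=; first by rewrite mulr1 mul1r.
by rewrite mulrA Tinv_Ar // -!mulrA IH //; lia.
Qed.

(** Letters of [sinv j] far from m commute with T_m; the two near ones are handled by the braid
    relation, read as conjugation by T_m T_(m+1). *)
Lemma sinv_T j m : (m.+1 < j)%N -> (j < n)%N -> rT m * sinv j = sinv j * rT m.+1.
Proof.
elim: j => // j IH mj jn /=; have [e|nmj] := eqVneq m.+1 j; last first.
  have c1 : rT m * Tinv j = Tinv j * rT m.
    by apply: Tinv_comm => //; apply: TTC; lia.
  by rewrite mulrA c1 -!mulrA IH //; lia.
rewrite -{}e in jn *; rewrite /= -!mulrA.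
have c2 : sinv m * rT m.+1 = rT m.+1 * sinv m.
  by apply/commr_sym/sinv_comm => [|i im]; [|apply: TTC]; lia.
have m1 : (m.+1 < n)%N by lia.
rewrite c2 !mulrA; congr (_ * _); rewrite -(mulrA (rT m)).
apply: (inv_swap (u := rT m * rT m.+1)); last by rewrite -mulrA braid.
  by rewrite -!mulrA (mulrA (rT m.+1)) TTinv // mul1r TTinv.
by rewrite -!mulrA (mulrA (Tinv m)) TinvT // mul1r TinvT.
Qed.

Lemma sinv_split j : (j.+1 < n)%N -> exists2 S, sinv j.+1 = S * Tinv 0 &
  GRing.comm rX S.
Proof.
elim: j => [|j IH] jn; first by exists 1; rewrite /= ?mulr1 ?mul1r //; apply: commr1.
have [|S e cS] := IH; first by lia.
exists (Tinv j.+1 * S); first by rewrite -mulrA -e.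
by apply: commrM => //; apply: Tinv_comm => //; apply: (hd_XT Hd).
Qed.
End Theory.
End Def.
End HeckeDatum.

(** * Induction from n to n+1 strands *)

Lemma addr_exchange (V : zmodType) (a c p q r u : V) :
  a - (q + c) - (p + r - u - c) = a - p - (q + r - u).
Proof.
rewrite opprB addrA opprD (addrA a) subrK -(addrA p r) -(addrA q r).
by rewrite (opprD p) (opprD q) (addrA (a - q)) (addrA (a - p)) (addrAC a).
Qed.

Section Induction.
Variables (k : comNzRingType) (A : pzAlgType k) (par : bool -> A -> Prop).
Variables (trA : {scalar A}) (I : finType) (B Bd : I -> A).
Hypothesis HA : dual_bases par trA B Bd.
Variables (z : k) (d : nat) (f : 'I_d -> A).
Hypothesis centf : forall i, supercentral par false (f i).

(* The strand carrying aI and Y is detached from the n others; ev plugs the    *)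
(* dots of the detached strand on the strand 0: ev (Y^j v) = x^j v if v has no *)
(* dot on the detached strand.                                                 *)
Record ind_datum (V : lmodType k) (n : nat) (aL : nat -> {linear A -> lendo_alg V})
    (aI : {linear A -> lendo_alg V}) (T : nat -> lendo_alg V)
    (x Y ev : lendo_alg V) : Prop := IndDatum {
  id_hecke : hecke_datum par B Bd z f n aL T x;
  id_I : amorph aI;
  id_LI : forall l, (l < n)%N -> scomm par (aL l) aI;
  id_TI : forall i a, (i.+1 < n)%N -> T i * aI a = aI a * T i;
  id_xI : forall a, (0 < n)%N -> x * aI a = aI a * x;
  id_YT : forall i, (i.+1 < n)%N -> Y * T i = T i * Y;
  id_Yx : (0 < n)%N -> Y * x = x * Y;
  id_YL : forall l a, (l < n)%N -> Y * aL l a = aL l a * Y;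
  id_YI : forall a, Y * aI a = aI a * Y;
  id_evT : forall i, (0 < i)%N -> (i.+1 < n)%N -> ev * T i = T i * ev;
  id_evx : (0 < n)%N -> ev * x = x * ev;
  id_evL : forall l a, (l < n)%N -> ev * aL l a = aL l a * ev;
  id_evI : forall a, ev * aI a = aI a * ev;
  id_evev : ev * ev = ev;
  id_evTev : (1 < n)%N -> ev * T 0%N * ev = T 0%N * ev;
  id_tevY : (0 < n)%N -> 
    tel B Bd (aL 0%N) aI * (ev * Y) = tel B Bd (aL 0%N) aI * (x * ev);
  id_ak : (1 < n)%N -> T 0%N * ev * T 0%N * x - x * T 0%N * ev * T 0%N
    = z *: (tel B Bd (aL 0%N) (aL 1%N) * (ev * T 0%N * x - x * T 0%N * ev));
  id_gen : forall g h : lendo_alg V,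
    (forall i, g * Y ^+ i * ev = h * Y ^+ i * ev) -> g = h;
  id_cyc : Y ^+ d + \sum_(i < d) aI (f i) * Y ^+ i = 0
}.

Lemma lendo_app (V : lmodType k) (g h : lendo_alg V) :
  g = h -> forall v, g v = h v.
Proof. by move->. Qed.

Lemma tel_central (E : pzAlgType k) (r1 r2 : {linear A -> E}) a :
  amorph r2 -> scomm par r1 r2 -> supercentral par false a ->
  r2 a * tel B Bd r1 r2 = tel B Bd r1 r2 * r2 a.
Proof.
move=> [_ M2] C [a0 ca]; rewrite mulr_sumr mulr_suml; apply: eq_bigr => b _.
rewrite mulrA (scommC C a0 (par_B HA b)) /= expr0 scale1r -!mulrA -!M2.
by rewrite (ca _ _ (par_Bd HA b)) expr0 scale1r.
Qed.

(** The leg of the second teleporter on strand 1 is carried to strand 3 by the first one. *)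
Lemma tel_tel (E : pzAlgType k) (r1 r2 r3 : {linear A -> E}) :
  amorph r1 -> amorph r3 -> scomm par r1 r3 -> scomm par r1 r2 ->
  scomm par r3 r2 ->
  tel B Bd r1 r3 * tel B Bd r2 r1 = tel B Bd r2 r3 * tel B Bd r1 r3.
Proof.
move=> A1 A3 C13 C12 C32; rewrite {2 3}/tel mulr_sumr mulr_suml.
apply: eq_bigr => b _; rewrite -mulrA (tel_mulr HA) // !mulrA.
by rewrite (tel_comm HA).
Qed.

(** * The operators on the induced module *)

Section Module.
Variables (V : lmodType k) (n : nat) (aL : nat -> {linear A -> lendo_alg V}).
Variables (aI : {linear A -> lendo_alg V}) (T : nat -> lendo_alg V).
Variables (x Y ev : lendo_alg V).
Hypothesis D : ind_datum n aL aI T x Y ev.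

(** Copy i holds the vectors whose detached strand is in position i: [yM i v] stands for T_(i-1) ...
    T_0 applied to v in copy 0. *)
Definition indM : lmodType k := {ffun 'I_n.+1 -> V}.

Fact yM_subproof : {y : nat -> {linear V -> indM} |
  forall i v (i' : 'I_n.+1), y i v i' = if i' == i :> nat then v else 0}.
Proof.
have L i : linear (fun v : V =>
    [ffun i' : 'I_n.+1 => if i' == i :> nat then v else 0] : indM).
  move=> c u v; apply/ffunP => i'; rewrite !ffunE; case: ifP => // _.
  by rewrite scaler0 addr0.
by exists (fun i => mk_linear (L i)) => i v i'; rewrite ffunE.
Qed.
Definition yM := sval yM_subproof.
Lemma yME i v (i' : 'I_n.+1) : yM i v i' = if i' == i :> nat then v else 0.
Proof. exact: (svalP yM_subproof). Qed.

Lemma yM_sum (m : indM) : m = \sum_(i < n.+1) yM i (m i).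
Proof.
apply/ffunP => i; rewrite sum_ffunE (bigD1 i) //= yME eqxx big1 ?addr0 //.
by move=> j ji; rewrite yME; case: eqP => // /val_inj ij; rewrite ij eqxx in ji.
Qed.

Lemma eq_indM (g h : lendo_alg indM) :
  (forall i v, (i <= n)%N -> g (yM i v) = h (yM i v)) -> g = h.
Proof.
move=> gh; apply: lendoP => m; rewrite (yM_sum m) !linear_sum.
by apply: eq_bigr => i _; apply: gh; rewrite -ltnS.
Qed.

(** Block matrices given by sparse columns: [F i] lists the target copies of copy i with the maps
    into them. *)
Fact bop_subproof (F : nat -> seq (nat * lendo_alg V)) : linear (fun m : indM =>
  \sum_(i < n.+1) \sum_(p <- F i) yM p.1 (p.2 (m i))).
Proof.
move=> c u v; rewrite scaler_sumr -big_split; apply: eq_bigr => i _ /=.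
rewrite scaler_sumr -big_split; apply: eq_bigr => p _ /=.
by rewrite !ffunE !linearP.
Qed.
Definition bop F : lendo_alg indM := Lendo (bop_subproof F).

Lemma bopE F i v : (i <= n)%N -> bop F (yM i v) = \sum_(p <- F i) yM p.1 (p.2 v).
Proof.
rewrite -ltnS => iN; rewrite /bop /=.
have other (j : 'I_n.+1) : j != Ordinal iN ->
    \sum_(p <- F j) yM p.1 (p.2 (yM i v j)) = 0.
  rewrite -val_eqE /= => ji; apply: big1 => p _.
  by rewrite yME (negPf ji) !linear0.
rewrite (bigD1 (Ordinal iN)) //= [X in _ + X]big1 ?addr0 //.
by apply: eq_bigr => p _; rewrite yME eqxx.
Qed.

Definition strand (i l : nat) : {linear A -> lendo_alg V} :=
  if (l < i)%N then aL l else if l == i then aI else aL l.-1.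

Fact iA_subproof : {r : nat -> {linear A -> lendo_alg indM} |
  forall l a i v, (i <= n)%N -> r l a (yM i v) = yM i (strand i l a v)}.
Proof.
have L l : linear (fun a => bop (fun i => [:: (i, strand i l a)])).
  move=> c a b; apply: eq_indM => i v iN.
  rewrite lendoDE lendoZE !bopE // !big_seq1 /= linearP lendoE.
  by rewrite linearD linearZ.
by exists (fun l => mk_linear (L l)) => l a i v iN; rewrite bopE ?big_seq1.
Qed.
Definition iA := sval iA_subproof.

Lemma iAE l a i v : (i <= n)%N -> iA l a (yM i v) = yM i (strand i l a v).
Proof. exact: (svalP iA_subproof). Qed.

Definition tI (l : nat) : lendo_alg V := tel B Bd (aL l) aI.

(** On the copies m and m+1 the crossing involves the detached strand, and the second entry is
    forced by the quadratic relation. On the other copies it is a crossing of V, renumbered if the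
    detached strand lies to its left. *)
Definition iT (m : nat) : lendo_alg indM := bop (fun i =>
  if i == m then [:: (m.+1, 1)]
  else if i == m.+1 then [:: (m, 1); (m.+1, z *: tI m)]
  else if (m < i)%N then [:: (i, T m)] else [:: (i, T m.-1)]).

Lemma iT_eq m v : (m <= n)%N -> iT m (yM m v) = yM m.+1 v.
Proof. by move=> mN; rewrite bopE // eqxx big_seq1. Qed.
Lemma iT_S m v : (m < n)%N ->
  iT m (yM m.+1 v) = yM m v + yM m.+1 ((z *: tI m) v).
Proof.
by move=> mN; rewrite bopE // eqxx gtn_eqF // big_cons big_seq1.
Qed.
Lemma iT_gt m i v : (m.+1 < i)%N -> (i <= n)%N ->
  iT m (yM i v) = yM i (T m v).
Proof.
by move=> mi iN; rewrite bopE // !gtn_eqF ?(ltnW mi) // big_seq1.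
Qed.
Lemma iT_lt m i v : (i < m)%N -> (i <= n)%N ->
  iT m (yM i v) = yM i (T m.-1 v).
Proof.
move=> mi iN; rewrite bopE // !ltn_eqF ?(ltnW mi) //; last by lia.
by rewrite ltnNge ltnW // big_seq1.
Qed.

Fixpoint s1 (i : nat) : lendo_alg V := if i is j.+1 then T j * s1 j else 1.
(** The error of moving X_0 past one crossing. Put T = T_0, x = T X_0 T^(-1), and let w have no dot
    on the detached strand. Then [ak_relation] on T^(-1) w reads X_0 T (Y^j w) = T (x Y^j w) - kap
    (Y^j w), because ev (Y^j w) = x^j w. *)
Definition kap : lendo_alg V := z *: (tI 0 * (x - Y * ev)).

(** On copy j+1 the generator X_0 commutes with T_j ... T_1 and meets only T_0. The correction [kap]
    falls into copy 0, where T_j ... T_1 act as T_(j-1) ... T_0 on V, that is as [s1 j]. *)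
Definition iX : lendo_alg indM := bop (fun i =>
  if i is j.+1 then [:: (i, x); (0%N, - (s1 j * kap))] else [:: (0%N, Y)]).

Lemma iX_0 v : iX (yM 0 v) = yM 0 (Y v).
Proof. by rewrite bopE // big_seq1. Qed.
Lemma iX_S i v : (i < n)%N ->
  iX (yM i.+1 v) = yM i.+1 (x v) - yM 0 (s1 i (kap v)).
Proof. by move=> iN; rewrite bopE // big_cons big_seq1 /= linearN. Qed.

Let H := id_hecke D.

Lemma tI_T m : (m.+1 < n)%N -> T m * tI m = tI m.+1 * T m.
Proof.
move=> mn; apply: tel_intertwine => a; first exact: (hd_TAl H).
exact: (id_TI D).
Qed.
Lemma tI_Tr m : (m.+1 < n)%N -> T m * tI m.+1 = tI m * T m.
Proof.
move=> mn; apply: tel_intertwine => a; first exact: (hd_TAr H).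
exact: (id_TI D).
Qed.
Lemma tI_comm (u : lendo_alg V) l : (forall a, GRing.comm u (aL l a)) ->
  (forall a, GRing.comm u (aI a)) -> GRing.comm u (tI l).
Proof. exact: comm_tel. Qed.
Lemma tI_TC m l : (m.+1 < n)%N -> (l < n)%N -> l != m -> l != m.+1 ->
  GRing.comm (T m) (tI l).
Proof.
move=> mn ln lm lm1; apply: tI_comm => a; first exact: (hd_TA H).
exact: (id_TI D).
Qed.

Lemma tI_tel m : (m.+1 < n)%N ->
  tI m * tel B Bd (aL m) (aL m.+1) = tI m.+1 * tI m.
Proof.
move=> mn; rewrite (telC HA); last by apply: (hd_AC H); lia.
apply: tel_tel.
- by apply: (hd_A H); lia.
- exact: (id_I D).
- by apply: (id_LI D); lia.
- by apply: (hd_AC H); lia.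
- by apply: scommC; apply: (id_LI D).
Qed.

Lemma tI_tel1 : (1 < n)%N ->
  tI 1 * tel B Bd (aL 0%N) (aL 1%N) = tI 0 * tI 1.
Proof.
move=> n1; apply: tel_tel.
- exact: (hd_A H).
- exact: (id_I D).
- exact: (id_LI D).
- by apply: (hd_AC H) => //; lia.
- by apply: scommC; apply: (id_LI D); lia.
Qed.

Lemma tI_tel1' : (1 < n)%N ->
  tel B Bd (aL 0%N) (aL 1%N) * tI 0 = tI 0 * tI 1.
Proof.
move=> n1; have n0 : (0 < n)%N by exact: ltnW.
rewrite (telC HA); last exact: (hd_AC H).
rewrite [RHS]mulr_sumr mulr_suml; apply: eq_bigr => b _.
rewrite -mulrA (tel_mull HA); [|exact: (hd_A H)|exact: (id_I D)].
rewrite !mulrA (tel_comm HA) //; first by apply: (hd_AC H).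
by apply: scommC; apply: (id_LI D).
Qed.

Let w := x - Y * ev.

Lemma w_x : (0 < n)%N -> GRing.comm w x.
Proof.
move=> n0; apply: commr_sym; apply: commrB => //; apply: commrM.
  by apply: commr_sym; apply: (id_Yx D).
by apply: commr_sym; apply: (id_evx D).
Qed.
Lemma w_T m : (0 < m)%N -> (m.+1 < n)%N -> GRing.comm w (T m).
Proof.
move=> m0 mn; apply: commr_sym; apply: commrB.
  by apply: commr_sym; apply: (hd_XT H).
apply: commrM; apply: commr_sym; first exact: (id_YT D).
exact: (id_evT D).
Qed.
Lemma w_L l a : (l < n)%N -> GRing.comm w (aL l a).
Proof.
move=> ln; apply: commr_sym; apply: commrB.
  by apply: commr_sym; apply: (hd_XA H).
apply: commrM; apply: commr_sym; first exact: (id_YL D).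
exact: (id_evL D).
Qed.
Lemma w_I a : (0 < n)%N -> GRing.comm w (aI a).
Proof.
move=> n0; apply: commr_sym; apply: commrB.
  by apply: commr_sym; apply: (id_xI D).
apply: commrM; apply: commr_sym; first exact: (id_YI D).
exact: (id_evI D).
Qed.

Lemma tI_x l : (l < n)%N -> GRing.comm x (tI l).
Proof.
move=> ln; apply: tI_comm => a; first exact: (hd_XA H).
by apply: (id_xI D); apply: leq_ltn_trans ln.
Qed.
Lemma tI_Y l : (l < n)%N -> GRing.comm Y (tI l).
Proof.
move=> ln; apply: tI_comm => a; first exact: (id_YL D).
exact: (id_YI D).
Qed.
Lemma tI_w l : (l < n)%N -> GRing.comm w (tI l).
Proof.
move=> ln; apply: tI_comm => a; first exact: w_L.
by apply: w_I; apply: leq_ltn_trans ln.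
Qed.

Lemma commZl (c : k) (g h : lendo_alg V) : GRing.comm g h -> GRing.comm (c *: g) h.
Proof. by move=> gh; apply: commr_sym; apply: commZ; apply: commr_sym. Qed.

Lemma kap_x : (0 < n)%N -> GRing.comm kap x.
Proof.
move=> n0; apply: commZl; apply: commr_sym; apply: commrM; first exact: tI_x.
by apply: commr_sym; apply: w_x.
Qed.
Lemma kap_T m : (0 < m)%N -> (m.+1 < n)%N -> GRing.comm kap (T m).
Proof.
move=> m0 mn; apply: commZl; apply: commr_sym; apply: commrM.
  by apply: tI_TC; lia.
by apply: commr_sym; apply: w_T.
Qed.
Lemma kap_L l a : (0 < l)%N -> (l < n)%N -> GRing.comm kap (aL l a).
Proof.
move=> l0 ln; have n0 : (0 < n)%N by lia.
apply: commZl; apply: commr_sym; apply: commrM; last first.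
  by apply: commr_sym; apply: w_L.
apply: (tel_comm HA); first by apply: (hd_AC H) => //; lia.
by apply: scommC; apply: (id_LI D).
Qed.
(** The teleporter inside [kap] exchanges the labels of strand 0 and of the detached strand. *)
Lemma kap_L0 a : (0 < n)%N -> kap * aL 0%N a = aI a * kap.
Proof.
move=> n0; rewrite -pz_scalerAl -pz_scalerAr -mulrA (w_L a n0) !mulrA.
congr (_ *: _); congr (_ * _); rewrite (tel_mulr HA) //; first exact: (id_LI D).
  exact: (hd_A H).
exact: (id_I D).
Qed.
Lemma kap_I a : (0 < n)%N -> kap * aI a = aL 0%N a * kap.
Proof.
move=> n0; rewrite -pz_scalerAl -pz_scalerAr -mulrA (w_I a n0) !mulrA.
congr (_ *: _); congr (_ * _); rewrite (tel_mull HA) //; first exact: (hd_A H).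
exact: (id_I D).
Qed.

Lemma s1_L0 j a : (j < n)%N -> s1 j * aL 0%N a = aL j a * s1 j.
Proof.
elim: j => [|j IH] jn /=; first by rewrite mulr1 mul1r.
by rewrite -mulrA (IH (ltnW jn)) !mulrA (hd_TAl H).
Qed.
Lemma s1_Lgt j l a : (j < l)%N -> (l < n)%N -> GRing.comm (s1 j) (aL l a).
Proof.
elim: j => [|j IH] jl ln /=; first exact: commr_sym (commr1 _).
apply: commr_sym; apply: commrM; apply: commr_sym; last by apply: IH; lia.
by apply: (hd_TA H); lia.
Qed.
Lemma s1_Llt j l a : (l < j)%N -> (j < n)%N ->
  s1 j * aL l.+1 a = aL l a * s1 j.
Proof.
elim: j => // j IH lj jn /=; have [->|nlj] := eqVneq l j.
  by rewrite -mulrA s1_Lgt // !mulrA (hd_TAr H).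
rewrite -mulrA IH; [|lia|lia]; rewrite !mulrA; congr (_ * _).
by apply: (hd_TA H); lia.
Qed.
Lemma s1_comm j (u : lendo_alg V) : (forall i, (i < j)%N -> GRing.comm u (T i)) ->
  GRing.comm u (s1 j).
Proof.
elim: j => [|j IH] uT /=; first exact: commr1.
by apply: commrM; [apply: uT | apply: IH => i ij; apply: uT; lia].
Qed.
Lemma s1_I j a : (j < n)%N -> s1 j * aI a = aI a * s1 j.
Proof.
move=> jn; apply: commr_sym; apply: s1_comm => i ij; apply: commr_sym.
by apply: (id_TI D); lia.
Qed.
Lemma s1_Tgt j m : (j < m)%N -> (m.+1 < n)%N -> GRing.comm (T m) (s1 j).
Proof. by move=> jm mn; apply: s1_comm => i ij; apply: (TTC H); lia. Qed.
Lemma s1_Tlt j m : (m.+1 < j)%N -> (j < n)%N -> s1 j * T m.+1 = T m * s1 j.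
Proof.
elim: j => // j IH mj jn /=; have [e|nmj] := eqVneq m.+1 j.
  rewrite -e /= -!mulrA -s1_Tgt; [|lia|lia]; rewrite !mulrA; congr (_ * _).
  by rewrite (hd_braid H) //; lia.
rewrite -mulrA IH; [|lia|lia]; rewrite !mulrA; congr (_ * _).
by apply: (TTC H); lia.
Qed.
Lemma s1_split j : (j.+1 < n)%N -> exists s',
  [/\ s1 j.+1 = s' * T 0%N, GRing.comm s' x, GRing.comm s' kap
    & GRing.comm s' (tI 0)].
Proof.
elim: j => [|j IH] jn.
  exists 1; split=> /=; rewrite ?mulr1 ?mul1r //; exact: commr_sym (commr1 _).
have [|s' [e cx ck ct]] := IH; first by lia.
exists (T j.+1 * s'); rewrite -mulrA -e; split=> //; apply: commr_sym;
  apply: commrM; try exact: commr_sym.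
- exact: (hd_XT H).
- exact: kap_T.
- by apply: commr_sym; apply: tI_TC; lia.
Qed.

(** What the relation between X_0 and T_0 demands of [kap] on the copies from 2 on. With [kap] = z t
    w and w = x - Y ev, the terms in x cancel by [hd_XTXT] and those in ev by [id_ak]. *)
Lemma star : (1 < n)%N -> x * T 0 * kap * T 0
  = T 0 * kap * T 0 * x + z *: (tI 0 * x * T 0 * kap) - kap * T 0 * kap.
Proof.
move=> n1; have n0 : (0 < n)%N by lia.
set t := tI 0; set t1 := tI 1; set t01 := tel B Bd (aL 0%N) (aL 1%N).
set T0 := T 0.
have Tt : T0 * t = t1 * T0 by apply: tI_T.
have tt1 : t1 * t01 = t * t1 by apply: tI_tel1.
have tt1' : t01 * t = t * t1 by apply: tI_tel1'.
have xt1 : x * t1 = t1 * x by apply: tI_x.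
have xt : x * t = t * x by apply: tI_x.
have wt1 : w * t1 = t1 * w by apply: tI_w.
have Yt1 : Y * t1 = t1 * Y by apply: tI_Y.
have Yt : Y * t = t * Y by apply: tI_Y.
have YT : Y * T0 = T0 * Y by apply: (id_YT D).
have Yx : Y * x = x * Y by apply: (id_Yx D).
have tY : t * (ev * Y) = t * (x * ev) by apply: (id_tevY D).
have eTe : ev * T0 * ev = T0 * ev by apply: (id_evTev D).
have ak := id_ak D n1; rewrite -/T0 -/t01 in ak.
have XT : x * T0 * x * T0 = T0 * x * T0 * x by apply: (hd_XTXT H).
have kE : kap = z *: (t * w) by [].
have TkE : T0 * kap = z *: (t1 * (T0 * w)).
  by rewrite kE -pz_scalerAr (mulrA T0) Tt -mulrA.
(* The ev part of w produces, by [id_ak], a teleporter between the strands 0 and 1, and t1 turns it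
   into t t1. *)
have key : t1 * (T0 * w * T0 * x - x * T0 * w * T0)
    = - (z *: (t * t1 * (Y * ev * T0 * w))).
  have -> : T0 * w * T0 * x - x * T0 * w * T0
      = - (Y * (T0 * ev * T0 * x - x * T0 * ev * T0)).
    have e1 : T0 * w * T0 * x = T0 * x * T0 * x - Y * (T0 * ev * T0 * x).
      by rewrite mulrBr !mulrBl !mulrA YT.
    have e2 : x * T0 * w * T0 = T0 * x * T0 * x - Y * (x * T0 * ev * T0).
      by rewrite -XT mulrBr mulrBl !mulrA Yx -(mulrA x Y) YT !mulrA.
    by rewrite e1 e2 opprB addrC addrA subrK mulrBr opprB.
  rewrite ak mulrN -!pz_scalerAr; congr (- (_ *: _)).
  have tY' : t * t1 * Y = Y * (t * t1) by rewrite -mulrA -Yt1 mulrA -Yt mulrA.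
  transitivity (Y * (t * t1) * (ev * T0 * x - x * T0 * ev)).
    by rewrite !mulrA -Yt1 -(mulrA Y) tt1 mulrA.
  transitivity (Y * (t * t1) * (ev * T0 * w)); last first.
    by rewrite !mulrA tY' !mulrA.
  rewrite -!(mulrA Y); congr (Y * _).
  rewrite /w (mulrBr (ev * T0)) 2!(mulrBr (t * t1)); congr (_ - _).
  rewrite -tt1' -!mulrA; congr (t01 * _).
  rewrite (mulrA T0) -YT -(mulrA Y) (mulrA ev Y) (mulrA t (ev * Y)) tY.
  by rewrite -!mulrA (mulrA ev) eTe.
have -> : x * T0 * kap * T0 = z *: (t1 * (x * T0 * w * T0)).
  rewrite -(mulrA x) TkE -pz_scalerAr -pz_scalerAl; congr (_ *: _).
  by rewrite !mulrA xt1.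
have -> : T0 * kap * T0 * x = z *: (t1 * (T0 * w * T0 * x)).
  by rewrite TkE -!pz_scalerAl !mulrA.
have -> : t * x * T0 * kap = z *: (t * t1 * (x * T0 * w)).
  rewrite -(mulrA _ T0) TkE -pz_scalerAr; congr (_ *: _).
  by rewrite !mulrA -(mulrA t x) xt1 !mulrA.
have -> : kap * T0 * kap = z *: (z *: (t * t1 * (w * T0 * w))).
  rewrite -(mulrA _ T0) TkE -pz_scalerAr kE -pz_scalerAl; congr (_ *: (_ *: _)).
  by rewrite !mulrA -(mulrA t w) wt1 !mulrA.
rewrite -addrA -scalerBr -scalerBr -scalerDr; congr (_ *: _).
have PQ : t * t1 * (x * T0 * w) - t * t1 * (w * T0 * w)
    = t * t1 * (Y * ev * T0 * w).
  have xw : x - w = Y * ev by rewrite /w opprB addrC subrK.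
  by rewrite -mulrBr -xw !mulrBl.
by rewrite PQ -[z *: _]opprK -key (mulrBr t1) opprB addrC subrK.
Qed.

(** * The relations on the induced module *)

Lemma iA_A l : (l < n.+1)%N -> amorph (iA l).
Proof.
move=> ln; have sA i : (i <= n)%N -> amorph (strand i l).
  rewrite /strand => iN; case: ltnP => [li|li]; first by apply: (hd_A H); lia.
  by case: eqP => [|?]; [move=> _; exact: (id_I D) | apply: (hd_A H); lia].
split=> [|a b]; apply: eq_indM => i v iN; first by rewrite iAE // (sA i iN).1.
by rewrite lendoME !iAE // (sA i iN).2.
Qed.

Lemma strand_C i l m : (i <= n)%N -> (l < n.+1)%N -> (m < n.+1)%N -> l != m ->
  scomm par (strand i l) (strand i m).
Proof.
move=> iN ln mn lm; rewrite /strand.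
have [li|li|li] := ltngtP l i; have [mi|mi|mi] := ltngtP m i; try lia.
- by apply: (hd_AC H); lia.
- by apply: (hd_AC H); lia.
- by apply: (id_LI D); lia.
- by apply: (hd_AC H); lia.
- by apply: (hd_AC H); lia.
- by apply: (id_LI D); lia.
- by apply: scommC; apply: (id_LI D); lia.
- by apply: scommC; apply: (id_LI D); lia.
Qed.

Lemma iA_C l m : (l < n.+1)%N -> (m < n.+1)%N -> l != m ->
  scomm par (iA l) (iA m).
Proof.
move=> ln mn lm p q a b pa qb; apply: eq_indM => i v iN.
rewrite lendoZE !lendoME !iAE // -linearZ; congr (yM _ _).
exact: (lendo_app (strand_C iN ln mn lm pa qb)).
Qed.

Lemma strand_lt i l : (l < i)%N -> strand i l = aL l.
Proof. by rewrite /strand => ->. Qed.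
Lemma strand_eq i : strand i i = aI.
Proof. by rewrite /strand ltnn eqxx. Qed.
Lemma strand_gt i l : (i < l)%N -> strand i l = aL l.-1.
Proof. by move=> il; rewrite /strand ltnNge ltnW //= gtn_eqF. Qed.

Lemma tI_L m a : (m < n)%N -> aI a * tI m = tI m * aL m a.
Proof.
move=> mn; apply: (tel_mulr HA); first exact: (id_LI D).
  exact: (hd_A H).
exact: (id_I D).
Qed.
Lemma tI_I m a : (m < n)%N -> aL m a * tI m = tI m * aI a.
Proof.
by move=> mn; apply: (tel_mull HA); [apply: (hd_A H)|apply: (id_I D)].
Qed.
Lemma tI_Lcomm m l a : (m < n)%N -> (l < n)%N -> l != m ->
  GRing.comm (aL l a) (tI m).
Proof.
move=> mn ln lm; apply: (tel_comm HA); first by apply: (hd_AC H) => //; lia.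
by apply: scommC; apply: (id_LI D).
Qed.

Lemma cases4 i m : [\/ (i < m)%N, i = m, i = m.+1 | (m.+1 < i)%N].
Proof.
have [lt|gt|->] := ltngtP i m; [by constructor 1| |by constructor 2].
have [->|] := eqVneq i m.+1; first by constructor 3.
by move=> ne; constructor 4; lia.
Qed.

Ltac rw e := rewrite e; try lia.
Ltac capp := congr (yM _ _); rewrite -?lendoME -?lendoZE;
  apply: lendo_app; rewrite -?pz_scalerAl -?pz_scalerAr; try congr (_ *: _).

Lemma iT_TAl m a : (m.+1 < n.+1)%N -> iT m * iA m a = iA m.+1 a * iT m.
Proof.
move=> mn; apply: eq_indM => i v iN; rewrite !lendoME iAE //.
have [im|im|im|im] := cases4 i m.
- case: m mn im => // m mn im; rw iT_lt; rw iT_lt; rw iAE; do 2 (rw strand_gt).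
  by capp; apply: (hd_TAl H); lia.
- rewrite im; rw iT_eq; rw iT_eq; rw iAE; by rewrite !strand_eq.
- rewrite im; rw iT_S; rw iT_S; rewrite lendo_vD; rw iAE; rw iAE.
  rewrite strand_lt // strand_eq strand_gt //; congr (_ + _).
  by capp; rewrite tI_L.
- rw iT_gt; rw iT_gt; rw iAE; rewrite !strand_lt; try lia.
  by capp; rewrite (hd_TAl H) //; lia.
Qed.

Lemma iT_TAr m a : (m.+1 < n.+1)%N -> iT m * iA m.+1 a = iA m a * iT m.
Proof.
move=> mn; apply: eq_indM => i v iN; rewrite !lendoME iAE //.
have [im|im|im|im] := cases4 i m.
- case: m mn im => // m mn im; rw iT_lt; rw iT_lt; rw iAE; do 2 (rw strand_gt).
  by capp; apply: (hd_TAr H); lia.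
- rewrite im; rw iT_eq; rw iT_eq; rw iAE; by rewrite strand_gt // strand_lt.
- rewrite im; rw iT_S; rw iT_S; rewrite lendo_vD; rw iAE; rw iAE.
  rewrite !strand_eq strand_lt //; congr (_ + _).
  by capp; rewrite tI_I.
- rw iT_gt; rw iT_gt; rw iAE; rewrite !strand_lt; try lia.
  by capp; rewrite (hd_TAr H) //; lia.
Qed.

Lemma iT_TA m l a : (m.+1 < n.+1)%N -> (l < n.+1)%N -> l != m -> l != m.+1 ->
  iT m * iA l a = iA l a * iT m.
Proof.
move=> mn ln lm lm1; apply: eq_indM => i v iN; rewrite !lendoME iAE //.
have [im|im|im|im] := cases4 i m.
- rw iT_lt; rw iT_lt; rw iAE; capp; rewrite /strand.
  by case: ltngtP => li; (apply: (id_TI D) || apply: (hd_TA H)); lia.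
- rewrite im; rw iT_eq; rw iT_eq; rw iAE; congr (yM _ _).
  have [lt|ge] := ltnP l m; first by rewrite !strand_lt // ltnW.
  by rewrite !strand_gt //; lia.
- rewrite im; rw iT_S; rw iT_S; rewrite lendo_vD; rw iAE; rw iAE.
  have [lt|ge] := ltnP l m.
    rewrite !strand_lt; try lia; congr (_ + _).
    by capp; apply/esym/tI_Lcomm; lia.
  rewrite !strand_gt; try lia; congr (_ + _).
  by capp; apply/esym/tI_Lcomm; lia.
- rw iT_gt; rw iT_gt; rw iAE; capp; rewrite /strand.
  by case: ltngtP => li; (apply: (id_TI D) || apply: (hd_TA H)); lia.
Qed.

Lemma tel_iA l l' i v : (i <= n)%N -> tel B Bd (iA l) (iA l') (yM i v)
  = yM i (tel B Bd (strand i l) (strand i l') v).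
Proof.
move=> iN; rewrite !lendo_sumE linear_sum; apply: eq_bigr => b _.
by rewrite !lendoME !iAE.
Qed.

Lemma iT_quad m : (m.+1 < n.+1)%N ->
  iT m * iT m = z *: (tel B Bd (iA m) (iA m.+1) * iT m) + 1.
Proof.
move=> mn; apply: eq_indM => i v iN; rewrite lendoDE lendoZE !lendoME lendo1E.
have [im|im|im|im] := cases4 i m.
- case: m mn im => // m mn im; rw iT_lt; rw iT_lt; rw tel_iA; do 2 (rw strand_gt).
  rewrite -linearZ -linearD; congr (yM _ _).
  by apply: (lendo_app (hd_quad H _) v); lia.
- rewrite im; rw iT_eq; rw iT_S; rw tel_iA; rewrite strand_lt // strand_eq.
  by rewrite addrC -linearZ.
- rewrite im; rw iT_S; rewrite !lendo_vD; rw iT_eq; rw iT_S.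
  rw tel_iA; rw tel_iA; rewrite strand_eq strand_gt // strand_lt // strand_eq.
  rewrite (telC HA); last by apply: scommC; apply: (id_LI D).
  rewrite addrC; congr (_ + _).
  by rewrite scalerDr !lendoZE !linearZ.
- rw iT_gt; rw iT_gt; rw tel_iA; rewrite !strand_lt; try lia.
  rewrite -linearZ -linearD; congr (yM _ _).
  by apply: (lendo_app (hd_quad H _) v); lia.
Qed.

Lemma iT_TT m j : (m.+1 < j)%N -> (j.+1 < n.+1)%N -> iT m * iT j = iT j * iT m.
Proof.
move=> mj jn; apply: eq_indM => i v iN; rewrite !lendoME.
have [im|im|im|im] := cases4 i m.
- do 4 (rw iT_lt); capp; apply: (TTC H); lia.
- rewrite im; rw iT_lt; rw iT_eq; rw iT_eq; rw iT_lt; by [].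
- rewrite im; rw iT_lt; rw iT_S; rw iT_S; rewrite lendo_vD; do 2 (rw iT_lt).
  by congr (_ + _); capp; apply/esym; apply: tI_TC; lia.
have [ij|ij|ij|ij] := cases4 i j.
- rw iT_lt; rw iT_gt; rw iT_gt; rw iT_lt; capp; apply: (TTC H); lia.
- rewrite ij; rw iT_eq; rw iT_gt; rw iT_gt; rw iT_eq; by [].
- rewrite ij; rw iT_S; rw iT_gt; rw iT_S; rewrite lendo_vD; do 2 (rw iT_gt).
  by congr (_ + _); capp; apply: tI_TC; lia.
- do 4 (rw iT_gt); capp; apply: (TTC H); lia.
Qed.

(** On the copies away from m, m+1, m+2 this is a braid relation of V. On these three the detached
    strand takes part; on copy m+2 the extra terms are balanced by the quadratic relation of T_m on
    V. *)
Lemma iT_braid m : (m.+2 < n.+1)%N ->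
  iT m * iT m.+1 * iT m = iT m.+1 * iT m * iT m.+1.
Proof.
move=> mn; apply: eq_indM => i v iN; rewrite !lendoME.
have [im|im|im|im] := cases4 i m.
- case: m mn im => // m mn im; do 6 (rw iT_lt); capp.
  by apply: (hd_braid H); lia.
- rewrite im; rw iT_eq; rw iT_eq; rw iT_gt; rw iT_lt; rw iT_eq; rw iT_eq; by [].
- rewrite im; rw (@iT_S m); rewrite !lendo_vD; rw (@iT_lt m.+1 m).
  rw (@iT_eq m.+1); rw (@iT_eq m); rw (@iT_gt m m.+2); rw (@iT_eq m.+1).
  rw (@iT_gt m m.+2); rw (@iT_S m.+1); congr (_ + _).
  by capp; apply: tI_T.
have [im2|im2] := eqVneq i m.+2; last first.
  by do 6 (rw iT_gt); capp; apply: (hd_braid H); lia.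
rewrite im2; rw (@iT_gt m m.+2); do 2 (rw (@iT_S m.+1)); rewrite !lendo_vD.
do 2 (rw (@iT_S m)); do 2 (rw (@iT_gt m m.+2)); rewrite !lendo_vD.
rw (@iT_lt m.+1 m); rw (@iT_eq m.+1); rw (@iT_S m.+1).
rewrite -!addrA; congr (_ + _).
rewrite [RHS]addrCA; congr (_ + _).
  by capp; rewrite tI_Tr.
(* The quadratic relation of T_m multiplied on the left by z t_m, with [tI_Tr] and [tI_tel] moving
   the teleporters. *)
have e : T m * (z *: tI m.+1) * T m
    = z *: tI m + (z *: tI m.+1) * T m * (z *: tI m.+1).
  rewrite -pz_scalerAr tI_Tr // -!pz_scalerAl -pz_scalerAr -scalerDr.
  rewrite -(mulrA (tI m)) (quadE H) // mulrDr mulr1 addrC; congr (_ *: (_ + _)).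
  by rewrite -pz_scalerAr -mulrA tI_Tr // !mulrA tI_tel.
by rewrite -linearD; congr (yM _ _); exact: (lendo_app e v).
Qed.

Lemma s1_kap_strand j l a : (j < n)%N -> (l < n.+1)%N ->
  s1 j * kap * strand j.+1 l a = strand 0 l a * (s1 j * kap).
Proof.
move=> jn ln; have n0 : (0 < n)%N by lia.
case: l ln => [|l] ln.
  by rewrite strand_lt // strand_eq -mulrA kap_L0 // mulrA s1_I // mulrA.
rewrite (strand_gt (i := 0)) //=.
have [lj|lj|->] := ltngtP l j.
- rewrite strand_lt // -mulrA kap_L; [|lia|lia].
  by rewrite mulrA s1_Llt // mulrA.
- rewrite strand_gt //= -mulrA kap_L; [|lia|lia].
  by rewrite mulrA s1_Lgt // mulrA.
- by rewrite strand_eq -mulrA kap_I // mulrA s1_L0 // mulrA.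
Qed.

Lemma iX_A l a : (l < n.+1)%N -> iX * iA l a = iA l a * iX.
Proof.
move=> ln; apply: eq_indM => [[|j] v] iN; rewrite !lendoME iAE //.
  rewrite !iX_0 iAE //; congr (yM _ _); rewrite -!lendoME; apply: lendo_app.
  case: l ln => [|l] ln; first by rewrite strand_eq; apply: (id_YI D).
  by rewrite strand_gt //; apply: (id_YL D).
rewrite !iX_S // lendo_vB !iAE //; congr (_ - _); congr (yM _ _).
  rewrite -!lendoME; apply: lendo_app; rewrite /strand; case: ltngtP => // lj.
  - by apply: (hd_XA H); lia.
  - by apply: (hd_XA H); lia.
  - by apply: (id_xI D); lia.
exact: (lendo_app (s1_kap_strand a iN ln) v).
Qed.

Lemma kap_tel j : (j.+1 < n)%N -> s1 j.+1 * kap * tI j.+1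
  = tel B Bd (aL j) (aL j.+1) * (s1 j.+1 * kap).
Proof.
move=> jn; apply: tel_intertwine => a.
  by rewrite -mulrA kap_L // mulrA s1_Llt // mulrA.
by rewrite -mulrA kap_I ?mulrA ?s1_L0 ?mulrA //; lia.
Qed.

(** The corrections in copy 0 agree because [kap] commutes with the crossings of positive index and
    [s1] lowers the index of a crossing that it passes. On copy m+1 the quadratic relation is used
    as well. *)
Lemma iX_T m : (0 < m)%N -> (m.+1 < n.+1)%N -> iX * iT m = iT m * iX.
Proof.
case: m => // m _ mn; apply: eq_indM => [[|i] v] iN; rewrite !lendoME.
  rw (@iT_lt m.+1 0); rewrite !iX_0; rw (@iT_lt m.+1 0).
  by congr (yM _ _); apply: (lendo_app (id_YT D _) v); lia.
rewrite (iX_S v) //; have [im|im|im|im] := cases4 i.+1 m.+1.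
- rw (@iT_lt m.+1 i.+1); rewrite iX_S // lendo_vB.
  rw (@iT_lt m.+1 i.+1); rw (@iT_lt m.+1 0); congr (_ - _); congr (yM _ _).
    by apply: (lendo_app (hd_XT H _ _) v); lia.
  apply: (lendo_app (g := s1 i * (kap * T m)) (h := T m * (s1 i * kap)) _ v).
  rewrite kap_T; [|lia|lia].
  by rewrite !mulrA s1_Tgt //; lia.
- case: im => im; subst m; rw (@iT_eq i.+1); rewrite iX_S // lendo_vB.
  by rw (@iT_eq i.+1); rw (@iT_lt i.+1 0).
- case: im => im; subst i; rw (@iT_S m.+1); rewrite !lendo_vD.
  rewrite !iX_S //; try lia; rewrite lendo_vN.
  rw (@iT_S m.+1); rw (@iT_lt m.+1 0).
  rewrite [LHS]addrACA -opprD -linearD.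
  have n0 : (0 < n)%N by lia.
  congr (_ + _ - _); congr (yM _ _).
    rewrite -!lendoME; apply: lendo_app.
    by rewrite -pz_scalerAl -pz_scalerAr tI_x.
  have e : s1 m * kap + s1 m.+1 * kap * (z *: tI m.+1) = T m * (s1 m.+1 * kap).
    rewrite -pz_scalerAr kap_tel //= !mulrA (quadE H) // !mulrDl mul1r addrC.
    by rewrite -!pz_scalerAl.
  exact: (lendo_app e v).
- rw (@iT_gt m.+1 i.+1); rewrite iX_S // lendo_vB.
  rw (@iT_gt m.+1 i.+1); rw (@iT_lt m.+1 0); congr (_ - _); congr (yM _ _).
    by apply: (lendo_app (hd_XT H _ _) v); lia.
  apply: (lendo_app (g := s1 i * (kap * T m.+1)) (h := T m * (s1 i * kap)) _ v).
  rewrite kap_T; [|lia|lia].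
  by rewrite !mulrA s1_Tlt //; lia.
Qed.

Lemma kap_t01 : (1 < n)%N ->
  T 0 * kap * tel B Bd (aL 0%N) (aL 1%N) = tI 0 * (T 0 * kap).
Proof.
move=> n1; have n0 : (0 < n)%N by lia.
have h1 a : T 0 * kap * aL 0%N a = aI a * (T 0 * kap).
  by rewrite -mulrA kap_L0 // mulrA (id_TI D) // mulrA.
have h2 a : T 0 * kap * aL 1%N a = aL 0%N a * (T 0 * kap).
  by rewrite -mulrA kap_L // mulrA (hd_TAr H) // mulrA.
rewrite (tel_intertwine B Bd h1 h2) (telC HA) //.
by apply: scommC; apply: (id_LI D).
Qed.

(** The first identity is [star] multiplied by the part of [s1] that commutes with x, [kap] and t.
    The second follows after multiplication by T_0 and the quadratic relation. *)
Lemma star_T j : (j.+1 < n)%N -> let s := s1 j.+1 in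
  x * s * kap * T 0 = s * kap * T 0 * x + z *: tI 0 * x * s * kap
                      - kap * s * kap /\
  s * kap * T 0 * x * T 0 - kap * s * kap * T 0 = x * s * kap.
Proof.
move=> jn s; rewrite {}/s; have [s' [-> sx sk st]] := s1_split jn.
have n1 : (1 < n)%N by lia.
have st' := star n1.
have e1 : x * (s' * T 0) * kap * T 0 = s' * T 0 * kap * T 0 * x
    + z *: tI 0 * x * (s' * T 0) * kap - kap * (s' * T 0) * kap.
  transitivity (s' * (x * T 0 * kap * T 0)); first by rewrite !mulrA sx.
  rewrite st' mulrBr mulrDr; congr (_ + _ - _); rewrite ?mulrA ?sk //.
  rewrite -pz_scalerAr -!pz_scalerAl; congr (_ *: _).
  by rewrite !mulrA st -(mulrA _ s' x) sx mulrA.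
split=> //; apply/eqP; rewrite subr_eq; apply/eqP.
have := congr1 (fun u => u * T 0) e1.
rewrite -(mulrA _ (T 0) (T 0)) (quadE H) // mulrDr mulr1 mulrBl mulrDl.
have e2 : x * (s' * T 0) * kap * (z *: (tel B Bd (aL 0%N) (aL 1%N) * T 0))
    = z *: tI 0 * x * (s' * T 0) * kap * T 0.
  rewrite -pz_scalerAr -!pz_scalerAl; congr (_ *: _).
  rewrite -!mulrA (mulrA kap) (mulrA (T 0)) (mulrA (T 0) kap) kap_t01 //.
  by rewrite !mulrA -(mulrA x s') st mulrA tI_x //; lia.
rewrite e2 => e3; apply: (addrI (z *: tI 0 * x * (s' * T 0) * kap * T 0)).
by rewrite addrA e3 subrK addrC.
Qed.

(** In T_0 X_0 on copy 1 the part z t x of [kap] cancels against the quadratic relation, and only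
    this part remains. *)
Let beta := z *: (tI 0 * (Y * ev)).

Lemma kapE : kap = (z *: tI 0) * x - beta.
Proof. by rewrite /kap mulrBr scalerBr -pz_scalerAl. Qed.

Lemma beta_Y : (0 < n)%N -> beta * Y = x * beta.
Proof.
move=> n0; rewrite -pz_scalerAl -pz_scalerAr; congr (_ *: _).
rewrite !mulrA -tI_Y // tI_x // -2!mulrA (id_tevY D) //.
by rewrite !mulrA tI_Y // -!mulrA (mulrA Y) (id_Yx D) // !mulrA.
Qed.

Lemma kap_beta : (0 < n)%N -> kap * beta = 0.
Proof.
move=> n0; rewrite -pz_scalerAl -pz_scalerAr.
suff -> : tI 0 * w * (tI 0 * (Y * ev)) = 0 by rewrite !scaler0.
have e : tI 0 * (w * (Y * ev)) = 0.
  rewrite mulrBl mulrBr; apply/eqP; rewrite subr_eq0; apply/eqP.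
  transitivity (Y * (tI 0 * (ev * Y)) * ev); last by rewrite !mulrA tI_Y.
  rewrite (id_tevY D) // -!mulrA (id_evev D) (mulrA x) -(id_Yx D) // !mulrA.
  by rewrite tI_Y.
by rewrite -mulrA (mulrA w) tI_w // -(mulrA _ w) e mulr0.
Qed.

Lemma iTX_1 v : (0 < n)%N ->
  iT 0%N (iX (yM 1 v)) = yM 0 (x v) + yM 1 (beta v).
Proof.
move=> n0; rewrite iX_S // lendo_vB; rw (@iT_S 0); rw (@iT_eq 0).
by rewrite -addrA -linearB; congr (_ + yM _ _); rewrite kapE /= opprB addrC subrK.
Qed.

(** Copy 0 is a direct computation. Copy 1 is T_0 of copy 0, and the quadratic relation turns both
    sides into the sides on copy 0 plus the common term X T_0 X. The later copies are [star_T]. *)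
Lemma iX_TXT : (1 < n.+1)%N ->
  iX * iT 0%N * iX * iT 0%N = iT 0%N * iX * iT 0%N * iX.
Proof.
rewrite ltnS => n0; set X := iX; set T0 := iT 0%N.
have y0 v : (X * T0 * X * T0) (yM 0 v) = (T0 * X * T0 * X) (yM 0 v).
  rewrite !lendoME; rw (@iT_eq 0); rewrite iTX_1 // lendo_vD iX_0 iX_S //.
  rewrite iX_0; rw (@iT_eq 0); rewrite iTX_1 //.
  have -> : kap (beta v) = 0 by exact: (lendo_app (kap_beta n0) v).
  rewrite lendo_v0 linear0 subr0; congr (yM _ _ + yM _ _).
    exact: (lendo_app (id_Yx D n0) v).
  exact/esym/(lendo_app (beta_Y n0) v).
apply: eq_indM => [[|[|j]] v] iN; first exact: y0.
  set t := tel B Bd (iA 0%N) (iA 1%N).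
  have q : T0 * T0 = z *: (t * T0) + 1 by apply: iT_quad.
  have Xt : X * t = t * X by apply: comm_tel => a; apply: iX_A; lia.
  have Tt : T0 * t = t * T0.
    have n1 : (1 < n.+1)%N by [].
    rewrite (tel_intertwine B Bd (fun a => iT_TAl a n1) (fun a => iT_TAr a n1)).
    by congr (_ * _); apply: (telC HA); apply: iA_C => //; lia.
  have <- : T0 (yM 0 v) = yM 1 v by rewrite iT_eq.
  have e1 : X * T0 * X * T0 * T0 = z *: (t * (X * T0 * X * T0)) + X * T0 * X.
    rewrite -(mulrA _ T0 T0) q mulrDr mulr1 -pz_scalerAr; congr (_ *: _ + _).
    by rewrite mulrA -(mulrA _ X t) Xt !mulrA -(mulrA X T0 t) Tt mulrA Xt.
  have e2 : T0 * (T0 * X * T0 * X) = z *: (t * (T0 * X * T0 * X)) + X * T0 * X.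
    by rewrite !mulrA q !mulrDl !mul1r -!pz_scalerAl.
  transitivity ((X * T0 * X * T0 * T0) (yM 0 v)); first by [].
  rewrite e1 lendoDE lendoZE [X in z *: X]lendoME y0.
  transitivity ((T0 * (T0 * X * T0 * X)) (yM 0 v)); first by rewrite e2.
  by rewrite lendoME -y0.
have [e1 e2] := star_T iN.
clear y0; rewrite !lendoME /X /T0 {X T0}; rw (@iT_gt 0 j.+2); rewrite !iX_S // !lendo_vB.
do 2 (rw (@iT_gt 0 j.+2)); do 2 (rw (@iT_eq 0)).
rewrite !iX_S // [in RHS]lendo_vB.
rw (@iT_gt 0 j.+2); rw (@iT_eq 0); rewrite [in RHS]lendo_vB; rw (@iT_S 0).
rw (@iT_eq 0).
have -> : yM j.+2 (x (T 0 (x (T 0 v)))) = yM j.+2 (T 0 (x (T 0 (x v)))).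
  by congr (yM _ _); apply: (lendo_app (hd_XTXT H _) v); lia.
have -> : x (s1 j.+1 (kap (T 0 v))) = s1 j.+1 (kap (T 0 (x v)))
    + (z *: tI 0) (x (s1 j.+1 (kap v))) - kap (s1 j.+1 (kap v)).
  exact: (lendo_app e1 v).
have -> : s1 j.+1 (kap (T 0 (x (T 0 v))))
    = x (s1 j.+1 (kap v)) + kap (s1 j.+1 (kap (T 0 v))).
  have e3 : s1 j.+1 * kap * T 0 * x * T 0
      = x * s1 j.+1 * kap + kap * s1 j.+1 * kap * T 0.
    by apply/eqP; rewrite -subr_eq e2.
  exact: (lendo_app e3 v).
rewrite [yM 0 (_ + _)]linearD [yM 1 (_ - _)]linearB [yM 1 (_ + _)]linearD.
exact: addr_exchange.
Qed.

(** * The cyclotomic relation on the induced module *)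

Lemma iX_X0 j v : (iX ^+ j) (yM 0 v) = yM 0 ((Y ^+ j) v).
Proof.
elim: j => [|j IH]; first by rewrite !expr0 !lendo1E.
by rewrite !exprS !lendoME IH iX_0.
Qed.

(** The quotient of Y^j - x^j by Y - x, that is the sum of the Y^a x^b with a + b = j - 1. *)
Fixpoint gpow (j : nat) : lendo_alg V :=
  if j is j'.+1 then Y * gpow j' + x ^+ j' else 0.

Lemma iX_X1 j v : (0 < n)%N ->
  (iX ^+ j) (yM 1 v) = yM 1 ((x ^+ j) v) - yM 0 ((gpow j) (kap v)).
Proof.
move=> n0; elim: j v => [|j IH] v.
  by rewrite !expr0 lendo1E lendo0E linear0 subr0.
rewrite exprS lendoME IH lendo_vB iX_0 iX_S // exprS lendoME -addrA -opprD.
rewrite -linearD; congr (_ - yM _ _); rewrite /= addrC; congr (_ + _).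
by apply: (lendo_app (commrX j (kap_x n0)) v).
Qed.

Lemma comm_Yx : (0 < n)%N -> GRing.comm Y x. Proof. exact: (id_Yx D). Qed.

Lemma gpowE j : (0 < n)%N -> gpow j * (Y - x) = Y ^+ j - x ^+ j.
Proof.
move=> n0; elim: j => [|j IH] /=; first by rewrite mul0r !expr0 subrr.
rewrite mulrDl -mulrA IH mulrBr -exprS (mulrBr (x ^+ j)) -exprSr.
have -> : Y * x ^+ j = x ^+ j * Y by apply: commrX; apply: comm_Yx.
by rewrite addrA subrK.
Qed.

Lemma gpow_comm j (u : lendo_alg V) : GRing.comm u Y -> GRing.comm u x ->
  GRing.comm u (gpow j).
Proof.
move=> uY ux; elim: j => [|j IH] /=; first exact: commr0.
by apply: commrD; [apply: commrM | apply: commrX].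
Qed.

(** As t ev Y = t x ev, the left side is t (x Y^i - Y x^i) ev, and x Y^i - Y x^i is divisible by Y -
    x. *)
Lemma w_factor i : (0 < n)%N -> exists R : lendo_alg V,
  tI 0 * w * Y ^+ i * ev = tI 0 * ((Y - x) * R).
Proof.
move=> n0; have tev j : tI 0 * (ev * Y ^+ j) = tI 0 * (x ^+ j * ev).
  elim: j => [|j IH]; first by rewrite !expr0 mulr1 mul1r.
  rewrite exprSr (mulrA ev) mulrA IH.
  have xj : x ^+ j * tI 0 = tI 0 * x ^+ j.
    by apply: commr_sym; apply: commrX; apply: commr_sym; apply: tI_x.
  by rewrite mulrA -xj -mulrA -mulrA (id_tevY D) // mulrA xj -mulrA (mulrA _ x) -exprSr.
have -> : tI 0 * w * Y ^+ i * ev = tI 0 * (x * Y ^+ i * ev - Y * x ^+ i * ev).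
  rewrite -!mulrA mulrBl !mulrBr; congr (_ - _).
  rewrite -!mulrA (mulrA (tI 0)) -tI_Y // -!mulrA (mulrA ev) (mulrA (tI 0)) tev.
  by rewrite !mulrA -(mulrA _ ev ev) (id_evev D) tI_Y.
case: i => [|i].
  exists (- ev); congr (_ * _); rewrite !expr0 !mulr1 -mulrBl -opprB.
  by rewrite mulNr mulrN.
exists (x * Y * gpow i * ev); congr (_ * _).
have gc : GRing.comm (Y - x) (gpow i).
  by apply: gpow_comm; apply: commr_sym; apply: commrB => //;
    [apply: comm_Yx | apply: commr_sym; apply: comm_Yx].
have xYc : GRing.comm (Y - x) (x * Y).
  apply: commr_sym; apply: commrB; apply: commr_sym; apply: commrM => //.
    exact: comm_Yx.
  by apply: commr_sym; apply: comm_Yx.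
have -> : (Y - x) * (x * Y * gpow i * ev) = x * Y * (gpow i * (Y - x)) * ev.
  by rewrite -gc !mulrA -xYc !mulrA.
rewrite gpowE // mulrBr mulrBl; congr (_ - _); first by rewrite exprS !mulrA.
by rewrite exprS mulrA comm_Yx.
Qed.

(** The first factor P satisfies P (Y - x) = f(Y) - f(x), with coefficients on the detached strand,
    and f(Y) = 0. The teleporter moves the coefficients of f(x) to strand 0, where f(x) = 0. By
    [w_factor] a factor Y - x can be split off from t w on each Y^i ev, and [id_gen] concludes. *)
Lemma cyc_kap : (0 < n)%N ->
  (gpow d + \sum_(i < d) aI (f i) * gpow i) * kap = 0.
Proof.
move=> n0; set P := _ + _; rewrite -pz_scalerAr.
have fcent i : aI (f i) * tI 0 = tI 0 * aI (f i).
  by apply: tel_central; [apply: (id_I D)|apply: (id_LI D)|apply: centf].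
have tP : P * tI 0 = tI 0 * P.
  apply: commr_sym; apply: commrD.
    by apply: gpow_comm; apply: commr_sym; [apply: tI_Y | apply: tI_x].
  apply: commr_sum => i _; apply: commrM; first exact/commr_sym/fcent.
  by apply: gpow_comm; apply: commr_sym; [apply: tI_Y | apply: tI_x].
have PE : tI 0 * (P * (Y - x)) = 0.
  have -> : P * (Y - x) = - (x ^+ d + \sum_(i < d) aI (f i) * x ^+ i).
    have e : \sum_(i < d) aI (f i) * gpow i * (Y - x)
        = \sum_(i < d) aI (f i) * Y ^+ i - \sum_(i < d) aI (f i) * x ^+ i.
      by rewrite -sumrB; apply: eq_bigr => i _; rewrite -mulrA gpowE // mulrBr.
    by rewrite mulrDl gpowE // mulr_suml e addrACA (id_cyc D) add0r opprD.
  rewrite mulrN mulrDr mulr_sumr; apply/eqP; rewrite oppr_eq0; apply/eqP.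
  transitivity (tI 0 * (x ^+ d + \sum_(i < d) aL 0%N (f i) * x ^+ i)).
    rewrite mulrDr mulr_sumr; congr (_ + _).
    apply: eq_bigr => i _; transitivity (tI 0 * aI (f i) * x ^+ i).
      exact: mulrA.
    by rewrite -fcent tI_L // mulrA.
  by rewrite (hd_cyc H n0) mulr0.
rewrite -/w; suff -> : P * (tI 0 * w) = 0 by rewrite scaler0.
apply: (id_gen D) => i; rewrite !mul0r.
have [R e] := w_factor i n0.
have -> : P * (tI 0 * w) * Y ^+ i * ev = P * (tI 0 * w * Y ^+ i * ev).
  by rewrite !mulrA.
by rewrite e mulrA tP -mulrA (mulrA P) mulrA PE mul0r.
Qed.

Lemma iX_cyc : (0 < n.+1)%N ->
  iX ^+ d + \sum_(i < d) iA 0%N (f i) * iX ^+ i = 0.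
Proof.
move=> _; set P := _ + _; have PE v : P v = (iX ^+ d) v
    + \sum_(i < d) iA 0%N (f i) ((iX ^+ i) v).
  by rewrite lendoDE lendo_sumE.
have PT j : (0 < j)%N -> (j < n)%N -> P * iT j = iT j * P.
  move=> j0 jn; have jn1 : (j.+1 < n.+1)%N by [].
  apply: commr_sym; apply: commrD.
    by apply: commrX; apply/commr_sym/iX_T.
  apply: commr_sum => i _; apply: commrM; last by apply/commrX/commr_sym/iX_T.
  by apply: iT_TA => //; lia.
apply: eq_indM => i v iN; rewrite lendo0E.
elim: i iN v => [|[|i] IH] iN v.
- rewrite PE iX_X0; under eq_bigr => i _ do rewrite iX_X0 iAE // strand_eq.
  rewrite -linear_sum -linearD -[RHS](linear0 (yM 0)); congr (yM _ _).
  have := lendo_app (id_cyc D) v; by rewrite lendoDE lendo_sumE.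
- rewrite PE iX_X1 //; under eq_bigr => i _ do
    rewrite iX_X1 // lendo_vB !iAE // strand_lt // strand_eq.
  rewrite sumrB addrACA -opprD -!linear_sum -!linearD.
  have -> : yM 1 ((x ^+ d) v + \sum_(i < d) aL 0%N (f i) ((x ^+ i) v)) = 0.
    rewrite -[RHS](linear0 (yM 1)); congr (yM _ _).
    by have := lendo_app (hd_cyc H iN) v; rewrite lendoDE lendo_sumE.
  have := lendo_app (cyc_kap iN) v; rewrite lendoME lendoDE lendo_sumE lendo0E.
  by move=> ->; rewrite linear0 subr0.
(* From copy 2 on, a vector is T_(i+1) of one in the previous copy, and the polynomial commutes with
   T_(i+1). *)
- rewrite -(@iT_eq i.+1); [|lia].
  by rewrite -lendoME PT // lendoME IH ?lendo_v0 //; lia.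
Qed.

Lemma ind_hecke : hecke_datum par B Bd z f n.+1 iA iT iX.
Proof.
split.
- exact: iA_A.
- exact: iA_C.
- exact: iT_TAl.
- exact: iT_TAr.
- exact: iT_TA.
- exact: iT_quad.
- exact: iT_braid.
- exact: iT_TT.
- by move=> l a; apply: iX_A.
- exact: iX_T.
- exact: iX_TXT.
- exact: iX_cyc.
Qed.
End Module.
End Induction.

(** * Adjoining a detached strand *)

Section Tensor.
Variables (k : comNzRingType) (A : pzAlgType k) (par : bool -> A -> Prop).
Variables (trA : {scalar A}) (I : finType) (B Bd : I -> A).
Hypothesis HA : dual_bases par trA B Bd.
Variables (z : k) (d : nat) (f : 'I_d -> A).
Hypothesis centf : forall i, supercentral par false (f i).
Hypothesis d_gt0 : (0 < d)%N.
Variables (N : lmodType k) (n : nat) (rA : nat -> {linear A -> lendo_alg N}).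
Variables (rT : nat -> lendo_alg N) (rX : lendo_alg N).
Hypothesis HN : hecke_datum par B Bd z f n rA rT rX.
Let sA : is_superalgebra par := sym_super (db_sym HA).

Lemma central_comm i a : f i * a = a * f i.
Proof.
have L1 : linear (fun a : A => f i * a) by move=> c u v; rewrite mulrDr pz_scalerAr.
have L2 : linear (fun a : A => a * f i) by move=> c u v; rewrite mulrDl pz_scalerAl.
apply: (par_linear_eq sA (g := mk_linear L1) (h := mk_linear L2)) => p b pb /=.
by have [_ /(_ _ _ pb) ->] := centf i; rewrite expr0 scale1r.
Qed.

Lemma twist_false a : twist par trA B Bd false a = a.
Proof.
have L : linear (fun a : A => a) by [].
by apply: (par_linear_eq sA (h := mk_linear L)) => p {}a pa; rewrite (twistE HA _ pa) scale1r.
Qed.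

Lemma twist1 p : twist par trA B Bd p 1 = 1.
Proof. by rewrite (twistE HA p (par_1 sA)) andbF scale1r. Qed.

Lemma twist_even p a : par false a -> twist par trA B Bd p a = a.
Proof. by move=> a0; rewrite (twistE HA p a0) andbF scale1r. Qed.

Lemma twistM p a b : twist par trA B Bd p (a * b)
  = twist par trA B Bd p a * twist par trA B Bd p b.
Proof.
set tw := twist _ _ _ _ _.
have L1 b' : linear (fun a : A => tw (a * b')).
  by move=> c u v; rewrite mulrDl -pz_scalerAl linearP.
have L2 b' : linear (fun a : A => tw a * tw b').
  by move=> c u v; rewrite linearP mulrDl pz_scalerAl.
have L3 a' : linear (fun b : A => tw (a' * b)).
  by move=> c u v; rewrite mulrDr -pz_scalerAr linearP.
have L4 a' : linear (fun b : A => tw a' * tw b).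
  by move=> c u v; rewrite linearP mulrDr pz_scalerAr.
apply: (par_linear_eq sA (g := mk_linear (L1 b)) (h := mk_linear (L2 b))) => q {}a qa /=.
apply: (par_linear_eq sA (g := mk_linear (L3 a)) (h := mk_linear (L4 a))) => r {}b rb /=.
rewrite /tw (twistE HA p (par_M sA qa rb)) (twistE HA p qa) (twistE HA p rb).
rewrite -pz_scalerAl -pz_scalerAr scalerA; congr (_ *: _).
by case: p q r {qa rb tw L1 L2 L3 L4} => [] [] []; rewrite ?expr0 ?expr1 ?mulrNN ?mulr1 ?mul1r.
Qed.

(** N (x) A[Y]/f in the coordinates Y^j b; the vector v (x) a Y^j is [qM j a v]. *)
Definition tenM : lmodType k := {ffun 'I_d * I -> N}.

Fact qM_subproof : {q : nat -> A -> {linear N -> tenM} |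
  forall j a v (p : 'I_d * I),
    q j a v p = if p.1 == j :> nat then trA (Bd p.2 * a) *: v else 0}.
Proof.
have L j a : linear (fun v : N => [ffun p : 'I_d * I =>
    if p.1 == j :> nat then trA (Bd p.2 * a) *: v else 0] : tenM).
  move=> c u v; apply/ffunP => p; rewrite !ffunE; case: ifP => // _.
    by rewrite scalerDr !scalerA mulrC.
  by rewrite scaler0 addr0.
by exists (fun j a => mk_linear (L j a)) => j a v p; rewrite ffunE.
Qed.
Definition qM := sval qM_subproof.
Lemma qME j a v (p : 'I_d * I) :
  qM j a v p = if p.1 == j :> nat then trA (Bd p.2 * a) *: v else 0.
Proof. exact: (svalP qM_subproof). Qed.

Lemma qM_lin j v : linear (fun a => qM j a v).
Proof.
move=> c a b; apply/ffunP => p; rewrite !ffunE !qME; case: ifP => _.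
  by rewrite mulrDr -pz_scalerAr linearP scalerDl scalerA.
by rewrite scaler0 addr0.
Qed.

Lemma qM_sum j (J : Type) (r : seq J) (F : J -> A) v :
  qM j (\sum_(i <- r) F i) v = \sum_(i <- r) qM j (F i) v.
Proof. by rewrite -[LHS]/(mk_linear (qM_lin j v) _) linear_sum. Qed.
Lemma qMZ j c a v : qM j (c *: a) v = c *: qM j a v.
Proof. by rewrite -[LHS]/(mk_linear (qM_lin j v) _) linearZ. Qed.

Lemma qM_crd j a v : qM j a v = \sum_b trA (Bd b * a) *: qM j (B b) v.
Proof.
by rewrite {1}(crdE HA a) qM_sum; apply: eq_bigr => b _; rewrite qMZ.
Qed.

Let dualE a b : trA (Bd a * B b) = (a == b)%:R.
Proof. exact: db_dual HA a b. Qed.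

Lemma qM_gen (m : tenM) : m = \sum_(p : 'I_d * I) qM p.1 (B p.2) (m p).
Proof.
apply/ffunP => p; rewrite sum_ffunE (bigD1 p) //= qME eqxx dualE eqxx scale1r.
rewrite big1 ?addr0 // => q nqp; rewrite qME dualE; case: eqP => // pq.
case: eqP => [pq2|_]; last by rewrite scale0r.
by case/eqP: nqp; apply/esym; apply: injective_projections => //; apply: val_inj.
Qed.

Lemma eq_tenM (V : lmodType k) (g h : tenM -> V) : linear g -> linear h ->
  (forall j b v, (j < d)%N -> g (qM j (B b) v) = h (qM j (B b) v)) -> g =1 h.
Proof.
move=> lg lh gh m; rewrite -[g]/(mk_linear lg : _ -> _) -[h]/(mk_linear lh : _ -> _).
by rewrite (qM_gen m) !linear_sum; apply: eq_bigr => p _; apply: gh.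
Qed.

Lemma eq_tenE (g h : lendo_alg tenM) :
  (forall j b v, (j < d)%N -> g (qM j (B b) v) = h (qM j (B b) v)) -> g = h.
Proof.
by move=> gh; apply: lendoP; apply: eq_tenM gh; apply: lendo_linear.
Qed.

Section Qop.
Variable F : nat -> I -> N -> tenM.
Hypothesis LF : forall j b, linear (F j b).
Fact qop_subproof : linear (fun m : tenM => \sum_(p : 'I_d * I) F p.1 p.2 (m p)).
Proof.
move=> c u v; rewrite scaler_sumr -big_split; apply: eq_bigr => p _ /=.
by rewrite !ffunE LF.
Qed.
Definition qop : lendo_alg tenM := Lendo qop_subproof.
Lemma qopE j b v : (j < d)%N -> qop (qM j (B b) v) = F j b v.
Proof.
move=> jd; have F0 j' b' : F j' b' 0 = 0.
  by rewrite -[F _ _]/(mk_linear (LF j' b') : _ -> _) linear0.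
rewrite /qop /= (bigD1 (Ordinal jd, b)) //= big1 ?addr0.
  by rewrite qME eqxx dualE eqxx scale1r.
move=> [j' b'] /= ne; rewrite qME /=; case: eqP => [ej|_]; last exact: F0.
rewrite dualE; case: eqP => [eb|_]; last by rewrite scale0r F0.
by case/eqP: ne; rewrite eb; congr pair; apply: val_inj.
Qed.
End Qop.

Section Ext.
Variable g : lendo_alg N.
Fact ext_subproof j b : linear (fun v => qM j (B b) (g v)).
Proof. by move=> c u v; rewrite !linearP. Qed.
Definition ext := qop ext_subproof.
Lemma extE j a v : (j < d)%N -> ext (qM j a v) = qM j a (g v).
Proof.
move=> jd; rewrite qM_crd lendo_vsum [RHS]qM_crd; apply: eq_bigr => b _.
by rewrite lendo_vZ qopE.
Qed.
End Ext.

(** The twist is the Koszul sign of c passing the label b of the detached strand. *)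
Fact aLt_subproof : {r : nat -> {linear A -> lendo_alg tenM} | forall l c j b v,
  (j < d)%N -> r l c (qM j (B b) v)
    = qM j (B b) (rA l (twist par trA B Bd (pb par B b) c) v)}.
Proof.
pose F l c j b v := qM j (B b) (rA l (twist par trA B Bd (pb par B b) c) v).
have LF l c j b : linear (F l c j b) by move=> e u v; rewrite /F !linearP.
have L l : linear (fun c => qop (LF l c)).
  move=> e a c; apply: eq_tenE => j b v jd; rewrite lendoDE lendoZE !qopE // /F.
  by rewrite 2!linearP lendoDE lendoZE linearP.
by exists (fun l => mk_linear (L l)) => l c j b v jd; rewrite qopE.
Qed.
Definition aLt := sval aLt_subproof.
Lemma aLtB l c j b v : (j < d)%N -> aLt l c (qM j (B b) v)
    = qM j (B b) (rA l (twist par trA B Bd (pb par B b) c) v).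
Proof. exact: (svalP aLt_subproof). Qed.
Lemma aLtE p l c j a v : par p a -> (j < d)%N ->
  aLt l c (qM j a v) = qM j a (rA l (twist par trA B Bd p c) v).
Proof.
move=> pa jd; rewrite qM_crd lendo_vsum [RHS]qM_crd; apply: eq_bigr => b _.
rewrite lendo_vZ aLtB //; have [->//|nb] := eqVneq (pb par B b) p.
by rewrite (crd_odd HA pa nb) !scale0r.
Qed.

Fact aIt_subproof : {r : {linear A -> lendo_alg tenM} | forall c j b v,
  (j < d)%N -> r c (qM j b v) = qM j (c * b) v}.
Proof.
pose F c (j : nat) b v := qM j (c * B b) v.
have LF c j b : linear (F c j b) by move=> e u v; rewrite /F !linearP.
have L : linear (fun c => qop (LF c)).
  move=> e a c; apply: eq_tenE => j b v jd; rewrite lendoDE lendoZE !qopE // /F.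
  by rewrite mulrDl -pz_scalerAl qM_lin.
exists (mk_linear L) => c j b v jd; rewrite qM_crd lendo_vsum.
rewrite {2}(crdE HA b) mulr_sumr qM_sum; apply: eq_bigr => i _.
by rewrite lendo_vZ qopE // -pz_scalerAr qMZ.
Qed.
Definition aIt := sval aIt_subproof.
Lemma aItE c j b v : (j < d)%N -> aIt c (qM j b v) = qM j (c * b) v.
Proof. exact: (svalP aIt_subproof). Qed.

Fact Yt_subproof : {Y : lendo_alg tenM | forall j a v, (j < d)%N ->
  Y (qM j a v) = if (j.+1 < d)%N then qM j.+1 a v
                 else - \sum_(i < d) qM i (f i * a) v}.
Proof.
pose G j a v := if (j.+1 < d)%N then qM j.+1 a v else - \sum_(i < d) qM i (f i * a) v.
have LG j a : linear (G j a).
  move=> c u v; rewrite /G; case: ifP => _; first exact: linearP.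
  rewrite scalerN scaler_sumr -opprD -big_split; congr (- _).
  by apply: eq_bigr => i _ /=; rewrite linearP.
have LGa j v : linear (fun a => G j a v).
  move=> c a b; rewrite /G; case: ifP => _; first exact: qM_lin.
  rewrite scalerN scaler_sumr -opprD -big_split; congr (- _).
  by apply: eq_bigr => i _ /=; rewrite mulrDr -pz_scalerAr qM_lin.
exists (qop (fun j b => LG j (B b))) => j a v jd.
rewrite -[RHS]/(mk_linear (LGa j v) a) {2}(crdE HA a) linear_sum qM_crd.
by rewrite lendo_vsum; apply: eq_bigr => b _; rewrite lendo_vZ qopE // linearZ.
Qed.
Definition Yt := sval Yt_subproof.
Lemma YtE j a v : (j < d)%N -> Yt (qM j a v) = if (j.+1 < d)%N then qM j.+1 a v
                 else - \sum_(i < d) qM i (f i * a) v.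
Proof. exact: (svalP Yt_subproof). Qed.

Fact evt_subproof : {ev : lendo_alg tenM | forall j a v, (j < d)%N ->
  ev (qM j a v) = qM 0 a ((rX ^+ j) v)}.
Proof.
pose G j a v := qM 0 a ((rX ^+ j) v).
have LG j a : linear (G j a) by move=> c u v; rewrite /G !linearP.
exists (qop (fun j b => LG j (B b))) => j a v jd.
rewrite qM_crd lendo_vsum [RHS]qM_crd; apply: eq_bigr => b _.
by rewrite lendo_vZ qopE.
Qed.
Definition evt := sval evt_subproof.
Lemma evtE j a v : (j < d)%N -> evt (qM j a v) = qM 0 a ((rX ^+ j) v).
Proof. exact: (svalP evt_subproof). Qed.

Let par_fB i b : par (pb par B b) (f i * B b).
Proof. exact: (par_M sA (centf i).1 (par_B HA b)). Qed.

(** The twists of the two legs are the same sign and cancel. *)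
Lemma ext_tel l m j b v : (j < d)%N ->
  tel B Bd (aLt l) (aLt m) (qM j (B b) v)
  = qM j (B b) (tel B Bd (rA l) (rA m) v).
Proof.
move=> jd; rewrite !lendo_sumE linear_sum; apply: eq_bigr => c _.
rewrite !lendoME !aLtB //; congr (qM _ _ _).
rewrite (twistE HA _ (par_B HA c)) (twistE HA _ (par_Bd HA c)).
rewrite [rA l _]linZ [rA m _]linZ !lendoZE lendo_vZ scalerA -exprD addnn.
rewrite -signr_odd odd_double.
by rewrite scale1r.
Qed.

Let E1 (u u' v v' : lendo_alg N) : u * v = u' * v' -> ext u * ext v = ext u' * ext v'.
Proof.
move=> e; apply: eq_tenE => j b w jd; rewrite !lendoME !extE //.
by congr (qM _ _ _); exact: (lendo_app e w).
Qed.
Lemma extM u v : ext (u * v) = ext u * ext v.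
Proof. by apply: eq_tenE => j b w jd; rewrite lendoME !extE. Qed.
Lemma extX u j : ext (u ^+ j) = ext u ^+ j.
Proof.
elim: j => [|j IH]; last by rewrite !exprS extM IH.
by apply: eq_tenE => j b w jd; rewrite extE // !expr0.
Qed.

Lemma ten_hecke : hecke_datum par B Bd z f n aLt (fun i => ext (rT i)) (ext rX).
Proof.
split.
- move=> l ln; have [h1 hM] := hd_A HN ln; split=> [|a b];
    apply: eq_tenE => j c v jd.
    by rewrite aLtB // twist1 h1.
  by rewrite lendoME !aLtB // twistM hM.
- move=> l m ln mn lm p q a b pa qb; apply: eq_tenE => j c v jd.
  rewrite lendoZE !lendoME !aLtB // -linearZ; congr (qM _ _ _).
  rewrite !(twistE HA _ pa) !(twistE HA _ qb) [rA l _]linZ [rA m _]linZ.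
  rewrite !lendoZE !lendo_vZ.
  have := lendo_app (hd_AC HN ln mn lm pa qb) v.
  by rewrite lendoZE !lendoME => ->; rewrite !scalerA; congr (_ *: _); ring.
- move=> i a iN; apply: eq_tenE => j b v jd; rewrite !lendoME !(aLtB, extE) //.
  by congr (qM _ _ _); exact: (lendo_app (hd_TAl HN _ iN) v).
- move=> i a iN; apply: eq_tenE => j b v jd; rewrite !lendoME !(aLtB, extE) //.
  by congr (qM _ _ _); exact: (lendo_app (hd_TAr HN _ iN) v).
- move=> i l a iN ln li li'; apply: eq_tenE => j b v jd.
  rewrite !lendoME !(aLtB, extE) //.
  by congr (qM _ _ _); exact: (lendo_app (hd_TA HN _ iN ln li li') v).
- move=> i iN; apply: eq_tenE => j b v jd; rewrite -extM (hd_quad HN) //.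
  rewrite extE // !lendoDE !lendoZE !lendoME extE // ext_tel //.
  by rewrite linearD linearZ.
- by move=> i iN; rewrite -!extM (hd_braid HN).
- by move=> i j ij jn; rewrite -!extM (hd_TT HN).
- move=> l a ln; apply: eq_tenE => j b v jd; rewrite !lendoME !(aLtB, extE) //.
  by congr (qM _ _ _); exact: (lendo_app (hd_XA HN _ ln) v).
- by move=> i i0 iN; rewrite -!extM (hd_XT HN).
- by move=> n1; rewrite -!extM (hd_XTXT HN).
- move=> n0; apply: eq_tenE => j b v jd; rewrite lendoDE lendo_sumE -extX extE //.
  transitivity (qM j (B b) ((rX ^+ d + \sum_(i < d) rA 0%N (f i) * rX ^+ i) v)).
    rewrite lendoDE lendo_sumE linearD linear_sum; congr (_ + _).
    apply: eq_bigr => i _; rewrite !lendoME -extX extE // aLtB //.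
    by rewrite twist_even //; have [] := centf i.
  by rewrite (hd_cyc HN n0) !lendo0E linear0.
Qed.

Lemma Yt_pow j a v : (j < d)%N -> (Yt ^+ j) (qM 0 a v) = qM j a v.
Proof.
elim: j => [|j IH] jd; first by rewrite expr0 lendo1E.
by rewrite exprS lendoME IH ?YtE ?jd //; lia.
Qed.

Lemma Yt_comm (u : lendo_alg tenM) a a' v v' j : (j < d)%N ->
  (forall i, (i < d)%N -> u (qM i a v) = qM i a' v') ->
  (forall i (i' : 'I_d), (i < d)%N -> u (qM i (f i' * a) v) = qM i (f i' * a') v') ->
  (Yt * u) (qM j a v) = (u * Yt) (qM j a v).
Proof.
move=> jd h1 h2; rewrite !lendoME h1 // !YtE //; case: ifP => jd'; first by rewrite h1.
by rewrite lendo_vN lendo_vsum; congr (- _); apply: eq_bigr => i _; rewrite h2.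
Qed.

Let t0 := tel B Bd (aLt 0%N) aIt.

Lemma aIt_morph : amorph aIt.
Proof.
split=> [|a b]; apply: eq_tenE => j c v jd; first by rewrite aItE // mul1r.
by rewrite lendoME !aItE // mulrA.
Qed.

Lemma aLt_aIt l : (l < n)%N -> scomm par (aLt l) aIt.
Proof.
move=> ln p q a b pa qb; apply: eq_tenE => j c v jd.
rewrite lendoZE !lendoME aItE // aLtB // (aLtE _ _ _ (par_M sA qb (par_B HA c))) //.
rewrite aItE // !(twistE HA _ pa) !(linZ (rA l)) !lendoZE !(linZ (qM j (b * B c))) scalerA.
by congr (_ *: _); case: p (q) (pb _ _ _) {pa qb} => [] [] [];
  rewrite ?expr0 ?expr1 ?mulrNN ?mulr1 ?mul1r.
Qed.

Lemma t0_central i : (0 < n)%N -> t0 * aIt (f i) = t0 * aLt 0%N (f i).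
Proof.
move=> n0; have C := aLt_aIt n0; have AL := hd_A ten_hecke n0.
rewrite -(tel_mulr HA _ C AL aIt_morph).
by rewrite (tel_central HA aIt_morph C (centf i)).
Qed.

(** The sides can differ only for j = d-1: on the left Y^d is reduced with the coefficients f_i on
    the detached strand, on the right X_0^d with the f_i on strand 0. The teleporter identifies the
    two, the f_i being central. *)
Lemma t0_evY : (0 < n)%N -> t0 * (evt * Yt) = t0 * (ext rX * evt).
Proof.
move=> n0; apply: eq_tenE => j b v jd; rewrite !lendoME YtE // evtE // extE //.
case: ifP => jd'; first by rewrite evtE // exprS.
have {jd' jd} dE : d = j.+1 by lia.
rewrite lendo_vN lendo_vsum -lendoME -exprS -dE.
have -> : (rX ^+ d) v = - \sum_(i < d) rA 0%N (f i) ((rX ^+ i) v).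
  apply/eqP; rewrite -addr_eq0; apply/eqP.
  by have := lendo_app (hd_cyc HN n0) v; rewrite lendoDE lendo_sumE.
rewrite (linN (qM _ _)) (lin_sum (qM _ _)) !lendo_vN !lendo_vsum; congr (- _).
apply: eq_bigr => i _; rewrite evtE //.
have -> : qM 0 (f i * B b) ((rX ^+ i) v) = aIt (f i) (qM 0 (B b) ((rX ^+ i) v)).
  by rewrite aItE.
have -> : qM 0 (B b) (rA 0%N (f i) ((rX ^+ i) v))
    = aLt 0%N (f i) (qM 0 (B b) ((rX ^+ i) v)).
  by rewrite aLtB // twist_even //; have [] := centf i.
exact: (lendo_app (t0_central i n0)).
Qed.

Lemma ten_ind : ind_datum par B Bd z f n aLt aIt (fun i => ext (rT i)) (ext rX)
  Yt evt.
Proof.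
have extY u : Yt * ext u = ext u * Yt.
  apply: eq_tenE => j b v jd.
  by apply: (@Yt_comm _ _ (B b) _ (u v)) => // *; rewrite extE.
have YI a : Yt * aIt a = aIt a * Yt.
  apply: eq_tenE => j b v jd; apply: (@Yt_comm _ _ (a * B b) _ v) => // *.
    by rewrite aItE.
  by rewrite aItE // !mulrA central_comm.
split.
- exact: ten_hecke.
- exact: aIt_morph.
- exact: aLt_aIt.
- move=> i a iN; apply: eq_tenE => j b v jd.
  by rewrite !lendoME extE // !aItE // extE.
- move=> a n0; apply: eq_tenE => j b v jd.
  by rewrite !lendoME extE // !aItE // extE.
- by [].
- by [].
- move=> l a ln; apply: eq_tenE => j b v jd.
  apply: (@Yt_comm _ _ (B b) _ (rA l (twist par trA B Bd (pb par B b) a) v)) => // *.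
    by rewrite aLtB.
  by rewrite (aLtE _ _ _ (par_fB _ b)).
- exact: YI.
- move=> i i0 iN; apply: eq_tenE => j b v jd; rewrite !lendoME extE // !evtE // extE //.
  have c1 : GRing.comm (rT i) (rX ^+ j) by apply/commrX/commr_sym/(hd_XT HN).
  by congr (qM _ _ _); apply: (lendo_app (esym c1)).
- move=> n0; apply: eq_tenE => j b v jd; rewrite !lendoME extE // !evtE // extE //.
  by congr (qM _ _ _); rewrite -!lendoME -exprS -exprSr.
- move=> l a ln; apply: eq_tenE => j b v jd; rewrite !lendoME aLtB // !evtE // aLtB //.
  congr (qM _ _ _); have c1 : GRing.comm rX (rA l
    (twist par trA B Bd (pb par B b) a)) by apply: (hd_XA HN).
  by apply: (lendo_app (esym (commrX j (commr_sym c1)))).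
- move=> a; apply: eq_tenE => j b v jd; rewrite !lendoME aItE // !evtE // aItE //.
- by apply: eq_tenE => j b v jd; rewrite !lendoME !evtE // expr0.
- move=> n1; apply: eq_tenE => j b v jd; rewrite !lendoME !evtE // extE // evtE //.
- exact: t0_evY.
(* On v (x) b Y^j this is [ak_relation] with exponent j. *)
- move=> n1; apply: eq_tenE => j b v jd.
  rewrite lendoDE lendoNE lendoZE !lendoME lendoDE lendoNE !lendoME !extE // !evtE //.
  rewrite !extE // -!linearB ext_tel // -linearZ; congr (qM _ _ _).
  exact: (lendo_app (ak_relation HA HN j n1) v).
- move=> g h gh; apply: eq_tenE => j b v jd.
  have := lendo_app (gh j) (qM 0 (B b) v).
  by rewrite !lendoME evtE // expr0 lendo1E Yt_pow.
(* The polynomial commutes with Y and every vector is reached by powers of Y from exponent 0, so it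
   suffices to kill the vectors of exponent 0. *)
- have PY : GRing.comm (Yt ^+ d + \sum_(i < d) aIt (f i) * Yt ^+ i) Yt.
    apply: commr_sym; apply: commrD; first exact: commrX.
    by apply: commr_sum => i _; apply: commrM; [apply: YI | apply: commrX].
  apply: eq_tenE => j b v jd; rewrite -Yt_pow // -lendoME (commrX j PY) lendoME.
  suff -> : (Yt ^+ d + \sum_(i < d) aIt (f i) * Yt ^+ i) (qM 0 (B b) v) = 0.
    by rewrite !lendo_v0.
  have dE : d = d.-1.+1 by lia.
  rewrite lendoDE lendo_sumE {1}dE exprS lendoME Yt_pow ?YtE; try lia.
  rewrite -dE ltnn addrC; apply/eqP; rewrite subr_eq0; apply/eqP.
  by apply: eq_bigr => i _; rewrite lendoME Yt_pow // aItE.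
Qed.
End Tensor.

(** * The induced module of a module *)

Section Step.
Variables (k : comNzRingType) (A : pzAlgType k) (par : bool -> A -> Prop).
Variables (trA : {scalar A}) (I : finType) (B Bd : I -> A).
Hypothesis HA : dual_bases par trA B Bd.
Variables (z : k) (d : nat) (f : 'I_d -> A).
Hypothesis centf : forall i, supercentral par false (f i).
Hypothesis d_gt0 : (0 < d)%N.
Variables (N : lmodType k) (n : nat) (rA : nat -> {linear A -> lendo_alg N}).
Variables (rT : nat -> lendo_alg N) (rX : lendo_alg N).
Hypothesis HN : hecke_datum par B Bd z f n rA rT rX.

Local Notation V := (tenM I d N).
Local Notation aL := (aLt HA d rA).
Local Notation aI := (aIt HA d N).
Local Notation T := (fun i => ext trA B Bd d (rT i)).
Local Notation x := (ext trA B Bd d rX).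
Local Notation Y := (Yt HA f N).
Local Notation ev := (evt HA d rX).
Let D : ind_datum par B Bd z f n aL aI T x Y ev := ten_ind HA centf d_gt0 HN.

Definition stepM : lmodType k := indM V n.
Definition stepA : nat -> {linear A -> lendo_alg stepM} := iA n aL aI.
Definition stepT : nat -> lendo_alg stepM := iT B Bd z n aL aI T.
Definition stepX : lendo_alg stepM := iX B Bd z n aL aI T x Y ev.

Lemma step_hecke : hecke_datum par B Bd z f n.+1 stepA stepT stepX.
Proof. exact: (ind_hecke HA centf D). Qed.
Let HM := step_hecke.

Definition yq (i j : nat) (a : A) (v : N) : stepM := yM V n i (qM trA Bd d N j a v).

Lemma eq_stepM (W : lmodType k) (g h : stepM -> W) : linear g -> linear h ->
  (forall i j b v, (i <= n)%N -> (j < d)%N -> g (yq i j (B b) v) = h (yq i j (B b) v))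
  -> g =1 h.
Proof.
move=> lg lh gh m; rewrite -[g]/(mk_linear lg : _ -> _) -[h]/(mk_linear lh : _ -> _).
rewrite (yM_sum m) !linear_sum; apply: eq_bigr => i _.
have L (g' : {linear stepM -> W}) : linear (fun u : V => g' (yM V n i u)).
  by move=> c u v; rewrite !linearP.
apply: (eq_tenM HA (L (mk_linear lg)) (L (mk_linear lh))) => j b v jd.
by apply: gh; rewrite // -ltnS.
Qed.

(** Closing the new strand: it counts only in the last position and with no dot, and then its label
    is evaluated by tr. In the coordinates, [ord_max] is copy n and [Ordinal d_gt0] is exponent
    0. *)
Fact stepE_subproof : {e : {linear stepM -> N} | forall i j a v,
  (i <= n)%N -> (j < d)%N ->
  e (yq i j a v) = ((i == n) && (j == 0%N))%:R *: (trA a *: v)}.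
Proof.
pose F (m : stepM) := \sum_b trA (B b) *: ((m ord_max : V) (Ordinal d_gt0, b)).
have LF : linear F.
  move=> c u v; rewrite /F scaler_sumr -big_split; apply: eq_bigr => b _ /=.
  by rewrite !ffunE scalerDr !scalerA mulrC.
exists (mk_linear LF) => i j a v iN jd /=; rewrite /F.
transitivity (\sum_b (((i == n) && (j == 0%N))%:R * (trA (Bd b * a) * trA (B b))) *: v).
  apply: eq_bigr => b _; rewrite yME /= eq_sym; case: eqP => _ /=.
    rewrite qME /= eq_sym; case: eqP => _ /=; last by rewrite scaler0 mul0r scale0r.
    by rewrite scalerA mul1r mulrC.
  by rewrite [X in _ *: X]ffunE scaler0 mul0r scale0r.
rewrite -scaler_suml -mulr_sumr scalerA; congr (_ * _ *: _).
rewrite {2}(crdE HA a) linear_sum; apply: eq_bigr => b _.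
by rewrite linearZ.
Qed.
Definition stepE := sval stepE_subproof.
Lemma stepE_yq i j a v : (i <= n)%N -> (j < d)%N ->
  stepE (yq i j a v) = ((i == n) && (j == 0%N))%:R *: (trA a *: v).
Proof. exact: (svalP stepE_subproof). Qed.

Lemma stepE_y i u : (i < n)%N -> stepE (yM V n i u) = 0.
Proof.
move=> iN; have L1 : linear (fun u : V => stepE (yM V n i u)).
  by move=> c u' v'; rewrite !linearP.
have L2 : linear (fun u : V => 0 : N) by move=> c u' v'; rewrite scaler0 addr0.
apply: (eq_tenM HA L1 L2) => j b v jd.
by rewrite stepE_yq ?(ltnW iN) // ltn_eqF // scale0r.
Qed.

(** Adding a strand with label 1 in the last position. The algebra on n strands acts on copy 0
    through conjugation by [sdn n]; the inverse crossings undo this, so that on the image it acts as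
    on N. *)
Fact stepR_subproof : linear (fun v : N => 
  sinv B Bd z stepA stepT n (yq 0 0 1 v)).
Proof. by move=> c u v; rewrite /yq !linearP. Qed.
Definition stepR : {linear N -> stepM} := mk_linear stepR_subproof.

Lemma stepE_comm (g : lendo_alg stepM) (h : lendo_alg N) :
  (forall i j b v, (i <= n)%N -> (j < d)%N ->
    stepE (g (yq i j (B b) v)) = h (stepE (yq i j (B b) v))) ->
  forall m, stepE (g m) = h (stepE m).
Proof.
by apply: eq_stepM => c u v; rewrite !linearP.
Qed.

Lemma stepE_T m u : (m.+1 < n)%N -> stepE (stepT m u) = rT m (stepE u).
Proof.
move=> mn; move: u; apply: stepE_comm => i j b v iN jd.
have [im|im] := ltnP m.+1 i.
  by rewrite /stepT iT_gt // (extE HA) // -/(yq _ _ _ _) !stepE_yq // !lendo_vZ.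
rewrite [in RHS]stepE_yq // ltn_eqF ?(leq_ltn_trans im) // scale0r lendo_v0.
have [im2|im2|im2|im2] := cases4 i m; last by lia.
- by rewrite /stepT iT_lt // stepE_y //; lia.
- by rewrite /yq im2 /stepT iT_eq ?stepE_y //; lia.
- rewrite /yq im2 /stepT iT_S; last by lia.
  by rewrite linearD !stepE_y ?addr0 //; lia.
Qed.

Lemma stepE_X u : (0 < n)%N -> stepE (stepX u) = rX (stepE u).
Proof.
move=> n0; move: u; apply: stepE_comm => i j b v iN jd; case: i iN => [|i] iN.
  rewrite /stepX iX_0 stepE_y // stepE_yq // eq_sym gtn_eqF //= scale0r.
  by rewrite lendo_v0.
rewrite /stepX iX_S // linearB (@stepE_y 0) // subr0 (extE HA) // -/(yq _ _ _ _).
by rewrite !stepE_yq // !lendo_vZ.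
Qed.

(** The Koszul sign of c past the label of the new strand is harmless: odd labels have trace 0. *)
Lemma stepE_A l c u : (l < n)%N -> stepE (stepA l c u) = rA l c (stepE u).
Proof.
move=> ln; move: u; apply: stepE_comm => i j b v iN jd.
rewrite /stepA iAE //; have [ni|ni] := eqVneq i n; last first.
  rewrite stepE_y; last by lia.
  by rewrite stepE_yq // (negPf ni) scale0r lendo_v0.
rewrite ni strand_lt // aLtB // -/(yq _ _ _ _) !stepE_yq // !lendo_vZ.
congr (_ *: _); have := par_B HA b.
case: (pb par B b) => pB; last by rewrite twist_false.
by rewrite (tr_even (db_sym HA) pB) !scale0r.
Qed.

Lemma stepE_Atop c j a v : (j < d)%N ->
  stepE (stepA n c (yq n j a v)) = (j == 0%N)%:R *: (trA (c * a) *: v).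
Proof.
move=> jd; rewrite /stepA iAE // strand_eq aItE // -/(yq _ _ _ _) stepE_yq //.
by rewrite eqxx.
Qed.

Lemma stepR_T m v : (m.+1 < n)%N -> stepT m (stepR v) = stepR (rT m v).
Proof.
move=> mn; rewrite -[LHS]/((stepT m * sinv B Bd z stepA stepT n) (yq 0 0 1 v)).
rewrite (sinv_T HA HM) // lendoME /stepT /yq (@iT_lt _ _ _ _ _ _ _ _ _ _ _ m.+1 0) //.
by rewrite (extE HA).
Qed.

Lemma stepR_A l c v : (l < n)%N -> stepA l c (stepR v) = stepR (rA l c v).
Proof.
move=> ln; rewrite -[LHS]/((stepA l c * sinv B Bd z stepA stepT n) (yq 0 0 1 v)).
rewrite (sinv_A HA HM) // lendoME /stepA /yq iAE // strand_gt //=.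
by rewrite (aLtE HA _ _ _ _ (par_1 (sym_super (db_sym HA)))) // twist_false.
Qed.

(** Only the factor T_0^(-1) of the inverse crossings meets X_0. On a vector w without dots [kap] is
    z t (x w - Y w), and the terms with Y cancel. *)
Lemma stepR_X v : (0 < n)%N -> stepX (stepR v) = stepR (rX v).
Proof.
move=> n0; rewrite -[LHS]/((stepX * sinv B Bd z stepA stepT n) (yq 0 0 1 v)).
rewrite -[RHS]/((sinv B Bd z stepA stepT n) (yq 0 0 1 (rX v))).
have nE : n = n.-1.+1 by lia.
have [|S e cS] := @sinv_split _ _ _ _ _ _ _ HA _ _ _ _ _ _ _ _ HM n.-1; first by lia.
rewrite nE e mulrA cS -mulrA !(lendoME S); congr (S _).
set w := qM trA Bd d N 0 1 v.
have xw : x w = qM trA Bd d N 0 1 (rX v) by rewrite (extE HA).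
have evw : ev w = w by rewrite evtE // expr0.
have TinvE u : Tinv B Bd z stepA stepT 0 (yM V n 0 u)
    = yM V n 1 u - yM V n 0 ((z *: tI B Bd aL aI 0) u).
  rewrite lendoDE lendoNE lendoZE /stepT iT_eq // /stepA tel_iA // strand_eq.
  rewrite strand_gt // (telC HA); last first.
    by apply/scommC/(id_LI D).
  by rewrite -(linZ (yM V n 0)).
rewrite lendoME /yq -xw -/w !TinvE lendo_vB /stepX iX_S // iX_0.
rewrite -addrA -opprD -linearD; congr (_ - yM V n 0 _).
have -> : s1 T 0 (kap B Bd z aL aI x Y ev w)
    = (z *: tI B Bd aL aI 0) (x w - Y (ev w)) by [].
have -> : Y ((z *: tI B Bd aL aI 0) w) = (z *: tI B Bd aL aI 0) (Y w).
  rewrite -!lendoME -pz_scalerAl -pz_scalerAr; apply: lendo_app.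
  by rewrite (tI_Y D).
by rewrite evw lendo_vB subrK.
Qed.

Lemma stepR_Atop c v : stepA n c (stepR v)
  = sinv B Bd z stepA stepT n (yq 0 0 c v).
Proof.
rewrite -[LHS]/((stepA n c * sinv B Bd z stepA stepT n) (yq 0 0 1 v)).
rewrite (sinv_A0 HA HM) // lendoME /stepA /yq iAE // strand_eq aItE //.
by rewrite mulr1.
Qed.

Lemma stepE_Tinv m u : (m.+1 < n)%N ->
  stepE (Tinv B Bd z stepA stepT m u) = Tinv B Bd z rA rT m (stepE u).
Proof.
move=> mn; rewrite /Tinv !lendoDE !lendoNE !lendoZE linearB linearZ stepE_T //.
congr (_ - _ *: _); rewrite !lendo_sumE linear_sum; apply: eq_bigr => b _.
by rewrite !lendoME !stepE_A //; lia.
Qed.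

Lemma stepE_sinv m u : (m < n)%N ->
  stepE (sinv B Bd z stepA stepT m u) = sinv B Bd z rA rT m (stepE u).
Proof.
elim: m u => [|m IH] u mn //.
rewrite [sinv _ _ _ _ _ _]/= [in RHS]/= !lendoME -IH; last by lia.
by rewrite stepE_Tinv.
Qed.

(** T_(n-1) cancels the first inverse crossing. The remaining ones involve the first n strands only,
    hence pass through [stepE], which kills copy 0. *)
Lemma stepE_TR c v : (0 < n)%N -> stepE (stepT n.-1 (stepA n c (stepR v))) = 0.
Proof.
move=> n0; rewrite stepR_Atop; have nE : n = n.-1.+1 by lia.
have {1}-> : sinv B Bd z stepA stepT n
    = Tinv B Bd z stepA stepT n.-1 * sinv B Bd z stepA stepT n.-1.
  by rewrite [in LHS]nE.
rewrite -!lendoME mulrA (TTinv HA HM); last by lia.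
rewrite mul1r stepE_sinv; last by lia.
by rewrite /yq stepE_y // lendo_v0.
Qed.

(** Inverse crossings move copy 0 to copy m up to lower copies; for m = n the latter are invisible
    to [stepE]. *)
Lemma sinv_y m u : (m <= n)%N -> exists w : nat -> V,
  sinv B Bd z stepA stepT m (yM V n 0 u) = yM V n m u + \sum_(i < m) yM V n i (w i).
Proof.
elim: m => [|m IH] mn; first by exists (fun=> 0); rewrite big_ord0 addr0.
have [|w e] := IH; first by lia.
pose t i := z *: tel B Bd (strand aL aI i m) (strand aL aI i m.+1).
have TinvE i v : (i < m)%N -> Tinv B Bd z stepA stepT m (yM V n i v)
    = yM V n i (T m.-1 v - t i v).
  move=> im; rewrite lendoDE lendoNE lendoZE /stepT iT_lt //; last by lia.
  by rewrite /stepA tel_iA ?linearB ?linearZ //; lia.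
have TmE : Tinv B Bd z stepA stepT m (yM V n m u) = yM V n m.+1 u
    + yM V n m (- t m u).
  rewrite lendoDE lendoNE lendoZE /stepT iT_eq //; last by lia.
  by rewrite /stepA tel_iA ?linearN ?linearZ //; lia.
exists (fun i => if (i < m)%N then T m.-1 (w i) - t i (w i) else - t m u).
rewrite [sinv _ _ _ _ _ _]/= lendoME e lendo_vD TmE lendo_vsum.
rewrite (eq_bigr _ (fun (i : 'I_m) _ => TinvE i (w i) (ltn_ord i))).
rewrite big_ord_recr /= ltnn -addrA; congr (_ + _); rewrite addrC; congr (_ + _).
by apply: eq_bigr => i _; rewrite ltn_ord.
Qed.

Lemma stepE_AR c v : stepE (stepA n c (stepR v)) = trA c *: v.
Proof.
rewrite stepR_Atop /yq; have [w ->] := sinv_y (qM trA Bd d N 0 c v) (leqnn n).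
rewrite linearD linear_sum big1 ?addr0 => [|i _]; last exact: stepE_y.
by rewrite -/(yq _ _ _ _) stepE_yq // !eqxx scale1r.
Qed.

Lemma sup_y m u : (m <= n)%N -> sup stepT m (yM V n 0 u) = yM V n m u.
Proof.
elim: m => // m IH mn; rewrite [sup _ _]/= lendoME IH; last by lia.
by rewrite /stepT iT_eq //; lia.
Qed.

(** The product [sdn n] undoes the inverse crossings of [stepR], the dots are then placed in copy 0
    as Y^j, and [sup n] moves the strand to copy n, where [stepE] reads off the exponent. *)
Lemma stepE_loop c j v : (j < d)%N ->
  stepE (stepA n c (sup stepT n ((stepX ^+ j) (sdn stepT n (stepR v)))))
  = (j == 0%N)%:R *: (trA c *: v).
Proof.
move=> jd; rewrite -[sdn stepT n (stepR v)]/((sdn stepT n * sinv B Bd z stepA stepT n)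
  (yq 0 0 1 v)) (sdn_sinv HA HM) // lendo1E /stepX /yq iX_X0 sup_y //.
by rewrite Yt_pow // -/(yq _ _ _ _) stepE_Atop // mulr1.
Qed.
End Step.

(** * The tower of modules and its functionals *)

Section Tower.
Variables (k : comNzRingType) (A : pzAlgType k) (par : bool -> A -> Prop).
Variables (trA : {scalar A}) (I : finType) (B Bd : I -> A).
Hypothesis HA : dual_bases par trA B Bd.
Variables (z : k) (d : nat) (f : 'I_d -> A).
Hypothesis centf : forall i, supercentral par false (f i).
Hypothesis d_gt0 : (0 < d)%N.

(* A module over the cyclotomic algebra on n strands, together with a vector v  *)
(* and a functional e; the trace of h is e (h v).                               *)
Record stage (n : nat) := Stage {
  st_mod : lmodType k;
  st_A : nat -> {linear A -> lendo_alg st_mod};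
  st_T : nat -> lendo_alg st_mod;
  st_X : lendo_alg st_mod;
  st_v : st_mod;
  st_e : {scalar st_mod};
  st_hd : hecke_datum par B Bd z f n st_A st_T st_X
}.

Fact stage0_A_subproof : linear (fun _ : A => 0 : lendo_alg k^o).
Proof. by move=> c u v; rewrite scaler0 addr0. Qed.
Fact stage0_e_subproof : linear_for *%R (fun c : k^o => c : k).
Proof. by []. Qed.
Fact stage0_hd_subproof : hecke_datum par B Bd z f 0
  (fun=> mk_linear stage0_A_subproof) (fun=> 0) 0.
Proof. by []. Qed.
Definition stage0 : stage 0 :=
  @Stage 0 _ _ _ _ (1 : k^o) (mk_scalar stage0_e_subproof) stage0_hd_subproof.

Section StepStage.
Variables (n : nat) (s : stage n).
Local Notation N := (st_mod s).
Definition stE := stepE HA d_gt0 N n.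
Definition stR := stepR HA z d n (st_A s) (st_T s).

Fact step_e_subproof : linear_for *%R (fun u => st_e s (stE u)).
Proof. by move=> c u v; rewrite !linearP. Qed.
Definition step_stage : stage n.+1 :=
  Stage (stR (st_v s)) (mk_scalar step_e_subproof)
    (step_hecke HA centf d_gt0 (st_hd s)).
End StepStage.

Fixpoint tower n : stage n := if n is m.+1 then step_stage (tower m) else stage0.

Local Notation E n := (stE (tower n)).
Local Notation R n := (stR (tower n)).

(* Operators on all the stages from m on, compatible with the two maps between *)
(* consecutive stages.                                                         *)
Definition fam := forall n, lendo_alg (st_mod (tower n)).
Definition compatible (m : nat) (g : fam) := forall n, (m <= n)%N ->
  (forall v, g n.+1 (R n v) = R n (g n v)) /\
  (forall u, E n (g n.+1 u) = g n (E n u)).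

Definition famM (g h : fam) : fam := fun n => g n * h n.
Definition famA l a : fam := fun n => st_A (tower n) l a.
Definition famT i : fam := fun n => st_T (tower n) i.
Definition famX : fam := fun n => st_X (tower n).

Lemma compatible_leq m m' g : (m <= m')%N -> compatible m g -> compatible m' g.
Proof. by move=> mm' cg n mn; apply: cg; apply: leq_trans mn. Qed.

Lemma compatible_M m g h : compatible m g -> compatible m h ->
  compatible m (famM g h).
Proof.
move=> cg ch n mn; have [gR gE] := cg n mn; have [hR hE] := ch n mn.
by split=> u; rewrite /famM !lendoME ?hR ?gR ?gE ?hE.
Qed.

Lemma compatible_D m c g h : compatible m g -> compatible m h ->
  compatible m (fun n => c *: g n + h n).
Proof.
move=> cg ch n mn; have [gR gE] := cg n mn; have [hR hE] := ch n mn.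
split=> u; rewrite !lendoDE !lendoZE; first by rewrite gR hR linearP.
by rewrite linearP gE hE.
Qed.

Lemma compatible_0 m : compatible m (fun=> 0).
Proof. by move=> n mn; split=> u; rewrite !lendo0E linear0. Qed.

Lemma compatible_1 m : compatible m (fun=> 1).
Proof. by []. Qed.

Lemma compatible_A m l a : (l < m)%N -> compatible m (famA l a).
Proof.
move=> lm n mn; have ln : (l < n)%N by lia.
by split=> u; rewrite /famA /=; [apply: (stepR_A HA centf d_gt0 (st_hd (tower n)))
  | apply: stepE_A].
Qed.

Lemma compatible_T m i : (i.+1 < m)%N -> compatible m (famT i).
Proof.
move=> lm n mn; have ln : (i.+1 < n)%N by lia.
by split=> u; rewrite /famT /=; [apply: (stepR_T HA centf d_gt0 (st_hd (tower n)))
  | apply: stepE_T].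
Qed.

Lemma compatible_X m : (0 < m)%N -> compatible m famX.
Proof.
move=> lm n mn; have ln : (0 < n)%N by lia.
by split=> u; rewrite /famX /=; [apply: (stepR_X HA centf d_gt0 (st_hd (tower n)))
  | apply: stepE_X].
Qed.

(** * The traces on the subalgebras, read off from the tower *)

Section Functionals.
Variables (H : pzAlgType k) (N : nat) (rA : nat -> {linear A -> H}).
Variables (rT : nat -> H) (rX : H).
Hypothesis HH : hecke_datum par B Bd z f N rA rT rX.
Variable Phi : H -> lendo_alg (st_mod (tower N)).
Hypothesis PhiP : forall c x y, Phi (c *: x + y) = c *: Phi x + Phi y.
Hypothesis PhiM : forall x y, Phi (x * y) = Phi x * Phi y.
Hypothesis Phi1 : Phi 1 = 1.
Hypothesis PhiA : forall l a, (l < N)%N -> Phi (rA l a) = st_A (tower N) l a.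
Hypothesis PhiT : forall i, (i.+1 < N)%N -> Phi (rT i) = st_T (tower N) i.
Hypothesis PhiX : (0 < N)%N -> Phi rX = st_X (tower N).

(* The homogeneous elements of the subalgebra on the first m strands.           *)
Inductive sub (m : nat) : bool -> H -> Prop :=
| sub_1 : sub m false 1
| sub_A l a p q x : (l < m)%N -> par p a -> sub m q x ->
    sub m (p (+) q) (rA l a * x)
| sub_T i q x : (i.+1 < m)%N -> sub m q x -> sub m q (rT i * x)
| sub_X q x : (0 < m)%N -> sub m q x -> sub m q (rX * x)
| sub_0 q : sub m q 0
| sub_D q c x y : sub m q x -> sub m q y -> sub m q (c *: x + y).

Definition lifts (x : H) (g : fam) := Phi x = g N.

Lemma lifts_M x y g h : lifts x g -> lifts y h -> lifts (x * y) (famM g h).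
Proof. by rewrite /lifts PhiM => -> ->. Qed.

Lemma sub_lifts m p x : (m <= N)%N -> sub m p x ->
  exists2 g, compatible m g & lifts x g.
Proof.
move=> mN; elim=> {p x}.
- by exists (fun=> 1); [apply: compatible_1 | rewrite /lifts Phi1].
- move=> l a p q x lm pa _ [g cg lg]; exists (famM (famA l a) g).
    by apply: compatible_M => //; apply: compatible_A.
  by apply: lifts_M => //; rewrite /lifts PhiA //; lia.
- move=> i q x im _ [g cg lg]; exists (famM (famT i) g).
    by apply: compatible_M => //; apply: compatible_T.
  by apply: lifts_M => //; rewrite /lifts PhiT //; lia.
- move=> q x m0 _ [g cg lg]; exists (famM famX g).
    by apply: compatible_M => //; apply: compatible_X.
  by apply: lifts_M => //; rewrite /lifts PhiX //; lia.
- move=> q; exists (fun=> 0); first exact: compatible_0.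
  have := PhiP (-1) 1 1; rewrite scaleN1r addNr /lifts => ->.
  by rewrite scaleN1r addNr.
- move=> q c x y _ [g cg lg] _ [h ch lh]; exists (fun n => c *: g n + h n).
    exact: compatible_D.
  by rewrite /lifts PhiP lg lh.
Qed.

Variable c : A.
Hypothesis trc : trA c = 1.

(* tau r is the trace on the first N - r strands, seen on the whole algebra.    *)
Fixpoint tau (r : nat) (x : H) : k :=
  if r is r'.+1 then tau r' (x * rA (N - r)%N c)
  else st_e (tower N) (Phi x (st_v (tower N))).

Lemma tau_lin r : linear_for *%R (tau r).
Proof.
elim: r => [|r IH] a x y /=.
  by rewrite PhiP lendoDE lendoZE linearP.
by rewrite mulrDl -pz_scalerAl IH.
Qed.

(** Each factor c on a further strand is absorbed by [stepE_AR], because tr(c) = 1. *)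
Lemma tauE m x g : (m <= N)%N -> compatible m g -> lifts x g ->
  tau (N - m) x = st_e (tower m) (g m (st_v (tower m))).
Proof.
move=> mN; move Er : (N - m)%N => r; elim: r m Er mN x g => [|r IH] m Er mN x g cg lg /=.
  by have -> : m = N by [lia]; rewrite lg.
have mE : m = (N - r.+1)%N by lia.
rewrite -mE (IH m.+1 _ _ _ (famM g (famA m c))); try lia; last 2 first.
- apply: compatible_M; first exact: compatible_leq cg.
  exact: compatible_A.
- by apply: lifts_M => //; rewrite /lifts PhiA //; lia.
have [_ gE] := cg m (leqnn m).
transitivity (st_e (tower m) (E m (g m.+1 (famA m c m.+1 (R m (st_v (tower m))))))).
  by [].
rewrite gE; congr (st_e _ (g m _)).
rewrite [LHS](stepE_AR HA centf d_gt0 (st_hd (tower m))).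
by rewrite trc scale1r.
Qed.

Lemma tau_0 : tau N 1 = 1.
Proof.
rewrite -[X in tau X]subn0 (tauE (leq0n N) (@compatible_1 0)) //.
Qed.

(** Compatibility takes x out of E and y through R, and what remains between E and R is evaluated by
    [stepE_TR]; in [tau_loop] it is evaluated by [stepE_loop]. *)
Lemma tau_T m p q x y a : (0 < m)%N -> (m < N)%N -> sub m p x -> sub m q y ->
  tau (N - m.+1) (x * (rT m.-1 * rA m a) * y) = 0.
Proof.
move=> m0 mN /(sub_lifts (ltnW mN)) [g cg lg] /(sub_lifts (ltnW mN)) [h ch lh].
have cS u : compatible m u -> compatible m.+1 u by apply: compatible_leq.
rewrite (tauE mN (g := famM (famM g (famM (famT m.-1) (famA m a))) h)).
- transitivity (st_e (tower m) (E m (g m.+1 (famT m.-1 m.+1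
    (famA m a m.+1 (h m.+1 (R m (st_v (tower m))))))))); first by [].
  have [gR gE] := cg m (leqnn m); have [hR hE] := ch m (leqnn m).
  rewrite gE hR [E m _](stepE_TR HA centf d_gt0 (st_hd (tower m))) //.
  by rewrite lendo_v0 linear0.
- apply: compatible_M; last exact: cS.
  apply: compatible_M; first exact: cS.
  by apply: compatible_M; [apply: compatible_T; lia | apply: compatible_A].
- do 3!apply: lifts_M => //; rewrite /lifts ?PhiT ?PhiA //; lia.
Qed.

Definition famsup m : fam := fun n => sup (st_T (tower n)) m.
Definition famsdn m : fam := fun n => sdn (st_T (tower n)) m.

Lemma tau_loop m p q x y a j : (m < N)%N -> (j < d)%N -> sub m p x -> sub m q y ->
  tau (N - m.+1) (x * (rA m a * (sup rT m * rX ^+ j * sdn rT m)) * y)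
  = (j == 0%N)%:R * trA a * tau (N - m) (x * y).
Proof.
move=> mN jd /(sub_lifts (ltnW mN)) [g cg lg] /(sub_lifts (ltnW mN)) [h ch lh].
have cS u : compatible m u -> compatible m.+1 u by apply: compatible_leq.
have csup i : (i <= m)%N -> compatible m.+1 (famsup i) /\ lifts (sup rT i) (famsup i).
  elim: i => [|i IH] im; first by split; [apply: compatible_1|apply: Phi1].
  have [|c1 l1] := IH; first by lia.
  split; first by apply: (@compatible_M _ (famT i)) => //; apply: compatible_T.
  by apply: (@lifts_M _ _ (famT i)) => //; apply: PhiT; lia.
have csdn i : (i <= m)%N -> compatible m.+1 (famsdn i) /\ lifts (sdn rT i) (famsdn i).
  elim: i => [|i IH] im; first by split; [apply: compatible_1|apply: Phi1].
  have [|c1 l1] := IH; first by lia.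
  split; first by apply: (@compatible_M _ _ (famT i)) => //; apply: compatible_T.
  by apply: (@lifts_M _ _ _ (famT i)) => //; apply: PhiT; lia.
have cX i : compatible m.+1 (fun n => famX n ^+ i) /\ lifts (rX ^+ i) (fun n => famX n ^+ i).
  elim: i => [|i [c1 l1]]; first by split; [apply: compatible_1|apply: Phi1].
  split=> [n mn|].
    have := @compatible_M m.+1 famX _ (compatible_X (ltn0Sn m)) c1 n mn.
    by rewrite /famM exprS exprS.
  rewrite /lifts !exprS PhiM l1; congr (_ * _); apply: PhiX; lia.
have [cs ls] := csup m (leqnn m); have [ct lt] := csdn m (leqnn m).
have [cx lx] := cX j.
set loop := famM (famM (famsup m) (fun n => famX n ^+ j)) (famsdn m).
have cl : compatible m.+1 loop by do 2!apply: compatible_M => //.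
have ll : lifts (sup rT m * rX ^+ j * sdn rT m) loop by do 2!apply: lifts_M => //.
rewrite (tauE mN (g := famM (famM g (famM (famA m a) loop)) h)); last 2 first.
- apply: compatible_M; last exact: cS.
  apply: compatible_M; first exact: cS.
  by apply: compatible_M => //; apply: compatible_A.
- by do 3!apply: lifts_M => //; rewrite /lifts ?PhiA //; lia.
rewrite (tauE (ltnW mN) (g := famM g h)); last 2 first.
- exact: compatible_M.
- exact: lifts_M.
have [gR gE] := cg m (leqnn m); have [hR hE] := ch m (leqnn m).
transitivity (st_e (tower m) (E m (g m.+1 (famA m a m.+1 (loop m.+1
    (h m.+1 (R m (st_v (tower m))))))))); first by [].
rewrite gE hR.
rewrite [E m _](stepE_loop HA centf d_gt0 (st_hd (tower m)) a _ jd).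
by rewrite !lendo_vZ !linearZ /= mulrA.
Qed.
End Functionals.
End Tower.

(** * Reduced words *)

Section Words.
Local Open Scope nat_scope.

(** Only moves that preserve the product of the T_i are allowed; cancelling a repeated letter is not
    one of them. *)
Inductive braid_eq : seq nat -> seq nat -> Prop :=
| braid_eq_refl s : braid_eq s s
| braid_eq_trans t s u : braid_eq s t -> braid_eq t u -> braid_eq s u
| braid_eq_comm u v i j : (i.+1 < j) || (j.+1 < i) ->
    braid_eq (u ++ [:: i, j & v]) (u ++ [:: j, i & v])
| braid_eq_braid u v i : braid_eq (u ++ [:: i, i.+1, i & v]) (u ++ [:: i.+1, i, i.+1 & v])
| braid_eq_braid' u v i : braid_eq (u ++ [:: i.+1, i, i.+1 & v]) (u ++ [:: i, i.+1, i & v]).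

Lemma braid_eq_cat u v s t : braid_eq s t -> braid_eq (u ++ s ++ v) (u ++ t ++ v).
Proof.
elim=> {s t} [s|t s w _ IH1 _ IH2|a b i j ij|a b i|a b i]; first exact: braid_eq_refl.
- exact: braid_eq_trans IH1 IH2.
- by rewrite -!catA /= !catA; apply: braid_eq_comm.
- by rewrite -!catA /= !catA; apply: braid_eq_braid.
- by rewrite -!catA /= !catA; apply: braid_eq_braid'.
Qed.
Lemma braid_eq_catl u s t : braid_eq s t -> braid_eq (u ++ s) (u ++ t).
Proof. by move=> /(braid_eq_cat u [::]); rewrite !cats0. Qed.
Lemma braid_eq_catr v s t : braid_eq s t -> braid_eq (s ++ v) (t ++ v).
Proof. exact: (braid_eq_cat [::]). Qed.

Lemma braid_eq_size s t : braid_eq s t -> size s = size t.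
Proof.
by elim=> {s t} // [t s u _ -> _ ->//|u v i j _|u v i|u v i]; rewrite !size_cat.
Qed.

Lemma braid_eq_all (P : pred nat) s t : braid_eq s t -> all P s = all P t.
Proof.
elim=> {s t} // [t s u _ -> _ ->//|u v i j _|u v i|u v i]; rewrite !all_cat /=.
- by rewrite (andbCA (P i)).
- by case: (P i) (P i.+1) => [] [].
- by case: (P i) (P i.+1) => [] [].
Qed.

Definition swp (i x : nat) := if x == i then i.+1 else if x == i.+1 then i else x.
Definition word_act (s : seq nat) (x : nat) := foldl (fun x i => swp i x) x s.

Lemma word_act_cat s t x : word_act (s ++ t) x = word_act t (word_act s x).
Proof. exact: foldl_cat. Qed.

Lemma swpK i : involutive (swp i).
Proof. by move=> x; rewrite /swp; repeat case: eqP; lia. Qed.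

Lemma word_act_inj s : injective (word_act s).
Proof.
elim: s => [|i s IH] x y //= /IH e; by rewrite -[x](swpK i) e swpK.
Qed.

Lemma braid_eq_act s t : braid_eq s t -> word_act s =1 word_act t.
Proof.
elim=> {s t} // [t s u _ e1 _ e2 x|u v i j ij x|u v i x|u v i x]; first by rewrite e1 e2.
all: rewrite !word_act_cat /=; congr foldl; rewrite /swp; repeat case: eqP; lia.
Qed.

(* The descending run m-1, ..., i. *)
Fixpoint block m i : seq nat :=
  if m is m'.+1 then if i <= m' then m' :: block m' i else [::] else [::].

Lemma block_ge m i : m <= i -> block m i = [::].
Proof. by case: m => //= m mi; rewrite leqNgt mi. Qed.
Lemma block_lt m i : i <= m -> block m.+1 i = m :: block m i.
Proof. by rewrite /= => ->. Qed.
Lemma block_rcons m i : i < m -> block m i = rcons (block m i.+1) i.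
Proof.
elim: m => // m IH; rewrite ltnS leq_eqVlt => /orP[/eqP<-|im].
  by rewrite /= leqnn ltnn block_ge.
by rewrite /= (ltnW im) im /= IH.
Qed.
Lemma block_cat m k i : i <= k <= m -> block m i = block m k ++ block k i.
Proof.
elim: m => [|m IH] ikm; first by have [-> ->] : i = 0 /\ k = 0 by lia.
have [->|km] : k = m.+1 \/ k <= m by lia.
  by rewrite (block_ge (leqnn m.+1)).
by rewrite !block_lt ?IH //; lia.
Qed.
Lemma all_block m i : all (fun k => i <= k < m) (block m i).
Proof.
elim: m => //= m IH; case: leqP => //= im; rewrite im ltnSn /=.
by apply: sub_all IH => k; lia.
Qed.

(** The normal form along the chain of symmetric groups: the descending runs represent the cosets of
    the group on m-1 letters in the group on m letters. *)
Fixpoint canonical_word m (c : seq nat) : Prop :=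
  if m is m'.+1 then exists c' i, [/\ canonical_word m' c', i <= m' & c = c' ++ block m' i]
  else c = [::].

Lemma canon_all m c : canonical_word m c -> all (fun i => i.+1 < m) c.
Proof.
elim: m c => [|m IH] c /=; first by move=> ->.
move=> [c' [i [/IH ac im ->]]]; rewrite all_cat; apply/andP; split.
  by apply: sub_all ac => k; lia.
by apply: sub_all (all_block m i) => k; lia.
Qed.

Lemma canon_nil m : canonical_word m [::].
Proof. by elim: m => //= m IH; exists [::], m; rewrite block_ge. Qed.

Lemma word_act_fix s x : all (fun i => i.+1 < x) s -> word_act s x = x.
Proof.
elim: s => //= i s IH /andP[ix /IH {2}<-]; congr foldl; rewrite /swp.
by rewrite !gtn_eqF //; lia.
Qed.

Lemma word_act_block m i : i <= m -> word_act (block m i) m = i.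
Proof.
elim: m => [|m IH]; first by rewrite leqn0 => /eqP->.
rewrite leq_eqVlt => /orP[/eqP->|im]; first by rewrite block_ge.
by rewrite block_lt //= /swp eqxx gtn_eqF // IH.
Qed.

(** The image of the last point is the end of the last run, since the rest of the word fixes that
    point; then induction. *)
Lemma canon_uniq m c c' : canonical_word m c -> canonical_word m c' -> word_act c =1 word_act c' -> c = c'.
Proof.
elim: m c c' => [|m IH] c c' /=; first by move=> -> ->.
move=> [c1 [i [k1 im ->]]] [c2 [j [k2 jm ->]]] e.
have := e m; rewrite !word_act_cat (word_act_fix (canon_all k1)) (word_act_fix (canon_all k2)) !word_act_block //.
move=> ij; rewrite ij in e *; congr (_ ++ _); apply: IH => // x.
by have := e x; rewrite !word_act_cat => /word_act_inj.
Qed.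

Lemma braid_eq_move k s : all (fun i => (i.+1 < k) || (k.+1 < i)) s -> braid_eq (rcons s k) (k :: s).
Proof.
elim: s => [|i s IH] //=; first by move=> _; apply: braid_eq_refl.
move=> /andP[ik /IH e]; apply: braid_eq_trans (braid_eq_catl [:: i] e) _.
exact: (braid_eq_comm [::]).
Qed.

Definition repeats s := exists t i u, braid_eq s (t ++ [:: i, i & u]).

(** The letter k moves left past the letters below k-1, a braid move turns k, k-1, k into k-1, k,
    k-1, and the first k-1 moves on past the letters above k. *)
Lemma block_shift m i k : i < k < m -> braid_eq (rcons (block m i) k) (k.-1 :: block m i).
Proof.
case: k => // k ikm; rewrite (@block_cat m k.+2 i); last lia.
rewrite !block_lt; try lia.
have e1 : braid_eq (rcons (block k i) k.+1) (k.+1 :: block k i).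
  by apply: braid_eq_move; apply: sub_all (all_block k i) => l; lia.
have e2 : braid_eq (rcons (block m k.+2) k) (k :: block m k.+2).
  by apply: braid_eq_move; apply: sub_all (all_block m k.+2) => l; lia.
have -> : rcons (block m k.+2 ++ [:: k.+1, k & block k i]) k.+1
    = (block m k.+2 ++ [:: k.+1; k]) ++ rcons (block k i) k.+1.
  by rewrite -!cats1 -!catA.
apply: braid_eq_trans (braid_eq_catl _ e1) _; rewrite -catA /=.
apply: braid_eq_trans (braid_eq_braid' _ _ _) _.
by have := braid_eq_catr [:: k.+1, k & block k i] e2; rewrite cat_rcons.
Qed.

(** A new letter prolongs the last run, repeats its end, or passes through the run, possibly lowered
    by one, to be inserted in the shorter canonical word. *)
Lemma canon_rcons m c k : canonical_word m c -> k.+1 < m ->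
  (exists2 c', canonical_word m c' & braid_eq (rcons c k) c') \/ repeats (rcons c k).
Proof.
elim: m c k => [|m IH] c k //= [c' [i [cc im ->]]] km.
have rec l : l.+1 < m -> braid_eq (rcons (block m i) k) (l :: block m i) ->
    (exists2 c1, (exists c0 j, [/\ canonical_word m c0, j <= m & c1 = c0 ++ block m j]) &
       braid_eq (rcons (c' ++ block m i) k) c1) \/ repeats (rcons (c' ++ block m i) k).
  move=> lm e; have e' : braid_eq (rcons (c' ++ block m i) k) (rcons c' l ++ block m i).
    by rewrite rcons_cat cat_rcons; apply: braid_eq_catl.
  have [[c0 k0 e0]|[t [j [u e0]]]] := IH _ _ cc lm.
    left; exists (c0 ++ block m i); first by exists c0, i.
    exact: braid_eq_trans e' (braid_eq_catr _ e0).
  right; exists t, j, (u ++ block m i); apply: braid_eq_trans e' _.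
  by have := braid_eq_catr (block m i) e0; rewrite -catA.
have [ki|[ki|[ki|ki]]] : k.+1 = i \/ k = i \/ k.+1 < i \/ i < k by lia.
- left; exists (c' ++ block m k); last first.
    by rewrite rcons_cat (block_rcons (m := m) (i := k)) ?ki //; apply: braid_eq_refl.
  by exists c', k; split=> //; lia.
- right; exists (c' ++ block m k.+1), k, [::]; rewrite -ki block_rcons; last lia.
  by rewrite -!cats1 -!catA /=; apply: braid_eq_refl.
- apply: (rec k); first lia.
  by apply: braid_eq_move; apply: sub_all (all_block m i) => l; lia.
- by apply: (rec k.-1); [lia | apply: block_shift; lia].
Qed.

Lemma canonical_form m s : all (fun i => i.+1 < m) s ->
  (exists2 c, canonical_word m c & braid_eq s c) \/ repeats s.
Proof.
elim/last_ind: s => [|s k IH]; first by left; exists [::]; [apply: canon_nil | apply: braid_eq_refl].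
rewrite all_rcons => /andP[km /IH[[c cc e]|[t [i [u e]]]]].
  have e' : braid_eq (rcons s k) (rcons c k) by rewrite -!cats1; apply: braid_eq_catr.
  have [[c' cc' e2]|[t [i [u e2]]]] := canon_rcons cc km.
    by left; exists c' => //; apply: braid_eq_trans e' e2.
  by right; exists t, i, u; apply: braid_eq_trans e' e2.
right; exists t, i, (rcons u k); rewrite -!cats1.
by have := braid_eq_catr [:: k] e; rewrite -catA.
Qed.

Lemma word_act_repeats t i u : word_act (t ++ [:: i, i & u]) =1 word_act (t ++ u).
Proof. by move=> x; rewrite !word_act_cat /= swpK. Qed.

(** Deleting a repeated pair keeps the permutation and shortens the word; without one the word is
    braid equivalent to a canonical word of the same length. *)
Lemma canon_shortest m s : all (fun i => i.+1 < m) s ->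
  exists c, [/\ canonical_word m c, word_act c =1 word_act s & size c <= size s].
Proof.
have [l] := ubnP (size s); elim: l s => // l IH s sl sm.
have [[c cc e]|[t [i [u e]]]] := canonical_form sm.
  by exists c; split=> //; [move=> x; rewrite (braid_eq_act e) | rewrite (braid_eq_size e)].
have := braid_eq_size e; rewrite size_cat /= => es.
have [||c [cc e' sc]] := IH (t ++ u); first by rewrite size_cat; lia.
  by move: sm; rewrite (braid_eq_all _ e) !all_cat /= => /and4P[-> _ _ ->].
exists c; split=> // [x|]; first by rewrite e' (braid_eq_act e) word_act_repeats.
by move: sc; rewrite size_cat; lia.
Qed.

(** * Reduced expressions of permutations *)

Section Reduced.
Variable n : nat.
Local Notation word := (map (@nat_of_ord n)).

Lemma val_prod_simple_tr (s : seq 'I_n) (x : 'I_n.+1) :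
  (\prod_(i <- s) simple_tr i)%g x = word_act (word s) x :> nat.
Proof.
elim: s x => [|i s IH] x; first by rewrite big_nil perm1.
rewrite big_cons permM IH /=; congr foldl; rewrite /simple_tr /swp.
case: tpermP => [->|->|/eqP + /eqP]; rewrite /= ?eqxx //.
  by rewrite gtn_eqF.
by rewrite -!val_eqE /= /bump /= add1n => /negPf -> /negPf ->.
Qed.

Lemma all_word (s : seq 'I_n) : all (fun i => i.+1 < n.+1) (word s).
Proof. by apply/allP => x /mapP[i _ ->]; rewrite ltnS. Qed.

Lemma wordP s : all (fun i => i.+1 < n.+1) s -> exists s' : seq 'I_n, word s' = s.
Proof.
elim: s => [|i s IH] /=; first by exists [::].
rewrite ltnS => /andP[im /IH[s' <-]]; by exists (Ordinal im :: s').
Qed.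

Lemma word_act_word (s s' : seq 'I_n) :
  (\prod_(i <- s) simple_tr i = \prod_(i <- s') simple_tr i)%g <->
  word_act (word s) =1 word_act (word s').
Proof.
split=> [e x|e]; last first.
  by apply/permP => x; apply: val_inj; rewrite /= !val_prod_simple_tr.
have [xn|xn] := ltnP x n.+1; first by rewrite -!(val_prod_simple_tr _ (Ordinal xn)) e.
by rewrite !word_act_fix //; apply: sub_all (all_word _) => i; lia.
Qed.

Lemma canon_reduced (s : seq 'I_n) : canonical_word n.+1 (word s) ->
  reduced_expression (\prod_(i <- s) simple_tr i)%g s.
Proof.
move=> cs; split=> // s' /word_act_word e.
have [c [cc ec sc]] := canon_shortest (all_word s').
have -> : size s = size c.
  rewrite -(size_map (@nat_of_ord n)); congr size; apply: canon_uniq cs cc _ => x.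
  by rewrite e ec.
by rewrite size_map in sc.
Qed.

(** A repeated letter, after braid moves, would yield a shorter word for the same permutation. *)
Lemma reduced_canon w (s : seq 'I_n) : reduced_expression w s ->
  exists2 c, canonical_word n.+1 c & braid_eq (word s) c.
Proof.
move=> [ws smin]; have [//|[t [i [u e]]]] := canonical_form (all_word s).
have := all_word s; rewrite (braid_eq_all _ e) all_cat /= => /and4P[ht _ _ hu].
have [s' es'] : exists s' : seq 'I_n, word s' = t ++ u.
  by apply: wordP; rewrite all_cat ht hu.
have le : size s <= size s'.
  apply: smin; rewrite ws; apply/word_act_word => x.
  by rewrite (braid_eq_act e) word_act_repeats es'.
move: le; have := braid_eq_size e; have := congr1 size es'; rewrite !size_map !size_cat /=; lia.
Qed.

Lemma reduced_size0 w (s : seq 'I_n) : reduced_expression w s -> (w == 1%g) = (size s == 0).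
Proof.
move=> [ws smin]; apply/eqP/eqP => [w1|/size0nil s0]; last by rewrite ws s0 big_nil.
by apply/eqP; rewrite -leqn0; apply: (smin [::]); rewrite big_nil.
Qed.
End Reduced.
End Words.

(** * Mackey decomposition *)

Section Subalgebras.
Variables (k : comNzRingType) (A : pzAlgType k) (par : bool -> A -> Prop).
Variables (trA : {scalar A}) (I : finType) (B Bd : I -> A).
Hypothesis HA : dual_bases par trA B Bd.
Variables (z : k) (d : nat) (f : 'I_d -> A).
Hypothesis centf : forall i, supercentral par false (f i).
Variables (H : pzAlgType k) (N : nat) (rA : nat -> {linear A -> H}).
Variables (rT : nat -> H) (rX : H).
Hypothesis HH : hecke_datum par B Bd z f N rA rT rX.

Local Notation sub := (sub par rA rT rX).
Local Notation xx := (jm rT rX).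
Local Notation tl l m := (tel B Bd (rA l) (rA m)).
Let sA : is_superalgebra par := sym_super (db_sym HA).

Lemma sub_Z m p c x : sub m p x -> sub m p (c *: x).
Proof. by move=> sx; rewrite -[_ *: _]addr0; apply: sub_D => //; apply: sub_0. Qed.
Lemma sub_add m p x y : sub m p x -> sub m p y -> sub m p (x + y).
Proof. by move=> sx sy; rewrite -[x]scale1r; apply: sub_D. Qed.
Lemma sub_N m p x : sub m p x -> sub m p (- x).
Proof. by move=> sx; rewrite -scaleN1r; apply: sub_Z. Qed.
Lemma sub_sum m p (J : Type) (r : seq J) (P : pred J) (F : J -> H) :
  (forall i, P i -> sub m p (F i)) -> sub m p (\sum_(i <- r | P i) F i).
Proof.
move=> sF; elim/big_rec: _ => [|i x Pi sx]; first exact: sub_0.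
by apply: sub_add => //; apply: sF.
Qed.

Lemma sub_leq m m' p x : (m <= m')%N -> sub m p x -> sub m' p x.
Proof.
move=> mm'; elim=> {p x}; first exact: sub_1.
- by move=> l a p q x lm pa _ sx; apply: sub_A => //; apply: leq_trans mm'.
- by move=> i q x im _ sx; apply: sub_T => //; apply: leq_trans mm'.
- by move=> q x m0 _ sx; apply: sub_X => //; apply: leq_trans mm'.
- by move=> q; apply: sub_0.
- by move=> q c x y _ sx _ sy; apply: sub_D.
Qed.

Lemma sub_M m p q r x y : r = p (+) q -> sub m p x -> sub m q y -> sub m r (x * y).
Proof.
move=> -> sx sy; elim: sx => {p x}; first by rewrite mul1r.
- move=> l a p q' x lm pa _ sx; rewrite -mulrA -addbA.
  exact: sub_A.
- by move=> i q' x im _ sx; rewrite -mulrA; apply: sub_T.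
- by move=> q' x m0 _ sx; rewrite -mulrA; apply: sub_X.
- by move=> q'; rewrite mul0r; apply: sub_0.
- by move=> q' c x x' _ sx _ sx'; rewrite mulrDl -pz_scalerAl; apply: sub_D.
Qed.

Lemma sub_gA m l a p : (l < m)%N -> par p a -> sub m p (rA l a).
Proof. by move=> lm pa; rewrite -[rA l a]mulr1 -[p]addbF; apply: sub_A => //; apply: sub_1. Qed.
Lemma sub_gT m i : (i.+1 < m)%N -> sub m false (rT i).
Proof. by move=> im; rewrite -[rT i]mulr1; apply: sub_T => //; apply: sub_1. Qed.
Lemma sub_gX m : (0 < m)%N -> sub m false rX.
Proof.
move=> m0; have: sub m false (rX * 1) by apply: sub_X => //; apply: sub_1.
by rewrite mulr1.
Qed.

Lemma sub_MF m p x y : sub m false x -> sub m p y -> sub m p (x * y).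
Proof. exact: sub_M. Qed.
Lemma sub_MFr m p x y : sub m p x -> sub m false y -> sub m p (x * y).
Proof. by apply: sub_M; rewrite addbF. Qed.
Lemma sub_exp m x j : sub m false x -> sub m false (x ^+ j).
Proof.
move=> sx; elim: j => [|j IH]; first exact: sub_1.
by rewrite exprS; apply: sub_MF.
Qed.
Lemma sub_tl m i j : (i < m)%N -> (j < m)%N -> sub m false (tl i j).
Proof.
move=> im jm; apply: sub_sum => b _; have e := addbb (pb par B b).
apply: (sub_M (esym e)); apply: sub_gA => //; first exact: (par_B HA).
exact: (par_Bd HA).
Qed.
Lemma sub_jm m j : (j < m)%N -> sub m false (xx j).
Proof.
elim: j => [|j IH] jm; first exact: sub_gX.
apply: sub_MFr; last exact: sub_gT.
by apply: sub_MF; [apply: sub_gT | apply: IH; lia].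
Qed.

Lemma sub0P p x : sub 0 p x -> exists2 c : k, x = c *: (1 : H) & p -> x = 0.
Proof.
elim=> {p x} //.
- by exists 1; rewrite ?scale1r.
- by move=> q; exists 0; rewrite ?scale0r.
- move=> q c x y _ [a xa px] _ [b yb py]; exists (c * a + b).
    by rewrite xa yb scalerA -scalerDl.
  by move=> hq; rewrite px // py // scaler0 addr0.
Qed.

Lemma sub_xx m p x : (m < N)%N -> sub m p x -> GRing.comm (xx m) x.
Proof.
move=> mN; elim=> {p x}; first exact: commr1.
- by move=> l a p q x lm _ _ cx; apply: commrM => //; apply: (jmA HH); lia.
- move=> i q x im _ cx; apply: commrM => //.
  by apply/commr_sym/(jmT HH); lia.
- move=> q x m0 _ cx; apply: commrM => //.
  by apply: (jm_comm HH (j := 0)) => //; lia.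
- by move=> q; apply: commr0.
- by move=> q c x y _ cx _ cy; apply: commrD => //; apply: commZ.
Qed.
Lemma sub_xxX m p x j : (m < N)%N -> sub m p x -> xx m ^+ j * x = x * xx m ^+ j.
Proof. by move=> mN sx; apply/commr_sym/commrX/commr_sym/(sub_xx mN sx). Qed.
Lemma xxA m j a : (m < N)%N -> xx m ^+ j * rA m a = rA m a * xx m ^+ j.
Proof. by move=> mN; apply/commr_sym/commrX/commr_sym/(jmA HH). Qed.

Lemma sub_rA m p q a x : (m < N)%N -> par p a -> sub m q x ->
  rA m a * x = (-1) ^+ (p && q) *: (x * rA m a).
Proof.
move=> mN pa; elim=> {q x}.
- by rewrite andbF scale1r mulr1 mul1r.
- move=> l b q r x lm qb _ IH.
  rewrite mulrA (hd_AC HH _ _ _ pa qb); try lia.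
  rewrite -pz_scalerAl -mulrA IH -pz_scalerAr scalerA mulrA; congr (_ *: _).
  by case: (p) (q) (r) => [] [] []; rewrite ?expr0 ?expr1 ?mulrNN ?mulr1 ?mul1r.
- move=> i q x im _ IH; rewrite mulrA -(hd_TA HH); try lia.
  by rewrite -mulrA IH -pz_scalerAr mulrA.
- move=> q x m0 _ IH; rewrite mulrA -(hd_XA HH) //.
  by rewrite -mulrA IH -pz_scalerAr mulrA.
- by move=> q; rewrite mulr0 mul0r scaler0.
- move=> q c x y _ IHx _ IHy; rewrite mulrDr mulrDl scalerDr -pz_scalerAr IHx IHy.
  by rewrite -pz_scalerAl !scalerA mulrC.
Qed.

Lemma sub_rA' m p q a x : (m < N)%N -> par p a -> sub m q x ->
  x * rA m a = (-1) ^+ (p && q) *: (rA m a * x).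
Proof.
move=> mN pa sx; rewrite (sub_rA mN pa sx) scalerA -exprD addnn -signr_odd.
by rewrite odd_double scale1r.
Qed.

(* P selects the powers of the last polynomial generator that may occur.        *)
Inductive mackP (P : pred nat) (m : nat) : bool -> H -> Prop :=
| mk_T p q r x y : r = p (+) q -> (0 < m)%N -> sub m p x -> sub m q y ->
    mackP P m r (x * rT m.-1 * y)
| mk_X p q r x a j : r = p (+) q -> P j -> sub m p x -> par q a ->
    mackP P m r (x * rA m a * xx m ^+ j)
| mk_0 r : mackP P m r 0
| mk_D r c x y : mackP P m r x -> mackP P m r y -> mackP P m r (c *: x + y).

Section MackP.
Variable P : pred nat.
Implicit Types (m : nat) (p q r : bool) (u v : H).

Lemma mk_Z m r c u : mackP P m r u -> mackP P m r (c *: u).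
Proof. by move=> su; rewrite -[_ *: _]addr0; apply: mk_D => //; apply: mk_0. Qed.
Lemma mk_add m r u v : mackP P m r u -> mackP P m r v -> mackP P m r (u + v).
Proof. by move=> su sv; rewrite -[u]scale1r; apply: mk_D. Qed.
Lemma mk_N m r u : mackP P m r u -> mackP P m r (- u).
Proof. by move=> su; rewrite -scaleN1r; apply: mk_Z. Qed.
Lemma mk_sum m r (J : Type) (s : seq J) (Q : pred J) (F : J -> H) :
  (forall i, Q i -> mackP P m r (F i)) -> mackP P m r (\sum_(i <- s | Q i) F i).
Proof.
move=> sF; elim/big_rec: _ => [|i x Qi sx]; first exact: mk_0.
by apply: mk_add => //; apply: sF.
Qed.

Lemma mk_L m p q r s u : r = q (+) p -> sub m q s -> mackP P m p u ->
  mackP P m r (s * u).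
Proof.
move=> er ss su; elim: su r er => {p u}.
- move=> p1 q1 r1 x y -> m0 sx sy r ->; rewrite !mulrA.
  by apply: (mk_T P (p := q (+) p1) (q := q1)) => //; [case: (q) (p1) (q1) => [] [] []|apply: sub_M sx].
- move=> p1 q1 r1 x a j -> Pj sx pa r ->; rewrite !mulrA.
  by apply: (mk_X (p := q (+) p1) (q := q1)) => //; [case: (q) (p1) (q1) => [] [] []|apply: sub_M sx].
- by move=> *; rewrite mulr0; apply: mk_0.
- move=> r1 c x y _ IHx _ IHy r er; rewrite mulrDr -pz_scalerAr.
  by apply: mk_D; [apply: IHx | apply: IHy].
Qed.

Lemma mk_A m p q r a u : (m < N)%N -> r = q (+) p -> par q a -> mackP P m p u ->
  mackP P m r (rA m a * u).
Proof.
move=> mN er qa su; elim: su r er => {p u}.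
- move=> p1 q1 r1 x y -> m0 sx sy r ->.
  rewrite !mulrA (sub_rA mN qa sx) -!pz_scalerAl; apply: mk_Z.
  have eA : rA m a * rT m.-1 = rT m.-1 * rA m.-1 a.
    by have := hd_TAl HH (i := m.-1) a; rewrite prednK // => ->.
  rewrite -(mulrA x) eA -!mulrA mulrA; apply: (mk_T P (p := p1) (q := q (+) q1)) => //.
    by case: (q) (p1) (q1) => [] [] [].
  by apply: (sub_M (erefl _)) => //; apply: sub_gA => //; lia.
- move=> p1 q1 r1 x b j -> Pj sx pb r ->.
  rewrite !mulrA (sub_rA mN qa sx) -!pz_scalerAl; apply: mk_Z.
  rewrite -(mulrA x) -(hd_A HH mN).2.
  apply: (mk_X (p := p1) (q := q (+) q1)) => //; last exact: (par_M sA).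
  by case: (q) (p1) (q1) => [] [] [].
- by move=> *; rewrite mulr0; apply: mk_0.
- move=> r1 c x y _ IHx _ IHy r er; rewrite mulrDr -pz_scalerAr.
  by apply: mk_D; [apply: IHx | apply: IHy].
Qed.

Lemma mk_R m p q r s u : (m < N)%N -> r = p (+) q -> sub m q s -> mackP P m p u ->
  mackP P m r (u * s).
Proof.
move=> mN er ss su; elim: su r er => {p u}.
- move=> p1 q1 r1 x y -> m0 sx sy r ->; rewrite -mulrA.
  apply: (mk_T P (p := p1) (q := q1 (+) q)) => //; last exact: sub_M ss.
  by rewrite addbA.
- move=> p1 q1 r1 x a j -> Pj sx pa r ->.
  rewrite -mulrA (sub_xxX _ mN ss) mulrA -(mulrA x) (sub_rA mN pa ss).
  rewrite -pz_scalerAr -pz_scalerAl mulrA; apply: mk_Z.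
  apply: (mk_X (p := p1 (+) q) (q := q1)) => //; last exact: sub_M ss.
  by case: (q) (p1) (q1) => [] [] [].
- by move=> *; rewrite mul0r; apply: mk_0.
- move=> r1 c x y _ IHx _ IHy r er; rewrite mulrDl -pz_scalerAl.
  by apply: mk_D; [apply: IHx | apply: IHy].
Qed.

Lemma mk_tl m p u : (m.+1 < N)%N -> mackP P m.+1 p u -> mackP P m.+1 p (tl m m.+1 * u).
Proof.
move=> mN su; rewrite mulr_suml; apply: mk_sum => b _; rewrite -mulrA.
apply: (mk_L (q := pb par B b) (p := pb par B b (+) p)).
- by rewrite addbA addbb.
- by apply: sub_gA => //; apply: par_B HA b.
- by apply: (mk_A mN _ _ su) => //; apply: par_Bd HA b.
Qed.

Lemma mk_gX m j : P j -> (m < N)%N -> mackP P m false (xx m ^+ j).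
Proof.
move=> Pj mN; rewrite -[xx m ^+ j]mul1r -(hd_A HH mN).1 -[rA m 1]mul1r.
by apply: (mk_X (p := false) (q := false)) => //; [apply: sub_1 | apply: par_1 sA].
Qed.

Lemma mk_gT m : mackP P m.+1 false (rT m).
Proof.
rewrite -[rT m]mulr1 -[rT m]mul1r.
by apply: (mk_T P (m := m.+1) (p := false) (q := false)) => //; apply: sub_1.
Qed.
End MackP.

Lemma mackP_sub (P P' : pred nat) m p u : (forall l, P l -> P' l) ->
  mackP P m p u -> mackP P' m p u.
Proof.
move=> PP'; elim=> {p u}.
- by move=> *; apply: mk_T; eauto.
- by move=> *; apply: mk_X; eauto.
- by move=> *; apply: mk_0.
- by move=> *; apply: mk_D.
Qed.

Lemma mk_xsum (P : pred nat) m j i : (m.+1 < N)%N -> (forall l, (l < i)%N -> P l.+1) ->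
  mackP P m.+1 false (\sum_(l < i) xx m ^+ (j - l.+1) * xx m.+1 ^+ l.+1).
Proof.
move=> mN Pl; apply: mk_sum => l _; apply: (mk_L (q := false) (p := false)) => //.
  by apply: sub_exp; apply: sub_jm.
by apply: mk_gX => //; apply: Pl.
Qed.

(** The exponents on the last strand stay between 1 and j, which later makes the trace of such terms
    vanish. *)
Lemma mk_xxT m j : (m.+1 < N)%N ->
  mackP (fun l => 0 < l <= j)%N m.+1 false (xx m.+1 ^+ j * rT m).
Proof.
move=> mN; have := T_jmX HA HH j mN => /eqP.
rewrite eq_sym subr_eq => /eqP ->; apply: mk_add.
  apply: (mk_R mN (p := false) (q := false)) => //; last exact: mk_gT.
  by apply: sub_exp; apply: sub_jm.
by apply: mk_Z; apply: mk_tl => //; apply: mk_xsum.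
Qed.

Lemma mk_Txx m j : (m.+1 < N)%N ->
  mackP (fun l => 0 < l <= j)%N m.+1 false (rT m * xx m.+1 ^+ j).
Proof.
move=> mN; rewrite (T_jmXr HH) //; apply: mk_add.
  apply: (mk_L (p := false) (q := false)) => //; last exact: mk_gT.
  by apply: sub_exp; apply: sub_jm.
by apply: mk_Z; apply: mk_tl => //; apply: mk_xsum.
Qed.

(** By [T_jmX] followed by the quadratic relation; the top summand cancels the teleporter term of
    T_m^2, which leaves exponents strictly below j. *)
Lemma mk_TxxT m j : (m.+1 < N)%N ->
  mackP (fun l => 0 < l < j)%N m.+1 false (rT m * xx m ^+ j * rT m - xx m.+1 ^+ j).
Proof.
move=> mN; case: j => [|j].
  rewrite !expr0 mulr1 (hd_quad HH) // addrK.
  by apply: mk_Z; apply: mk_tl => //; apply: mk_gT.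
rewrite (T_jmX HA HH) // mulrBl -(mulrA _ (rT m)) (hd_quad HH) // mulrDr mulr1.
rewrite big_ord_recr [nat_of_ord ord_max]/= subnn expr0 mul1r.
have c1 : GRing.comm (xx m.+1 ^+ j.+1) (tl m m.+1).
  by apply/commr_sym/commrX/commr_sym/(jm_tl HH); lia.
set W := xx m.+1 ^+ j.+1; set S := \sum_(i < j) _.
have -> : W * (z *: (tl m m.+1 * rT m)) = z *: (tl m m.+1 * (W * rT m)).
  by rewrite -pz_scalerAr !mulrA c1.
rewrite -pz_scalerAl -(mulrA (tl m m.+1)) mulrDl (mulrDr (tl m m.+1)) scalerDr.
rewrite addrAC addrK opprD addrCA subrr addr0.
apply: mk_N; apply: mk_Z; apply: mk_tl => //.
rewrite mulr_suml; apply: mk_sum => l _; rewrite -mulrA.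
apply: (mk_L (q := false) (p := false)) => //.
  by apply: sub_exp; apply: sub_jm.
by apply: mackP_sub (mk_xxT l.+1 mN) => i /=; have := ltn_ord l; lia.
Qed.

Lemma sub_T_comm m p x : (m.+1 < N)%N -> sub m p x -> GRing.comm (rT m) x.
Proof.
move=> mN; elim=> {p x}; first exact: commr1.
- by move=> l a p q x lm _ _ cx; apply: commrM => //; apply: (hd_TA HH); lia.
- by move=> i q x im _ cx; apply: commrM => //; apply: (TTC HH); lia.
- move=> q x m0 _ cx; apply: commrM => //.
  by apply/commr_sym/(hd_XT HH).
- by move=> q; apply: commr0.
- by move=> q c x y _ cx _ cy; apply: commrD => //; apply: commZ.
Qed.

(** On the T part of u the braid relation reduces two occurrences of T_m to one; on the X part
    [mk_TxxT] applies. *)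
Lemma mk_TuT (P : pred nat) m p u : (m.+1 < N)%N ->
  (forall l l', P l -> 0 < l' < l -> P l')%N -> mackP P m p u ->
  mackP P m.+1 p (rT m * u * rT m).
Proof.
move=> mN Pl; have TT j : P j -> mackP P m.+1 false (rT m * xx m ^+ j * rT m).
  move=> Pj; rewrite -[X in mackP _ _ _ X](subrK (xx m.+1 ^+ j)).
  apply: mk_add; last exact: mk_gX.
  by apply: mackP_sub (mk_TxxT j mN) => l; apply: Pl.
elim=> {u p}.
- move=> p1 q1 r x y -> m0 sx sy; clear Pl TT.
  case: m mN m0 sx sy => // m mN _ sx sy.
  have Tx := sub_T_comm mN sx; have Ty := sub_T_comm mN sy.
  rewrite !mulrA Tx -(mulrA _ y) -Ty !mulrA -2!(mulrA x) -(hd_braid HH) //.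
  rewrite -!mulrA 2!mulrA; apply: (mk_T _ (p := p1) (q := q1)) => //.
    by apply: sub_MFr; [apply: sub_leq sx | apply: sub_gT].
  by apply: sub_MF; [apply: sub_gT | apply: sub_leq sy].
- move=> p1 q1 r x a j -> Pj sx pa.
  have Tx := sub_T_comm mN sx.
  rewrite !mulrA Tx -(mulrA x) (hd_TAl HH) // -!mulrA.
  apply: (mk_L (q := p1) (p := q1)) => //; first exact: sub_leq sx.
  apply: (mk_A (q := q1) (p := false)) => //; first by rewrite addbF.
  by rewrite mulrA; apply: TT.
- by move=> *; rewrite mulr0 mul0r; apply: mk_0.
- move=> r c x y _ IHx _ IHy; rewrite mulrDr mulrDl -pz_scalerAr -pz_scalerAl.
  exact: mk_D.
Qed.

(** The last strand winds around all the others and carries j dots on the way. This is the element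
    that the tower evaluates, whereas X_m^j is the one in the decomposition. *)
Definition loop m j : H := sup rT m * rX ^+ j * sdn rT m.

(** The loops on m+1 and m strands differ by conjugation with T_m, so [mk_TuT] and [mk_TxxT] give
    the induction. *)
Lemma loop_low m j : (m < N)%N ->
  mackP (fun l => 0 < l < j)%N m false (loop m j - xx m ^+ j).
Proof.
elim: m => [|m IH] mN.
  by rewrite /loop /= mul1r mulr1 subrr; apply: mk_0.
have -> : loop m.+1 j = rT m * loop m j * rT m by rewrite /loop /= !mulrA.
rewrite -[loop m j](subrK (xx m ^+ j)) mulrDr mulrDl -addrA.
apply: mk_add; last exact: mk_TxxT.
by apply: mk_TuT => // [l l'|]; [lia | apply: IH; lia].
Qed.

Hypothesis d_gt0 : (0 < d)%N.
Let dP : pred nat := fun l => (l < d)%N.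

(** The right side contains 1, so it is enough that generators preserve it under left
    multiplication. The only delicate one is the last crossing: on a term of the T part it produces
    T x T with x on fewer strands, which is decomposed by induction and treated with [mk_TuT]. *)
Lemma mackey m p u : (m < N)%N -> sub m.+1 p u -> mackP dP m p u.
Proof.
elim: m p u => [|m IHm] p u mN su.
  elim: su => {p u}.
  - by have := @mk_gX dP 0 0 d_gt0 mN; rewrite expr0.
  - case=> // a p q x _ pa _; exact: mk_A.
  - by [].
  - move=> q x _ _; elim=> {q x}.
    + by [].
    + move=> p q r x a j -> dj sx pa; rewrite mulrA.
      have [c xc px] := sub0P sx; case: p sx px => [sx ->//|sx _].
        by rewrite !(mulr0, mul0r); apply: mk_0.
      rewrite xc -pz_scalerAl mul1r -pz_scalerAr -pz_scalerAl; apply: mk_Z.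
      rewrite (hd_XA HH) // -mulrA -[rX]/(xx 0) -exprS.
      apply: (mk_A (q := q) (p := false)) => //; first by rewrite addbF.
      (* An exponent that reaches d is reduced by the cyclotomic relation. *)
      have [dj1|dj1] := ltnP j.+1 d; first exact: mk_gX.
      have -> : j.+1 = d by rewrite /dP in dj; lia.
      have /eqP := hd_cyc HH mN; rewrite addr_eq0 => /eqP ->.
      apply: mk_N; apply: mk_sum => i _.
      apply: (mk_A (q := false) (p := false)) => //; first by have [] := centf i.
      by apply: (@mk_gX dP 0) => //; apply: ltn_ord.
    + by move=> *; rewrite mulr0; apply: mk_0.
    + by move=> r c x y _ IHx _ IHy; rewrite mulrDr -pz_scalerAr; apply: mk_D.
  - by move=> q; apply: mk_0.
  - by move=> q c x y _ IHx _ IHy; apply: mk_D.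
have IH p' u' : sub m.+1 p' u' -> mackP dP m p' u' by apply: IHm; lia.
have TST x p' : sub m.+1 p' x -> mackP dP m.+1 p' (rT m * x * rT m).
  by move=> /IH; apply: mk_TuT => // l l'; rewrite /dP; lia.
elim: su => {p u}.
- by have := @mk_gX dP m.+1 0 d_gt0 mN; rewrite expr0.
- move=> l a p q x lm pa _ su; have [->|nl] := eqVneq l m.+1; first exact: mk_A su.
  by apply: mk_L su => //; apply: sub_gA => //; lia.
- move=> i q x im _ su; have [->|ni] := eqVneq i m; last first.
    by apply: (mk_L (q := false) _ _ su) => //; apply: sub_gT; lia.
  elim: su => {x q}.
  + move=> p q r x y -> _ sx sy; rewrite !mulrA.
    by apply: (mk_R mN _ sy (TST _ _ sx)).
  + move=> p q r x a j -> dj sx pa.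
    rewrite (sub_rA' mN pa sx) -!pz_scalerAl -pz_scalerAr; apply: mk_Z.
    rewrite -mulrA -(sub_xxX _ mN sx) !mulrA (hd_TAr HH) // -!mulrA.
    apply: (mk_L (q := q) (p := p)); first by rewrite addbC.
      by apply: sub_gA.
    rewrite mulrA; apply: (mk_R mN (p := false) _ sx) => //.
    by apply: mackP_sub (mk_Txx j mN) => l; rewrite /dP in dj *; lia.
  + by move=> *; rewrite mulr0; apply: mk_0.
  + by move=> r c x y _ IHx _ IHy; rewrite mulrDr -pz_scalerAr; apply: mk_D.
- move=> q x _ _ su; apply: (mk_L (q := false) _ _ su) => //; exact: sub_gX.
- by move=> q; apply: mk_0.
- by move=> q c x y _ IHx _ IHy; apply: mk_D.
Qed.
End Subalgebras.

(** * Supersymmetry and duality *)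

Section Traces.
Variables (k : comNzRingType) (A : pzAlgType k) (par : bool -> A -> Prop).
Variables (trA : {scalar A}) (I : finType) (B Bd : I -> A).
Hypothesis HA : dual_bases par trA B Bd.
Variables (z : k) (d : nat) (f : 'I_d -> A).
Hypothesis centf : forall i, supercentral par false (f i).
Hypothesis d_gt0 : (0 < d)%N.
Variables (H : pzAlgType k) (N : nat) (rA : nat -> {linear A -> H}).
Variables (rT : nat -> H) (rX : H).
Hypothesis HH : hecke_datum par B Bd z f N rA rT rX.

Local Notation sub := (sub par rA rT rX).
Local Notation xx := (jm rT rX).
Local Notation mackP := (mackP par rA rT rX).
Local Notation Tinv := (Tinv B Bd z rA rT).
Let sA : is_superalgebra par := sym_super (db_sym HA).

Variable tr : nat -> {scalar H}.
Hypothesis tr0 : tr 0 1 = 1.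
Hypothesis tr_T : forall m p q x y a, (0 < m)%N -> (m < N)%N -> sub m p x ->
  sub m q y -> tr m.+1 (x * (rT m.-1 * rA m a) * y) = 0.
Hypothesis tr_loop : forall m p q x y a j, (m < N)%N -> (j < d)%N -> sub m p x ->
  sub m q y -> tr m.+1 (x * (rA m a * loop rT rX m j) * y)
  = (j == 0%N)%:R * trA a * tr m (x * y).

Lemma trT m p q x y : (0 < m)%N -> (m < N)%N -> sub m p x -> sub m q y ->
  tr m.+1 (x * rT m.-1 * y) = 0.
Proof.
move=> m0 mN sx sy; rewrite -(tr_T 1 m0 mN sx sy) (hd_A HH mN).1 mulr1 //.
Qed.

(** The T part of u contributes nothing, so only the powers of X_m allowed by P matter. *)
Lemma tr_mack_aux (P : pred nat) m p q r s x y a u : (m < N)%N -> par r a ->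
  sub m p x -> sub m q y -> mackP P m s u ->
  (forall j, P j -> forall p x b r, sub m p x -> par r b ->
     tr m.+1 (x * rA m b * xx m ^+ j * y) = 0) ->
  tr m.+1 (x * rA m a * u * y) = 0.
Proof.
move=> mN ra sx sy su tP; elim: su => {s u}.
- move=> p1 q1 s x1 y1 _ m0 sx1 sy1.
  rewrite !mulrA -(mulrA x) (sub_rA HH mN ra sx1) -pz_scalerAr -!pz_scalerAl linearZ /=.
  have eA : rA m a * rT m.-1 = rT m.-1 * rA m.-1 a.
    by have := hd_TAl HH (i := m.-1) a; rewrite prednK // => ->.
  rewrite !mulrA -(mulrA (x * x1)) eA -!mulrA 2!mulrA.
  rewrite (trT (p := p (+) p1) (q := r (+) (q1 (+) q))) ?mulr0 //.
    exact: sub_M sx sx1.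
  apply: (sub_M (erefl _) _ (sub_M (erefl _) sy1 sy)).
  by apply: sub_gA => //; lia.
- move=> p1 q1 s x1 b j _ Pj sx1 pb.
  rewrite !mulrA -(mulrA x) (sub_rA HH mN ra sx1) -pz_scalerAr -!pz_scalerAl.
  rewrite linearZ /= !mulrA -(mulrA _ (rA m a)) -(hd_A HH mN).2.
  rewrite (tP _ Pj (p (+) p1) _ _ (r (+) q1)) ?mulr0 //.
    exact: sub_M sx sx1.
  exact: par_M.
- by move=> *; rewrite mulr0 mul0r linear0.
- move=> s c u v _ IHu _ IHv; rewrite mulrDr mulrDl -pz_scalerAr -pz_scalerAl.
  by rewrite linearP IHu IHv /= mulr0 addr0.
Qed.

(** Strong induction on j: the loop is evaluated by [tr_loop], and its difference from X_m^j
    involves only exponents strictly between 0 and j. *)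
Lemma trX m p q r x y a j : (m < N)%N -> (j < d)%N -> sub m p x -> sub m q y ->
  par r a -> tr m.+1 (x * rA m a * xx m ^+ j * y)
  = (j == 0%N)%:R * trA a * tr m (x * y).
Proof.
move=> mN; elim/ltn_ind: j p r x a => j IH p r x a jd sx sy ra.
rewrite -[xx m ^+ j](subKr (loop rT rX m j)) mulrBr mulrBl linearB /=.
rewrite (tr_mack_aux mN ra sx sy (loop_low HA HH j mN)) => [|l lj p' x' b r' sx' pb].
  by rewrite subr0 -mulrA -(tr_loop a mN jd sx sy) !mulrA.
have [l0 lj'] : (0 < l)%N /\ (l < j)%N by lia.
by rewrite (IH l lj' p' r') ?(ltn_trans lj') // gtn_eqF // !mul0r.
Qed.

Lemma tr_mack0 (P : pred nat) m p q r s x y a u : (m < N)%N ->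
  (forall l, P l -> 0 < l < d)%N -> par r a -> sub m p x -> sub m q y ->
  mackP P m s u -> tr m.+1 (x * rA m a * u * y) = 0.
Proof.
move=> mN Pl ra sx sy su; apply: (tr_mack_aux mN ra sx sy su).
move=> j /Pl /andP[j0 jd] p' x' b r' sx' pb.
by rewrite (trX mN jd sx' sy pb) gtn_eqF // !mul0r.
Qed.

Lemma tr_xxT m p q r x y a j : (m.+1 < N)%N -> (j < d)%N -> par r a ->
  sub m.+1 p x -> sub m.+1 q y ->
  tr m.+2 (x * rA m.+1 a * (xx m.+1 ^+ j * rT m) * y) = 0.
Proof.
move=> mN jd ra sx sy; apply: (tr_mack0 mN _ ra sx sy (mk_xxT HA HH j mN)) => l.
by lia.
Qed.

Lemma tr_Txx m p q r x y a j : (m.+1 < N)%N -> (j < d)%N -> par r a ->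
  sub m.+1 p x -> sub m.+1 q y ->
  tr m.+2 (x * rA m.+1 a * (rT m * xx m.+1 ^+ j) * y) = 0.
Proof.
move=> mN jd ra sx sy; apply: (tr_mack0 mN _ ra sx sy (mk_Txx HA HH j mN)) => l.
by lia.
Qed.

Lemma tr_TxxT m p q r x y a j : (m.+1 < N)%N -> (j < d)%N -> par r a ->
  sub m.+1 p x -> sub m.+1 q y ->
  tr m.+2 (x * rA m.+1 a * (rT m * xx m ^+ j * rT m) * y)
  = (j == 0%N)%:R * trA a * tr m.+1 (x * y).
Proof.
move=> mN jd ra sx sy; rewrite -(trX mN jd sx sy ra).
rewrite -[X in tr _ (_ * X * _)](subrK (xx m.+1 ^+ j)) mulrDr mulrDl linearD /=.
rewrite (tr_mack0 mN _ ra sx sy (mk_TxxT HA HH j mN)) ?add0r // => l.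
by lia.
Qed.

Lemma tr_odd0 m x : (m <= N)%N -> sub m true x -> tr m x = 0.
Proof.
elim: m x => [|m IH] x mN sx; first by have [c _ ->] := sub0P sx; rewrite ?linear0.
have := mackey HA centf HH d_gt0 mN sx; move Ep : true => p sx'.
elim: sx' Ep => {sx x p} [p1 q1 r x y er m0 sx sy|p1 q1 r x a j er dj sx pa|r|r c x y _ IHx _ IHy] Er.
- exact: (trT m0 mN sx sy).
- rewrite -[_ * xx m ^+ j]mulr1 (trX mN dj sx (sub_1 _ _ _ _ _) pa) mulr1.
  case: q1 pa er => pa er; first by rewrite (tr_even (db_sym HA) pa) mulr0 mul0r.
  by rewrite IH ?mulr0 //; [lia | rewrite Er er addbF].
- exact: linear0.
- by rewrite linearP IHx // IHy //= mulr0 addr0.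
Qed.

(** * Supersymmetry of the traces *)

Lemma tr_TTT m p q r s x y w w' : (m.+1 < N)%N -> (0 < m)%N ->
  sub m p x -> sub m q y -> sub m.+1 r w -> sub m.+1 s w' ->
  tr m.+2 (w * (rT m * (x * rT m.-1 * y) * rT m) * w') = 0.
Proof.
case: m => // m mN _ sx sy sw sw'.
have Tx := sub_T_comm HH mN sx; have Ty := sub_T_comm HH mN sy.
have -> : rT m.+1 * (x * rT m * y) * rT m.+1 = x * rT m * rT m.+1 * (rT m * y).
  by rewrite !mulrA Tx -(mulrA _ y) -Ty !mulrA -2!(mulrA x) -(hd_braid HH) // !mulrA.
rewrite !mulrA -(mulrA _ (rT m) y) -(mulrA _ _ w').
apply: (trT (p := r (+) (p (+) false)) (q := q (+) s)) => //.
  rewrite -mulrA; apply: (sub_M (erefl _)) => //; apply: (sub_M (erefl _)).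
    exact: sub_leq sx.
  by apply: sub_gT; lia.
apply: (sub_M (erefl _)) => //; apply: sub_MF; first by apply: sub_gT; lia.
exact: sub_leq sy.
Qed.

Lemma tr_TaxT m p q r s x a j w w' : (m.+1 < N)%N -> (j < d)%N ->
  sub m p x -> par q a -> sub m.+1 r w -> sub m.+1 s w' ->
  tr m.+2 (w * (rT m * (x * rA m a * xx m ^+ j) * rT m) * w')
  = (j == 0%N)%:R * trA a * tr m.+1 (w * x * w').
Proof.
move=> mN jd sx pa sw sw'; have Tx := sub_T_comm HH mN sx.
have sx' : sub m.+1 p x by apply: sub_leq sx.
rewrite -(tr_TxxT mN jd pa (sub_M (erefl _) sw sx') sw') !mulrA.
by rewrite -(mulrA w) Tx !mulrA -(mulrA (w * x)) (hd_TAl HH) ?mulrA //; lia.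
Qed.

(** Decompose u and v. If one of them is in the T part, both sides vanish. For u = x a X_m^j and v =
    y b X_m^l both sides are tr(a) tr(b) tr_m(x y) if j = l = 0, and 0 otherwise. *)
Lemma tr_TuTu m p q u v : (m.+1 < N)%N -> sub m.+1 p u -> sub m.+1 q v ->
  tr m.+2 (u * (rT m * v * rT m) * 1) = tr m.+2 (1 * (rT m * u * rT m) * v).
Proof.
move=> mN su sv; have mN' : (m < N)%N by lia.
have s1 : sub m.+1 false 1 by apply: sub_1.
have lew r x : sub m r x -> sub m.+1 r x by apply: sub_leq.
elim: (mackey HA centf HH d_gt0 mN' su).
- move=> p1 q1 r1 x y _ m0 sx sy; rewrite (tr_TTT mN m0 sx sy s1 sv).
  have sux : sub m.+1 (p1 (+) false (+) q1) (x * rT m.-1 * y).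
    apply: (sub_M (erefl _)); last exact: lew.
    by apply: (sub_M (erefl _)); [exact: lew | apply: sub_gT; lia].
  elim: (mackey HA centf HH d_gt0 mN' sv).
  + by move=> p2 q2 r2 x2 y2 _ _ sx2 sy2; apply: (tr_TTT mN m0 sx2 sy2 sux s1).
  + move=> p2 q2 r2 x2 a j _ dj sx2 pa; rewrite (tr_TaxT mN dj sx2 pa sux s1).
    rewrite mulr1 -(mulrA _ y) (trT m0 mN' sx (sub_M (erefl _) sy sx2)).
    exact: mulr0.
  + by move=> *; rewrite !(mulr0, mul0r) linear0.
  + move=> r2 c x2 y2 _ IHx _ IHy.
    rewrite !(mulrDr, mulrDl) -!(pz_scalerAr, pz_scalerAl) linearP.
    by rewrite IHx IHy /= mulr0 addr0.
- move=> p1 q1 r1 x a j _ dj sx pa; rewrite (tr_TaxT mN dj sx pa s1 sv) mul1r.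
  have sux : sub m.+1 (p1 (+) q1 (+) false) (x * rA m a * xx m ^+ j).
    apply: (sub_M (erefl _)); last by apply: sub_exp; apply: sub_jm.
    by apply: (sub_M (erefl _)); [exact: lew | apply: sub_gA].
  elim: (mackey HA centf HH d_gt0 mN' sv).
  + move=> p2 q2 r2 x2 y2 _ m0 sx2 sy2; rewrite (tr_TTT mN m0 sx2 sy2 sux s1).
    by rewrite !mulrA (trT m0 mN' (sub_M (erefl _) sx sx2) sy2) mulr0.
  + move=> p2 q2 r2 x2 b l _ dl sx2 pb; rewrite (tr_TaxT mN dl sx2 pb sux s1).
    rewrite mulr1 (trX mN' dj sx sx2 pa) -[X in _ = _ * tr _ X]mulr1 !mulrA.
    rewrite (trX mN' dl (sub_M (erefl _) sx sx2) (sub_1 _ _ _ _ _) pb) mulr1.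
    by rewrite !mulrA; congr (_ * _); ring.
  + by move=> *; rewrite !(mulr0, mul0r) !linear0 mulr0.
  + move=> r2 c x2 y2 _ IHx _ IHy.
    rewrite !(mulrDr, mulrDl) -!(pz_scalerAr, pz_scalerAl) !linearP.
    by rewrite IHx IHy /= mulrDr mulrCA.
- by move=> *; rewrite !(mulr0, mul0r) !linear0.
- move=> r2 c x2 y2 _ IHx _ IHy.
  rewrite !(mulrDr, mulrDl) -!(pz_scalerAr, pz_scalerAl) !linearP.
  by rewrite IHx IHy.
Qed.

Definition ssym m := forall p q x y, sub m p x -> sub m q y ->
  tr m (x * y) = (-1) ^+ (p && q) * tr m (y * x).

(** The g with tr(x g) = (-1)^(|x||g|) tr(g x) for all x are closed under products ([GM]). It
    remains to treat H_m, the labels on strand m, X_0 when m = 0, and T_(m-1), each against the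
    terms of [mackey]. *)
Lemma ssym_step m : (m < N)%N -> ssym m -> ssym m.+1.
Proof.
move=> mN IH.
pose G q g := forall p x, sub m.+1 p x ->
  tr m.+1 (x * g) = (-1) ^+ (p && q) * tr m.+1 (g * x).
have s1 : sub m false 1 by apply: sub_1.
have GM q1 q2 g h : sub m.+1 q1 g -> sub m.+1 q2 h -> G q1 g -> G q2 h ->
    G (q1 (+) q2) (g * h).
  move=> sg sh Gg Gh p x sx; rewrite mulrA (Gh _ _ (sub_M (erefl _) sx sg)).
  rewrite mulrA (Gg _ _ (sub_M (erefl _) sh sx)) !mulrA; congr (_ * _).
  by case: p q1 q2 {sg sh Gg Gh sx} => [] [] []; rewrite ?expr0 ?expr1 ?mulrNN ?mulr1 ?mul1r.
have Gsub q g : sub m q g -> G q g.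
  move=> sg p x sx; elim: (mackey HA centf HH d_gt0 mN sx).
  - move=> p1 q1 r x1 y1 er m0 sx1 sy1.
    rewrite -mulrA (trT m0 mN sx1 (sub_M (erefl _) sy1 sg)).
    by rewrite !mulrA (trT m0 mN (sub_M (erefl _) sg sx1) sy1) mulr0.
  - move=> p1 q1 r x1 a j er dj sx1 pa; rewrite (trX mN dj sx1 sg pa).
    rewrite !mulrA -[X in _ = _ * tr _ X]mulr1.
    rewrite (trX mN dj (sub_M (erefl _) sg sx1) s1 pa) mulr1 (IH _ _ _ _ sx1 sg).
    case: q1 pa er => pa er; first by rewrite (tr_even (db_sym HA) pa) !(mulr0, mul0r).
    by rewrite er addbF mulrCA !mulrA; congr (_ * _); ring.
  - by move=> r; rewrite !(mulr0, mul0r) linear0 mulr0.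
  - move=> r c x1 y1 _ IHx _ IHy; rewrite mulrDr mulrDl -pz_scalerAl -pz_scalerAr.
    by rewrite !linearP IHx IHy /= mulrDr mulrCA.
have GA q a : par q a -> G q (rA m a).
  move=> pa p x sx; elim: (mackey HA centf HH d_gt0 mN sx).
  - move=> p1 q1 r x1 y1 er m0 sx1 sy1.
    rewrite -!mulrA (sub_rA' HH mN pa sy1) -!pz_scalerAr linearZ /= !mulrA.
    rewrite -(mulrA x1) (tr_T a m0 mN sx1 sy1) (sub_rA HH mN pa sx1).
    have eA : rA m a * rT m.-1 = rT m.-1 * rA m.-1 a.
      by have := hd_TAl HH (i := m.-1) a; rewrite prednK // => ->.
    rewrite -!pz_scalerAl -(mulrA x1) eA !mulrA -(mulrA _ _ y1) linearZ /=.
    rewrite (trT m0 mN sx1 (sub_M (erefl _) _ sy1) (q := q (+) q1)) ?mulr0 //.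
    by apply: sub_gA => //; lia.
  - move=> p1 q1 r x1 b j er dj sx1 pb.
    have -> : x1 * rA m b * xx m ^+ j * rA m a = x1 * rA m (b * a) * xx m ^+ j * 1.
      by rewrite mulr1 -mulrA (xxA HH) // !mulrA -(mulrA x1) -(hd_A HH mN).2.
    have -> : rA m a * (x1 * rA m b * xx m ^+ j)
      = (-1) ^+ (q && p1) *: (x1 * rA m (a * b) * xx m ^+ j * 1).
      rewrite mulr1 !mulrA (sub_rA HH mN pa sx1) -!pz_scalerAl -(mulrA x1).
      by rewrite -(hd_A HH mN).2.
    rewrite linearZ /= (trX mN dj sx1 s1 (par_M sA pb pa)).
    rewrite (trX mN dj sx1 s1 (par_M sA pa pb)) (trA_C HA pb pa) mulr1 er.
    rewrite !mulrA; congr (_ * _).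
    case: q q1 p1 pa pb {er sx1} => [] [] [] _ _; rewrite ?expr0 ?expr1 /=; ring.
  - by move=> r; rewrite !(mulr0, mul0r) linear0 mulr0.
  - move=> r c x1 y1 _ IHx _ IHy; rewrite mulrDr mulrDl -pz_scalerAl -pz_scalerAr.
    by rewrite !linearP IHx IHy /= mulrDr mulrCA.
have GX : m = 0%N -> G false rX.
  move=> m0 p x; rewrite m0 andbF expr0 mul1r => sx; congr (tr _ _).
  elim: sx => {p x}; first by rewrite mulr1 mul1r.
  - case=> // a p q x _ _ _ IHx; rewrite mulrA (hd_XA HH) -?mulrA ?IHx //; lia.
  - by [].
  - by move=> q x _ _ IHx; rewrite -mulrA IHx.
  - by move=> q; rewrite mulr0 mul0r.
  - by move=> q c x y _ IHx _ IHy; rewrite mulrDr mulrDl -pz_scalerAl -pz_scalerAr IHx IHy.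
(* Against the T part this is [tr_TuTu]; against x a X^j both sides vanish, since only exponents
   between 1 and j arise. *)
have GT : (0 < m)%N -> G false (rT m.-1).
  move=> m0 p x; rewrite andbF expr0 mul1r => sx.
  clear GA GX Gsub GM G IH; case: m mN m0 s1 sx => // m mN _ s1 sx /=.
  elim: (mackey HA centf HH d_gt0 mN sx).
  - move=> p1 q1 r x1 y1 _ _ sx1 sy1.
    by have := tr_TuTu mN sx1 sy1; rewrite !mulrA mulr1 mul1r.
  - move=> p1 q1 r x1 a j er dj sx1 pa.
    have:= tr_xxT mN dj pa sx1 s1; rewrite mulr1 !mulrA => ->.
    rewrite -(mulrA (rT m)) (sub_rA' HH mN pa sx1) -pz_scalerAr -pz_scalerAl.
    set X := xx m.+1 ^+ j; rewrite linearZ /= {}/X.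
    rewrite -!mulrA -(sub_xxX HH _ mN sx1) !mulrA (hd_TAr HH) // -!mulrA.
    rewrite (mulrA (rT m)) mulrA.
    have sa : sub m.+1 q1 (rA m a) by apply: sub_gA.
    have := tr_Txx mN dj (par_1 sA) sa sx1; rewrite (hd_A HH mN).1 mulr1 => ->.
    by rewrite mulr0.
  - by move=> r; rewrite !(mulr0, mul0r).
  - move=> r c x1 y1 _ IHx _ IHy; rewrite mulrDr mulrDl -pz_scalerAl -pz_scalerAr.
    by rewrite !linearP IHx IHy.
move=> p q x y sx sy; move: p x sx; rewrite -/(G q y).
elim: sy => {q y}.
- by move=> p x _; rewrite andbF mulr1 !mul1r.
- move=> l a p q y lm pa sy Gy.
  apply: GM Gy => //; first by apply: sub_gA.
  have [->|nl] := eqVneq l m; first exact: GA.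
  by apply: Gsub; apply: sub_gA => //; lia.
- move=> i q y im sy Gy; rewrite -[q]addFb; apply: GM Gy => //; first exact: sub_gT.
  have [ei|ni] := eqVneq i.+1 m; first by rewrite -[i]/(i.+1.-1) ei; apply: GT; lia.
  by apply: Gsub; apply: sub_gT; lia.
- move=> q y _ sy Gy; rewrite -[q]addFb; apply: GM Gy => //; first exact: sub_gX.
  by case: (posnP m) => [/GX//|m0]; apply: Gsub; apply: sub_gX.
- by move=> q p x _; rewrite !(mulr0, mul0r) linear0 mulr0.
- move=> q c x1 y1 _ Gx _ Gy p x sx; rewrite mulrDr mulrDl -pz_scalerAl -pz_scalerAr.
  by rewrite !linearP (Gx _ _ sx) (Gy _ _ sx) /= mulrDr mulrCA.
Qed.

Lemma ssymP m : (m <= N)%N -> ssym m.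
Proof.
elim: m => [_|m IH mN]; last by apply: ssym_step => //; apply: IH; lia.
move=> p q x y sx sy; have [a ax px] := sub0P sx; have [b by' py] := sub0P sy.
have [/andP[/px -> _]|_] := boolP (p && q); first by rewrite !(mul0r, mulr0) linear0 mulr0.
by rewrite ax by' expr0 mul1r -!pz_scalerAl -!pz_scalerAr mulr1 !scalerA mulrC.
Qed.

(** * Duality *)

Variable XV : H.
Hypothesis subXV : (0 < N)%N -> sub 1 false XV.
Hypothesis rXV : (0 < N)%N -> rX * XV = 1 /\ XV * rX = 1.

(** The inverse of X_j. *)
Fixpoint yy (j : nat) : H := if j is i.+1 then Tinv i * yy i * Tinv i else XV.

Lemma xxyy j : (j < N)%N -> xx j * yy j = 1 /\ yy j * xx j = 1.
Proof.
elim: j => [|j IH] jN; first exact: rXV.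
have [|e1 e2] := IH; first exact: ltnW.
rewrite /= !mulrA; split.
  rewrite -(mulrA (rT j * _)) (TTinv HA HH) // mulr1 -(mulrA (rT j)) e1 mulr1.
  exact: (TTinv HA HH).
rewrite -(mulrA (Tinv j * _)) (TinvT HH) // mulr1 -(mulrA (Tinv j)) e2 mulr1.
exact: (TinvT HH).
Qed.

Lemma xxyyX j l i : (j < N)%N -> (l <= i)%N -> xx j ^+ i * yy j ^+ l = xx j ^+ (i - l).
Proof.
move=> jN; elim: l => [|l IH] li; first by rewrite expr0 mulr1 subn0.
rewrite exprSr mulrA IH; last lia.
by rewrite (_ : (i - l = (i - l.+1).+1)%N) ?exprSr -?mulrA ?(xxyy jN).1 ?mulr1 //; lia.
Qed.

Lemma yyxxX j l i : (j < N)%N -> (i <= l)%N -> yy j ^+ l * xx j ^+ i = yy j ^+ (l - i).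
Proof.
move=> jN; elim: i => [|i IH] li; first by rewrite expr0 mulr1 subn0.
rewrite exprSr mulrA IH; last lia.
by rewrite (_ : (l - i = (l - i.+1).+1)%N) ?exprSr -?mulrA ?(xxyy jN).2 ?mulr1 //; lia.
Qed.

Lemma sub_Tinv m i : (i.+1 < m)%N -> sub m false (Tinv i).
Proof.
move=> im; apply: sub_add; first exact: sub_gT.
by apply: sub_N; apply: sub_Z; apply: (sub_tl HA); lia.
Qed.

Lemma sub_yy m j : (j < m)%N -> (m <= N)%N -> sub m false (yy j).
Proof.
move=> jm mN; elim: j jm => [|j IH] jm.
  by apply: (sub_leq jm); apply: subXV; lia.
apply: sub_MFr; last exact: sub_Tinv.
by apply: sub_MF; [apply: sub_Tinv | apply: IH; lia].
Qed.

Lemma yy_comm m l x : (m < N)%N -> GRing.comm (xx m) x -> GRing.comm (yy m ^+ l) x.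
Proof.
move=> mN cx; apply/commr_sym/commrX.
by apply: (comm_inv (xxyy mN).1 (xxyy mN).2); apply/commr_sym.
Qed.

Definition Sub m x := exists x0 x1, [/\ sub m false x0, sub m true x1 & x = x0 + x1].

Lemma Sub_sub m p x : sub m p x -> Sub m x.
Proof.
case: p => sx; [exists 0, x | exists x, 0]; split; rewrite ?add0r ?addr0 //;
  exact: sub_0.
Qed.
Lemma Sub_0 m : Sub m 0. Proof. exact: (Sub_sub (sub_0 _ _ _ _ _ false)). Qed.
Lemma Sub_1 m : Sub m 1. Proof. exact: (Sub_sub (sub_1 _ _ _ _ _)). Qed.
Lemma Sub_D m x y : Sub m x -> Sub m y -> Sub m (x + y).
Proof.
move=> [x0 [x1 [s0 s1 ->]]] [y0 [y1 [t0 t1 ->]]]; exists (x0 + y0), (x1 + y1).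
by split; [apply: sub_add|apply: sub_add|rewrite addrACA].
Qed.
Lemma Sub_Z m c x : Sub m x -> Sub m (c *: x).
Proof.
move=> [x0 [x1 [s0 s1 ->]]]; exists (c *: x0), (c *: x1).
by split; [apply: sub_Z|apply: sub_Z|rewrite scalerDr].
Qed.
Lemma Sub_N m x : Sub m x -> Sub m (- x).
Proof. by rewrite -scaleN1r; apply: Sub_Z. Qed.
Lemma Sub_sum m (J : Type) (r : seq J) (P : pred J) (F : J -> H) :
  (forall i, P i -> Sub m (F i)) -> Sub m (\sum_(i <- r | P i) F i).
Proof.
move=> sF; elim/big_rec: _ => [|i x Pi sx]; first exact: Sub_0.
by apply: Sub_D => //; apply: sF.
Qed.
Lemma Sub_ind m (P : H -> Prop) : (forall p x, sub m p x -> P x) ->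
  (forall x y, P x -> P y -> P (x + y)) -> forall x, Sub m x -> P x.
Proof. by move=> Ps PD x [x0 [x1 [s0 s1 ->]]]; apply: PD; apply: Ps; eauto. Qed.
Lemma Sub_M m x y : Sub m x -> Sub m y -> Sub m (x * y).
Proof.
move=> sx sy; elim/Sub_ind: sx => [p {}x sx|x1 x2 IH1 IH2].
  elim/Sub_ind: sy => [q {}y sy|y1 y2 IH1 IH2].
    by apply: (Sub_sub (p := p (+) q)); apply: sub_M sx sy.
  by rewrite mulrDr; apply: Sub_D.
by rewrite mulrDl; apply: Sub_D.
Qed.
Lemma Sub_leq m m' x : (m <= m')%N -> Sub m x -> Sub m' x.
Proof.
move=> mm' [x0 [x1 [s0 s1 ->]]]; exists x0, x1.
by split=> //; [apply: sub_leq s0|apply: sub_leq s1].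
Qed.
Lemma Sub_A m l a : (l < m)%N -> Sub m (rA l a).
Proof.
move=> lm; have [a0 [a1 [p0 p1 ->]]] := par_span sA a.
by exists (rA l a0), (rA l a1); split; [exact: sub_gA|exact: sub_gA|rewrite linearD].
Qed.
Lemma Sub_T m i : (i.+1 < m)%N -> Sub m (rT i).
Proof. by move=> im; apply: (Sub_sub (p := false)); apply: sub_gT. Qed.
Lemma Sub_tr m m' m'' (u : H) (c : k) :
  (forall p q x y, sub m p x -> sub m q y -> tr m' (x * u * y) = c * tr m'' (x * y)) ->
  forall x y, Sub m x -> Sub m y -> tr m' (x * u * y) = c * tr m'' (x * y).
Proof.
move=> hs x y sx sy; elim/Sub_ind: sx => [p {}x sx|x1 x2 IH1 IH2].
  elim/Sub_ind: sy => [q {}y sy|y1 y2 IH1 IH2]; first exact: hs sx sy.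
  by rewrite !mulrDr !linearD /= IH1 IH2 mulrDr.
by rewrite !mulrDl !linearD /= IH1 IH2 mulrDr.
Qed.

Definition tr_inj m := forall x, Sub m x -> (forall y, Sub m y -> tr m (x * y) = 0) -> x = 0.
Definition tr_surj m := forall phi : {scalar H},
  exists2 a, Sub m a & forall y, Sub m y -> tr m (a * y) = phi y.

(* The Gram matrix of e and g with values in tr m need only be unitriangular    *)
(* for the order given by rk.                                                   *)
Record triangular m (J : finType) (R : nat) (rk : J -> nat) (e g : J -> H) : Prop :=
  Triangular {
  tri_e : forall j, Sub m.+1 (e j);
  tri_g : forall j, Sub m.+1 (g j);
  tri_rk : forall j, (rk j < R)%N;
  tri_gram : forall p q s t j l, sub m p s -> sub m q t -> (rk l <= rk j)%N ->
    tr m.+1 (s * (e j * g l) * t) = (j == l)%:R * tr m (s * t);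
  tri_l : forall x, Sub m.+1 x -> exists2 s : J -> H,
    forall j, Sub m (s j) & x = \sum_j s j * e j;
  tri_r : forall x, Sub m.+1 x -> exists2 s : J -> H,
    forall j, Sub m (s j) & x = \sum_j g j * s j
}.

Section TriInj.
Variables (m : nat) (J : finType) (R : nat) (rk : J -> nat) (e g : J -> H).
Hypothesis Ht : triangular m R rk e g.

Lemma tri_gramS s t j l : Sub m s -> Sub m t -> (rk l <= rk j)%N ->
  tr m.+1 (s * (e j * g l) * t) = (j == l)%:R * tr m (s * t).
Proof. by move=> ss st r; apply: Sub_tr ss st => p q x y sx sy; apply: (tri_gram Ht) sx sy r. Qed.

(** Pairing the sum of the s_j e_j with g_l t leaves tr_m(s_l t) once all s_j of smaller rank
    vanish; so the s_l vanish rank by rank. *)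
Lemma tri_inj : tr_inj m -> tr_inj m.+1.
Proof.
move=> inj x sx xy0; have [s ss xs] := tri_l Ht sx.
suff s0 n : forall l, (rk l < n)%N -> s l = 0.
  by rewrite xs big1 // => j _; rewrite (s0 (rk j).+1) ?mul0r.
elim: n => // n IH l lr; apply: inj => // t st.
have st' : Sub m.+1 t by apply: Sub_leq st.
have := xy0 _ (Sub_M (tri_g Ht l) st'); rewrite xs mulr_suml linear_sum (bigD1 l) //=.
rewrite !mulrA -(mulrA (s l)) (tri_gramS (ss l) st) // eqxx mul1r big1 ?addr0 //.
move=> j njl; have [rl|rl] := leqP (rk l) (rk j).
  rewrite !mulrA -(mulrA (s j)) (tri_gramS (ss j) st) //.
  by rewrite (negPf njl) mul0r.
by rewrite (IH j) ?mul0r ?linear0 //; lia.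
Qed.

(** The element is built rank by rank: at rank n one adds the s_l e_l with rk l = n, where s_l
    represents over H_m the remaining defect on g_l. By triangularity lower ranks are not
    disturbed. *)
Lemma tri_surj : tr_surj m -> tr_surj m.+1.
Proof.
move=> surj phi.
suff [a sa ha] : exists2 a, Sub m.+1 a & forall l t, (rk l < R)%N -> Sub m t ->
    tr m.+1 (a * (g l * t)) = phi (g l * t).
  exists a => // y sy; have [s ss ->] := tri_r Ht sy.
  by rewrite mulr_sumr !linear_sum; apply: eq_bigr => j _; apply: ha => //; apply: tri_rk Ht _.
elim: (R) => [|n [a sa IH]]; first by exists 0 => //; apply: Sub_0.
have /choice[s ss] : forall l, exists s, Sub m s /\ forall t, Sub m t ->
    tr m (s * t) = phi (g l * t) - tr m.+1 (a * (g l * t)).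
  move=> l.
  have L : linear_for *%R (fun t => phi (g l * t) - tr m.+1 (a * (g l * t))).
    move=> c t t' /=; rewrite !mulrDr -!pz_scalerAr !linearP /=; ring.
  by have [s ss hs] := surj (mk_scalar L); exists s; split.
exists (a + \sum_(l | rk l == n) s l * e l) => [|l t rl st].
  apply: Sub_D => //; apply: Sub_sum => l _; apply: Sub_M; last exact: (tri_e Ht).
  by apply: Sub_leq (ss l).1.
have gram j : (rk l <= rk j)%N ->
    tr m.+1 (s j * e j * (g l * t)) = (j == l)%:R * tr m (s j * t).
  by move=> r; rewrite !mulrA -(mulrA (s j)) (tri_gramS (ss j).1 st).
rewrite mulrDl linearD /= mulr_suml linear_sum /=.
have [rln|rln] := ltnP (rk l) n.
  rewrite IH // big1 ?addr0 // => j /eqP rj; rewrite gram; last lia.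
  by case: eqP => [jl|_]; [rewrite jl in rj; lia | rewrite mul0r].
have rn : rk l = n by lia.
rewrite (bigD1 l) /=; last exact/eqP.
rewrite gram // eqxx mul1r (ss l).2 // big1 => [|j].
  by rewrite addr0 addrC subrK.
case/andP=> /eqP rj njl; rewrite gram; last lia.
by rewrite (negPf njl) mul0r.
Qed.
End TriInj.

Section Span.
Variables (m : nat) (J : finType) (F : J -> H -> H).
Hypothesis FD : forall j x y, F j (x + y) = F j x + F j y.

(** Abstracting from F treats left spans, with F j s = s e_j, and right spans, with F j s = g_j s,
    together. *)
Definition spn x := exists2 s : J -> H, forall j, Sub m (s j) & x = \sum_j F j (s j).

Let F0 j : F j 0 = 0.
Proof. by apply: (addrI (F j 0)); rewrite -FD !addr0. Qed.
Lemma spn_0 : spn 0.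
Proof. by exists (fun=> 0) => [j|]; [apply: Sub_0 | rewrite big1]. Qed.
Lemma spn_D x y : spn x -> spn y -> spn (x + y).
Proof.
move=> [s ss ->] [t st ->]; exists (fun j => s j + t j) => [j|]; first exact: Sub_D.
by rewrite -big_split; apply: eq_bigr => j _; rewrite FD.
Qed.
Lemma spn_sum (K : Type) (r : seq K) (G : K -> H) :
  (forall i, spn (G i)) -> spn (\sum_(i <- r) G i).
Proof.
move=> sG; elim/big_rec: _ => [|i x _ sx]; first exact: spn_0.
exact: spn_D.
Qed.
Lemma spn_F j x : Sub m x -> spn (F j x).
Proof.
move=> sx; exists (fun i => if i == j then x else 0) => [i|].
  by case: eqP => // _; apply: Sub_0.
by rewrite (bigD1 j) //= eqxx big1 ?addr0 // => i /negPf ->.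
Qed.
Lemma spn_Z c x : (forall j x, F j (c *: x) = c *: F j x) -> spn x -> spn (c *: x).
Proof.
move=> FZ [s ss ->]; exists (fun j => c *: s j) => [j|]; first exact: Sub_Z.
by rewrite scaler_sumr; apply: eq_bigr => j _; rewrite FZ.
Qed.
End Span.

(* The part of the families e and g that comes from the T-part of Mackey's      *)
(* decomposition.                                                               *)
Record tblock m (J : finType) (R : nat) (rk : J -> nat) (e g : J -> H) : Prop :=
  TBlock {
  tb_e : forall j, Sub m.+1 (e j);
  tb_g : forall j, Sub m.+1 (g j);
  tb_rk : forall j, (rk j < R)%N;
  tb_gram : forall p q s t j l, sub m p s -> sub m q t -> (rk l <= rk j)%N ->
    tr m.+1 (s * (e j * g l) * t) = (j == l)%:R * tr m (s * t);
  tb_cross : forall p q s t a j l, sub m p s -> sub m q t -> (j < d)%N ->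
    tr m.+1 (s * (rA m a * xx m ^+ j * g l) * t) = 0;
  tb_l : (0 < m)%N -> forall u v, Sub m u -> Sub m v ->
    spn m (fun j s => s * e j) (u * rT m.-1 * v);
  tb_r : (0 < m)%N -> forall u v, Sub m u -> Sub m v ->
    spn m (fun j s => g j * s) (u * rT m.-1 * v)
}.

Lemma Sub_par m (P : H -> Prop) : (forall x y, P x -> P y -> P (x + y)) ->
  (forall p x, sub m p x -> P x) -> forall x, Sub m x -> P x.
Proof. by move=> PD Ps; apply: Sub_ind. Qed.

(** Since X_(m+1)^(-1) T_m = T_m^(-1) X_m^(-1) and T_m^(-1) = T_m - z t, the crossing moves to the
    left, and the terms without it carry X_(m+1)^(-i) with i < l. *)
Lemma yyT m l : (m.+1 < N)%N -> exists w (ws : nat -> H),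
  [/\ Sub m.+1 w, forall i, Sub m.+1 (ws i) & yy m.+1 ^+ l * rT m = rT m * w
    + \sum_(i < l) yy m.+1 ^+ i * tel B Bd (rA m) (rA m.+1) * ws i].
Proof.
move=> mN; have sy : Sub m.+1 (yy m) by apply: (Sub_sub (p := false)); apply: sub_yy; lia.
elim: l => [|l [w [ws [sw sws IH]]]].
  exists 1, (fun=> 0); split; [exact: Sub_1 | by move=> i; apply: Sub_0|].
  by rewrite big_ord0 addr0 expr0 mul1r mulr1.
exists (yy m * w), (fun i => if i is j.+1 then ws j else - z *: (yy m * w)).
split; first exact: Sub_M.
  by case=> [|j]; [apply: Sub_Z; apply: Sub_M | apply: sws].
rewrite exprS -mulrA IH mulrDr mulr_sumr big_ord_recl /= expr0 mul1r addrA; congr (_ + _).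
  rewrite mulrA -(mulrA _ _ (rT m)) (TinvT HH) // mulr1 mulrBl mulrBl.
  by rewrite -pz_scalerAr -!pz_scalerAl scaleNr !mulrA.
by apply: eq_bigr => i _; rewrite /bump /= add1n exprS !mulrA.
Qed.

(** The X part is added to the T part. For l <= j the product of b^vee X^j and X^(-l) c is b^vee c
    X^(j-l), with exponent between 0 and d-1, so [trX] gives 1 on the diagonal and 0 off it. *)
Lemma tri_tblock m (J : finType) R (rk : J -> nat) e g : (m < N)%N ->
  tblock m R rk e g -> exists (J' : finType) R' (rk' : J' -> nat) e' g',
  triangular m R' rk' e' g'.
Proof.
move=> mN tb.
(* The X part gets the ranks R + j, above the T part and ordered by exponent; then [tb_cross] covers
   the mixed entries that triangularity asks for. *)
pose K := (('I_d * I) + J)%type.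
pose rk' (x : K) := match x with inl jb => (R + jb.1)%N | inr y => rk y end.
pose e' (x : K) := match x with
  inl jb => rA m (Bd jb.2) * xx m ^+ jb.1 | inr y => e y end.
pose g' (x : K) := match x with
  inl jb => yy m ^+ jb.1 * rA m (B jb.2) | inr y => g y end.
have FDl (L : finType) (h : L -> H) j x y : (x + y) * h j = x * h j + y * h j.
  exact: mulrDl.
have FDr (L : finType) (h : L -> H) j x y : h j * (x + y) = h j * x + h j * y.
  exact: mulrDr.
exists K, (R + d)%N, rk', e', g'; split.
- case=> [[j b]|j] /=; last exact: (tb_e tb).
  apply: Sub_M; first exact: Sub_A.
  by apply: (Sub_sub (p := false)); apply: sub_exp; apply: (sub_jm).
- case=> [[j b]|j] /=; last exact: (tb_g tb).
  apply: Sub_M; last exact: Sub_A.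
  by apply: (Sub_sub (p := false)); apply: sub_exp; apply: sub_yy.
- by case=> [[j b]|j] /=; [rewrite ltn_add2l | apply: ltn_addr; apply: (tb_rk tb)].
- move=> p q s t [[j b]|j] [[l c]|l] ss st /= r.
  + have eX : rA m (Bd b) * xx m ^+ j * (yy m ^+ l * rA m (B c))
      = rA m (Bd b * B c) * xx m ^+ (j - l).
      rewrite (hd_A HH mN).2 mulrA -(mulrA (rA m (Bd b))) (xxyyX mN); last lia.
      by rewrite -(mulrA (rA m (Bd b))) (xxA HH) // !mulrA.
    rewrite eX (mulrA s).
    rewrite (trX mN _ ss st (par_M sA (par_Bd HA b) (par_B HA c))); last by have := ltn_ord j; lia.
    rewrite (db_dual HA) -natrM mulnb; congr (_%:R * _).
    by rewrite /eq_op /= /eq_op /= -val_eqE /=; congr (nat_of_bool (_ && _)); lia.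
  + by rewrite (tb_cross tb (Bd b) l ss st (ltn_ord j)) mul0r.
  + by have := tb_rk tb j; lia.
  + exact: (tb_gram tb ss st).
- move=> x sx; suff: spn m (fun j s => s * e' j) x by [].
  elim/Sub_par: sx => [|p {}x sx]; first by apply: spn_D; apply: FDl.
  elim: (mackey HA centf HH d_gt0 mN sx).
  + move=> p1 q1 r u v _ m0 su sv; have [s ss ->] := tb_l tb m0 (Sub_sub su) (Sub_sub sv).
    apply: spn_sum (FDl _ _) _ _ _ _ => j.
    exact: (spn_F (FDl _ _) (inr j)).
  + move=> p1 q1 r x1 a j _ dj sx1 _; rewrite (crd_dualE HA a) linear_sum mulr_sumr mulr_suml.
    apply: (spn_sum (FDl _ _)) => b.
    rewrite linZ -pz_scalerAr pz_scalerAl -mulrA.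
    exact: (spn_F (FDl _ _) (inl (Ordinal dj, b)) (Sub_Z _ (Sub_sub sx1))).
  + by move=> r; apply: (spn_0 m (FDl _ _)).
  + move=> r c y1 y2 _ IH1 _ IH2; apply: (spn_D (FDl _ _)) => //.
    by apply: spn_Z => // j y; rewrite pz_scalerAl.
- move=> x sx; suff: spn m (fun j s => g' j * s) x by [].
  have PD := FDr _ g'.
  have PZ c y : spn m (fun j s => g' j * s) y -> spn m (fun j s => g' j * s) (c *: y).
    by apply: spn_Z => j {}y; rewrite pz_scalerAr.
  have P2 u v a l : (l < d)%N -> Sub m u -> Sub m v ->
      spn m (fun j s => g' j * s) (u * yy m ^+ l * rA m a * v).
    move=> ld su sv; elim/Sub_par: su => [u1 u2|p {}u su].
      by rewrite !mulrDl; apply: spn_D.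
    have [a0 [a1 [pa0 pa1 ->]]] := par_span sA a.
    suff h q b : par q b -> spn m (fun j s => g' j * s) (u * yy m ^+ l * rA m b * v).
      by rewrite linearD mulrDr mulrDl; apply: (spn_D PD); apply: h; eauto.
    move=> pb; rewrite -(yy_comm _ mN (sub_xx HH mN su)) -(mulrA _ u).
    rewrite (sub_rA' HH mN pb su) -pz_scalerAr -pz_scalerAl; apply/PZ.
    rewrite {1}(crdE HA b) linear_sum mulr_suml mulr_sumr mulr_suml.
    apply: (spn_sum PD) => c; rewrite linZ -pz_scalerAl -pz_scalerAr -pz_scalerAl.
    apply/PZ; rewrite !mulrA -mulrA.
    exact: (spn_F PD (inl (Ordinal ld, c)) (Sub_M (Sub_sub su) sv)).
  have P1 u v : (0 < m)%N -> Sub m u -> Sub m v ->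
      spn m (fun j s => g' j * s) (u * rT m.-1 * v).
    move=> m0 su sv; have [s ss ->] := tb_r tb m0 su sv.
    by apply: (spn_sum PD) => j; exact: (spn_F PD (inr j)).
  have P3 u v l : (0 < m)%N -> (l <= d)%N -> Sub m u -> Sub m v ->
      spn m (fun j s => g' j * s) (u * (yy m ^+ l * rT m.-1) * v).
    move=> m0 ld su sv; have [|w [ws [sw sws]]] := @yyT m.-1 l; first by rewrite prednK.
    rewrite !(prednK m0) in sw sws * => ->.
    rewrite mulrDr mulrDl; apply: (spn_D PD).
      by rewrite !mulrA -mulrA; apply: P1 => //; apply: Sub_M.
    rewrite mulr_sumr mulr_suml; apply: (spn_sum PD) => i.
    rewrite mulr_sumr mulr_suml mulr_sumr mulr_suml; apply: (spn_sum PD) => b.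
    rewrite (mulrA (yy m ^+ i)) (yy_comm i mN (jmA HH (l := m.-1) (B b) mN _)); last lia.
    rewrite !mulrA -mulrA; apply: P2; first by have := ltn_ord i; lia.
      by apply: Sub_M => //; apply: Sub_A; lia.
    exact: Sub_M.
  (* Multiplication by X^(-(d-1)) turns the exponents 0, ..., d-1 of the decomposition into the
     exponents of the family g; every x is X^(-(d-1)) applied to X^(d-1) x. *)
  have P4 y : Sub m.+1 y -> spn m (fun j s => g' j * s) (yy m ^+ d.-1 * y).
    move=> sy; elim/Sub_par: sy => [y1 y2|p {}y sy].
      by rewrite mulrDr; apply: spn_D.
    elim: (mackey HA centf HH d_gt0 mN sy).
    + move=> p1 q1 r u v _ m0 su sv.
      rewrite !mulrA (yy_comm _ mN (sub_xx HH mN su)) -(mulrA u).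
      by apply: P3 => //; [lia | apply: Sub_sub su | apply: Sub_sub sv].
    + move=> p1 q1 r u a j _ dj su _.
      rewrite !mulrA (yy_comm _ mN (sub_xx HH mN su)) -!mulrA -(xxA HH) //.
      rewrite (mulrA (yy _ ^+ _)) (yyxxX mN); last lia.
      rewrite !mulrA -[X in spn _ _ X]mulr1.
      by apply: P2; [lia | apply: Sub_sub su | apply: Sub_1].
    + by move=> r; rewrite mulr0; apply: (spn_0 m PD).
    + move=> r c y1 y2 _ IH1 _ IH2; rewrite mulrDr -pz_scalerAr; apply: (spn_D PD) => //.
      exact/PZ.
  have : Sub m.+1 (xx m ^+ d.-1 * x).
    by apply: Sub_M => //; apply: (Sub_sub (p := false)); apply: sub_exp; apply: sub_jm.
  by move/P4; rewrite mulrA (yyxxX mN) // subnn expr0 mul1r.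
Qed.

Lemma tblock0 : (0 < N)%N -> tblock 0 0 (fun _ : 'I_0 => 0%N) (fun=> 0) (fun=> 0).
Proof.
move=> N0; split=> //; try by case.
  by move=> p q s t [].
by move=> p q s t a j [].
Qed.

(* y is the conditional expectation of x; that it does not depend on the choice *)
(* of a decomposition of x is not needed.                                       *)
Lemma cond_exp m x : (m.+1 < N)%N -> Sub m.+1 x -> exists2 y, Sub m y &
  (forall s t, Sub m s -> Sub m t -> tr m.+1 (s * x * t) = tr m (s * y * t)) /\
  (forall s t, Sub m.+1 s -> Sub m.+1 t ->
     tr m.+2 (s * (rT m * x * rT m) * t) = tr m.+1 (s * y * t)).
Proof.
move=> mN sx; have mN' : (m < N)%N by lia.
elim/Sub_par: sx => [x1 x2 [y1 s1 [e1 e1']] [y2 s2 [e2 e2']]|p {}x sx].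
  exists (y1 + y2); first exact: Sub_D.
  split=> s t ss st.
    by rewrite !(mulrDr, mulrDl) !linearD /= e1 // e2.
  by rewrite !(mulrDr, mulrDl) !linearD /= e1' // e2'.
have lew r y : sub m r y -> sub m.+1 r y by apply: sub_leq.
have trS m1 m2 (w : H) (c : k) (y : H) :
  (forall p q s t, sub m1 p s -> sub m1 q t ->
     tr m1.+1 (s * w * t) = c * tr m2 (s * y * t)) ->
  forall s t, Sub m1 s -> Sub m1 t -> tr m1.+1 (s * w * t) = c * tr m2 (s * y * t).
  move=> h s t ss st; elim/Sub_par: ss => [s1 s2 E1 E2|p1 {}s ss].
    by rewrite !mulrDl !linearD /= E1 E2 mulrDr.
  elim/Sub_par: st => [s1 s2 E1 E2|p2 {}t st]; last exact: h ss st.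
  by rewrite !mulrDr !linearD /= E1 E2 mulrDr.
elim: (mackey HA centf HH d_gt0 mN' sx).
- move=> p1 q1 r u v _ m0 su sv; exists 0; first exact: Sub_0.
  split=> s t ss st; rewrite mulr0 mul0r linear0 -[RHS](mul0r (tr 0 (s * 0 * t))).
    apply: trS ss st => p2 q2 {}s {}t ss st; rewrite mul0r !mulrA -(mulrA _ v).
    exact: (trT m0 mN' (sub_M (erefl _) ss su) (sub_M (erefl _) sv st)).
  apply: trS ss st => p2 q2 {}s {}t ss st; rewrite mul0r.
  exact: (tr_TTT mN m0 su sv ss st).
- move=> p1 q1 r u a j _ dj su pa; exists (((j == 0%N)%:R * trA a) *: u).
    by apply: Sub_Z; apply: Sub_sub su.
  split=> s t ss st; rewrite -pz_scalerAr -pz_scalerAl linearZ /=.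
    apply: trS ss st => p2 q2 {}s {}t ss st; rewrite !mulrA.
    exact: (trX mN' dj (sub_M (erefl _) ss su) st pa).
  apply: trS ss st => p2 q2 {}s {}t ss st.
  exact: (tr_TaxT mN dj su pa ss st).
- move=> r; exists 0; first exact: Sub_0.
  by split=> s t ss st; rewrite !(mulr0, mul0r) !linear0.
- move=> r c x1 x2 _ [y1 s1 [e1 e1']] _ [y2 s2 [e2 e2']].
  exists (c *: y1 + y2); first by apply: Sub_D => //; apply: Sub_Z.
  split=> s t ss st; rewrite !(mulrDr, mulrDl) -!(pz_scalerAr, pz_scalerAl) !linearP /=.
    by rewrite e1 // e2.
  by rewrite e1' // e2'.
Qed.

(** The Gram entries involve T_m e_j g_l T_m, whose trace is that of the conditional expectation of
    e_j g_l. This is the old Gram entry, so triangularity is inherited. *)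
Lemma tblock_step m (J : finType) R (rk : J -> nat) e g : (m.+1 < N)%N -> tr_inj m ->
  triangular m R rk e g ->
  tblock m.+1 R rk (fun j => rT m * e j) (fun j => g j * rT m).
Proof.
move=> mN inj Ht; have mN' : (m < N)%N by lia.
have FDl (L : finType) (h : L -> H) j x y : (x + y) * h j = x * h j + y * h j.
  exact: mulrDl.
have FDr (L : finType) (h : L -> H) j x y : h j * (x + y) = h j * x + h j * y.
  exact: mulrDr.
have commT s : Sub m s -> GRing.comm (rT m) s.
  elim/Sub_ind => [p {}s ss|s1 s2 c1 c2]; first exact: (sub_T_comm HH mN ss).
  exact: commrD.
split.
- by move=> j; apply: Sub_M; [apply: Sub_T | apply: Sub_leq (tri_e Ht j)].
- by move=> j; apply: Sub_M; [apply: Sub_leq (tri_g Ht j) | apply: Sub_T].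
- exact: (tri_rk Ht).
- move=> p q s t j l ss st r; rewrite -(mulrA (rT m)) (mulrA (e j)) (mulrA (rT m)).
  have [y sy [h1 h2]] := cond_exp mN (Sub_M (tri_e Ht j) (tri_g Ht l)).
  rewrite h2; [|exact: Sub_sub ss|exact: Sub_sub st].
  (* The conditional expectation is determined by its pairings with H_m, as the trace form on H_m is
     injective. *)
  suff ->: y = (j == l)%:R *: (1 : H).
    by rewrite -pz_scalerAr -pz_scalerAl mulr1 linearZ.
  apply/eqP; rewrite -subr_eq0; apply/eqP; apply: inj => [|t' st'].
    by apply: Sub_D => //; apply: Sub_N; apply: Sub_Z; apply: Sub_1.
  rewrite mulrBl -[y]mul1r linearB /= -h1 //; last exact: Sub_1.
  rewrite (tri_gramS Ht (Sub_1 m) st') // mul1r -pz_scalerAl mul1r linearZ /=.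
  by rewrite subrr.
- move=> p q s t a j l ss st jd.
  elim/Sub_par: (tri_g Ht l) => [x y hx hy|r x sx].
    by rewrite !(mulrDl, mulrDr) linearD /= hx hy addr0.
  have [a0 [a1 [pa0 pa1 ->]]] := par_span sA a.
  suff h r' b : par r' b -> tr m.+2 (s * (rA m.+1 b * xx m.+1 ^+ j * (x * rT m)) * t) = 0.
    by rewrite linearD !(mulrDl, mulrDr) linearD (h _ _ pa0) (h _ _ pa1) addr0.
  move=> pb; have -> : rA m.+1 b * xx m.+1 ^+ j * (x * rT m)
      = (-1) ^+ (r' && r) *: (x * rA m.+1 b * (xx m.+1 ^+ j * rT m)).
    rewrite mulrA -(mulrA (rA m.+1 b)) (sub_xxX HH _ mN sx) !mulrA.
    by rewrite (sub_rA HH mN pb sx) -!pz_scalerAl.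
  rewrite -pz_scalerAr -pz_scalerAl; set w := s * _ * t; rewrite linearZ /= {}/w !(mulrA s).
  by rewrite (tr_xxT mN jd pb (sub_M (erefl _) ss sx) st) mulr0.
- move=> _ u v su sv; have [s ss ->] := tri_l Ht sv.
  rewrite mulr_sumr; apply: (spn_sum (FDl _ _)) => j.
  rewrite !mulrA -(mulrA u) (commT _ (ss j)) mulrA -mulrA.
  apply: (spn_F (FDl _ _) j); apply: Sub_M => //.
  exact: Sub_leq (ss j).
- move=> _ u v su sv; have [s ss ->] := tri_r Ht su.
  rewrite !mulr_suml; apply: (spn_sum (FDr _ _)) => j.
  rewrite -!mulrA (mulrA (s j)) -(commT _ (ss j)) !mulrA -mulrA.
  apply: (spn_F (FDr _ _) j); apply: Sub_M => //.
  exact: Sub_leq (ss j).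
Qed.

Lemma tr_perfect m : (m <= N)%N -> tr_inj m /\ tr_surj m.
Proof.
move=> mN; suff: [/\ tr_inj m, tr_surj m & (m < N)%N -> exists (J : finType) R
    (rk : J -> nat) e g, triangular m R rk e g] by case.
elim: m mN => [|m IH] mN.
  split; last by move=> N0; apply: tri_tblock (tblock0 N0).
    move=> x [x0 [x1 [/sub0P[c -> _] /sub0P[c' _ /(_ isT) ->] ->]]] h.
    have := h 1 (Sub_1 0); rewrite addr0 mulr1 linearZ /= tr0 mulr1 => ->.
    by rewrite scale0r.
  move=> phi; exists (phi 1 *: (1 : H)); first by apply: Sub_Z; apply: Sub_1.
  move=> y [x0 [x1 [/sub0P[c -> _] /sub0P[c' _ /(_ isT) ->] ->]]].
  by rewrite addr0 -pz_scalerAl -pz_scalerAr mulr1 !linearZ /= tr0 mulr1 mulrC.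
have [|inj surj /(_ mN)[J [R [rk [e [g Ht]]]]]] := IH; first lia.
split; [exact: tri_inj Ht inj|exact: tri_surj Ht surj|move=> mN'].
exact: (tri_tblock mN' (tblock_step mN' inj Ht)).
Qed.
End Traces.

(** * The universal property *)

Record ahom (k : comNzRingType) (C E : pzAlgType k) (g : C -> E) : Prop := AHom {
  ahomP : forall c x y, g (c *: x + y) = c *: g x + g y;
  ahomM : forall x y, g (x * y) = g x * g y;
  ahom1 : g 1 = 1
}.

Section AHomTheory.
Variables (k : comNzRingType) (C E : pzAlgType k) (g : C -> E).
Hypothesis gh : ahom g.
Lemma ahomD x y : g (x + y) = g x + g y.
Proof. by rewrite -[x]scale1r (ahomP gh) !scale1r. Qed.
Lemma ahom0 : g 0 = 0.
Proof. by apply: (addrI (g 0)); rewrite -ahomD !addr0. Qed.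
Lemma ahomZ c x : g (c *: x) = c *: g x.
Proof. by rewrite -[c *: x]addr0 (ahomP gh) ahom0 addr0. Qed.
Lemma ahomB x y : g (x - y) = g x - g y.
Proof. by rewrite -scaleN1r addrC (ahomP gh) scaleN1r addrC. Qed.
Lemma ahom_sum (J : Type) (r : seq J) (P : pred J) (F : J -> C) :
  g (\sum_(i <- r | P i) F i) = \sum_(i <- r | P i) g (F i).
Proof. exact: (big_morph g ahomD ahom0). Qed.
Lemma ahom_prod (J : Type) (r : seq J) (P : pred J) (F : J -> C) :
  g (\prod_(i <- r | P i) F i) = \prod_(i <- r | P i) g (F i).
Proof. exact: (big_morph g (ahomM gh) (ahom1 gh)). Qed.
Lemma ahomX x j : g (x ^+ j) = g x ^+ j.
Proof.
elim: j => [|j IH]; first by rewrite !expr0 (ahom1 gh).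
by rewrite !exprS (ahomM gh) IH.
Qed.
End AHomTheory.

Lemma ahom_comp (k : comNzRingType) (C D E : pzAlgType k) (g : D -> E) (h : C -> D) :
  ahom g -> ahom h -> ahom (g \o h).
Proof.
move=> gh hh; split=> [c x y|x y|] /=; first by rewrite (ahomP hh) (ahomP gh).
  by rewrite (ahomM hh) (ahomM gh).
by rewrite (ahom1 hh) (ahom1 gh).
Qed.

Section FreeLift.
Variables (k : comNzRingType) (G : choiceType) (E : pzAlgType k) (h : G -> E).

Definition monom_lift (m : {fmonom G}) : E := \prod_(g <- (m : seq G)) h g.
Definition free_lift (x : {malg k[{fmonom G}]}) : E :=
  \sum_(m <- msupp x) x@_m *: monom_lift m.

Lemma free_liftEw (D : {fset {fmonom G}}) x : (msupp x `<=` D)%fset ->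
  free_lift x = \sum_(m <- D) x@_m *: monom_lift m.
Proof.
move=> le; apply: big_fset_incl le _ => m _ /mcoeff_outdom ->.
by rewrite scale0r.
Qed.

Lemma free_liftP c x y : free_lift (c *: x + y) = c *: free_lift x + free_lift y.
Proof.
set D := (msupp x `|` msupp y)%fset.
have sx : (msupp x `<=` D)%fset by apply: fsubsetUl.
have sy : (msupp y `<=` D)%fset by apply: fsubsetUr.
have sz : (msupp (c *: x + y) `<=` D)%fset.
  apply: fsubset_trans (msuppD_le _ _) _; apply: fsetSU; exact: msuppZ_le.
rewrite (free_liftEw sx) (free_liftEw sy) (free_liftEw sz) scaler_sumr -big_split.
by apply: eq_bigr => m _ /=; rewrite mcoeffD mcoeffZ scalerDl scalerA.
Qed.

Lemma free_liftU c m : free_lift << c *g m >> = c *: monom_lift m.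
Proof. by rewrite (free_liftEw msuppU_le) big_seq_fset1 mcoeffUU. Qed.

Lemma monom_liftM (m1 m2 : {fmonom G}) : monom_lift (monalg.mul m1 m2) = monom_lift m1 * monom_lift m2.
Proof. by rewrite /monom_lift fmM big_cat. Qed.

Lemma free_lift_ahom : ahom (free_lift : free_alg k G -> E).
Proof.
have l0 : free_lift 0 = 0 by rewrite /free_lift msupp0 big_seq_fset0.
have lD : {morph free_lift : x y / x + y}.
  by move=> x y; rewrite -[x]scale1r free_liftP !scale1r.
split; first exact: free_liftP.
- move=> x y; rewrite [x * y]malgME (big_morph _ lD l0) mulr_suml.
  apply: eq_bigr => m1 _; rewrite (big_morph _ lD l0) mulr_sumr.
  apply: eq_bigr => m2 _; rewrite free_liftU monom_liftM.
  by rewrite -pz_scalerAl -pz_scalerAr scalerA.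
- rewrite [LHS]free_liftU scale1r /monom_lift fm1 big_nil //.
Qed.
End FreeLift.

Section QuoLift.
Variables (k : comNzRingType) (C E : pzAlgType k) (S : C -> Prop) (g : C -> E).
Hypothesis gh : ahom g.
Hypothesis gS : forall x, S x -> g x = 0.

Lemma quo_lift : exists2 h : quotient_alg S -> E, ahom h & forall x, h (quo S x) = g x.
Proof.
have g0 x : ideal_gen S x -> g x = 0.
  elim=> {x} [x /gS //||x y _ gx _ gy|a x b _ gx]; first exact: ahom0.
    by rewrite ahomD // gx gy addr0.
  by rewrite !(ahomM gh) gx mulr0 mul0r.
pose h (u : quotient_alg S) : E := g (repr u).
have hq x : h (quo S x) = g x.
  by apply/eqP; rewrite -subr_eq0 -(ahomB gh) g0 //; apply: ideal_repr.
exists h => //; split=> [c u v|u v|].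
- have [[x ->] [y ->]] := (quo_surj u, quo_surj v).
  by rewrite -quoZ -quoD !hq (ahomP gh).
- have [[x ->] [y ->]] := (quo_surj u, quo_surj v).
  by rewrite -quoM !hq (ahomM gh).
- by rewrite -quo1 hq (ahom1 gh).
Qed.
End QuoLift.

(** * Pure tensors as ordered products over the strands *)

Section TensorWords.
Variables (k : comNzRingType) (A : pzAlgType k) (par : bool -> A -> Prop).
Variables (trA : {scalar A}) (I : finType) (B Bd : I -> A).
Hypothesis HA : dual_bases par trA B Bd.
Variables (z : k) (d : nat) (f : 'I_d -> A).
Variables (H : pzAlgType k) (N : nat) (rA : nat -> {linear A -> H}).
Variables (rT : nat -> H) (rX : H).
Hypothesis HH : hecke_datum par B Bd z f N rA rT rX.
Local Notation sub := (sub par rA rT rX).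

Definition tprod m (a : nat -> A) : H := \prod_(0 <= j < m) rA j (a j).

Lemma eq_tprod m a c : (forall j, (j < m)%N -> a j = c j) -> tprod m a = tprod m c.
Proof. by move=> ac; apply: eq_big_nat => j /andP[_ jm]; rewrite ac. Qed.

Lemma tprodS m a : tprod m.+1 a = tprod m a * rA m (a m).
Proof. by rewrite /tprod big_nat_recr. Qed.

Lemma tprod_split m j a : (j < m)%N ->
  tprod m a = tprod j a * rA j (a j) * \prod_(j.+1 <= i < m) rA i (a i).
Proof.
move=> jm; rewrite /tprod (big_cat_nat _ (n := j)) //=; last exact: ltnW.
by rewrite [X in _ * X]big_ltn // mulrA.
Qed.

Lemma tprod_comm m m' a x :
  (forall j, (m <= j < m')%N -> GRing.comm x (rA j (a j))) ->
  GRing.comm x (\prod_(m <= j < m') rA j (a j)).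
Proof.
move=> cx; rewrite big_nat_cond; apply: (big_ind (GRing.comm x)).
- exact: commr1.
- by move=> u v; apply: commrM.
- by move=> j; rewrite andbT; apply: cx.
Qed.

Lemma prod_rA1 m m' a : (m' <= N)%N -> (forall j, (m <= j < m')%N -> a j = 1) ->
  \prod_(m <= j < m') rA j (a j) = 1.
Proof.
move=> mN a1; rewrite big_nat_cond big1 // => j; rewrite andbT => jm.
by rewrite a1 // (hd_A HH _).1 //; lia.
Qed.

Lemma tprod_delta m l x a : (m <= N)%N -> (l < m)%N -> a l = x ->
  (forall j, (j < m)%N -> j != l -> a j = 1) -> tprod m a = rA l x.
Proof.
move=> mN lm al a1; rewrite (tprod_split _ lm) al /tprod !prod_rA1 ?mul1r ?mulr1 //.
- by move=> j jl; apply: a1; lia.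
- lia.
- by move=> j jl; apply: a1; lia.
Qed.

Lemma tprod_sub m p a : (forall j, (j < m)%N -> par (p j) (a j)) ->
  sub m (\big[addb/false]_(0 <= j < m) p j) (tprod m a).
Proof.
elim: m => [|m IH] pa; first by rewrite /tprod !big_nil; apply: sub_1.
rewrite big_nat_recr //= tprodS; apply: (sub_M (erefl _)).
  by apply: (@sub_leq _ _ _ _ _ _ _ m) => //; apply: IH => j jm; apply: pa; lia.
by apply: sub_gA => //; apply: pa.
Qed.

Lemma signr_addb_sum p (q : nat -> bool) m :
  (-1) ^+ (p && \big[addb/false]_(0 <= j < m) q j)
  = (-1) ^+ (\sum_(0 <= j < m) (p && q j))%N :> k.
Proof.
elim: m => [|m IH]; first by rewrite !big_nil andbF.
rewrite !big_nat_recr //= exprD -IH.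
by case: p (q m) (\big[_/_]_(_ <= _ < _) _) {IH} => [] [] []; rewrite ?expr0 ?expr1 ?mulrNN ?mulr1 ?mul1r.
Qed.

(** Moving the last factor of a past the first m factors of c produces the inner sum, for i = m, of
    the Koszul exponent. *)
Lemma tprod_mul m p q a c : (m <= N)%N -> (forall j, (j < m)%N -> par (p j) (a j)) ->
  (forall j, (j < m)%N -> par (q j) (c j)) ->
  tprod m a * tprod m c = (-1) ^+ (\sum_(0 <= i < m) \sum_(0 <= j < i) (p i && q j))%N
    *: tprod m (fun j => a j * c j).
Proof.
elim: m => [|m IH] mN pa qc; first by rewrite /tprod !big_nil expr0 scale1r mulr1.
rewrite !tprodS mulrA -(mulrA (tprod m a)).
rewrite (sub_rA HH mN (pa m _) (tprod_sub (p := q) _)) //; last by move=> j jm; apply: qc; lia.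
rewrite -pz_scalerAr -pz_scalerAl mulrA IH => [|||]; [|lia|by move=> j jm; apply: pa; lia|by move=> j jm; apply: qc; lia].
rewrite -!pz_scalerAl -mulrA -(hd_A HH mN).2 scalerA big_nat_recr //= exprD mulrC.
by rewrite signr_addb_sum.
Qed.

Lemma tprod_T m i p a a' : (i.+1 < m)%N -> (m <= N)%N ->
  (forall j, (j < m)%N -> par (p j) (a j)) -> a' i = a i.+1 -> a' i.+1 = a i ->
  (forall j, (j < m)%N -> j != i -> j != i.+1 -> a' j = a j) ->
  rT i * tprod m a = (-1) ^+ (p i && p i.+1) *: (tprod m a' * rT i).
Proof.
move=> im mN pa ai ai1 aj; have iN : (i.+1 < N)%N by lia.
rewrite (tprod_split a im) (tprod_split a' im) !tprodS ai ai1.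
rewrite (@eq_tprod i a' a) => [|j ji]; last by apply: aj; lia.
have -> : \prod_(i.+2 <= j < m) rA j (a' j) = \prod_(i.+2 <= j < m) rA j (a j).
  by apply: eq_big_nat => j jm; rewrite aj //; lia.
have c1 : GRing.comm (rT i) (tprod i a).
  by apply: tprod_comm => j ji; apply: (hd_TA HH); lia.
have c2 : GRing.comm (rT i) (\prod_(i.+2 <= j < m) rA j (a j)).
  by apply: tprod_comm => j ji; apply: (hd_TA HH); lia.
rewrite !mulrA c1 -!(mulrA (tprod i a)) -(mulrA _ _ (rT i)) -c2.
rewrite !mulrA -(mulrA (tprod i a)) (hd_TAl HH) // !mulrA -(mulrA _ (rT i)) (hd_TAr HH) // mulrA.
rewrite -(mulrA (tprod i a)) (hd_AC HH (l := i.+1) (m := i) _ _ _ (pa i _) (pa i.+1 _)); try lia.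
by rewrite -pz_scalerAr -!pz_scalerAl !mulrA.
Qed.
End TensorWords.

Section CycloLift.
Variables (k : comNzRingType) (A : pzAlgType k) (par : bool -> A -> Prop).
Variables (trA : {scalar A}) (I : finType) (B Bd : I -> A).
Hypothesis HA : dual_bases par trA B Bd.
Variables (n : nat) (z : k) (d : nat) (f : 'I_d -> A).
Variables (E : pzAlgType k) (rA : nat -> {linear A -> E}).
Variables (rT : nat -> E) (rX : E).
Definition nat_tensor (a : {ffun 'I_n.+1 -> A}) (j : nat) : A := a (inord j).
Lemma nat_tensorE a (j : 'I_n.+1) : nat_tensor a j = a j.
Proof. by rewrite /nat_tensor inord_val. Qed.

Lemma tprod_set_factor a (j : 'I_n.+1) : exists P Q, forall x,
  tprod rA n.+1 (nat_tensor (set_factor a j x)) = P * rA j x * Q.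
Proof.
exists (tprod rA j (nat_tensor a)), (\prod_(j.+1 <= i < n.+1) rA i (nat_tensor a i)) => x.
rewrite (tprod_split _ _ (ltn_ord j)) nat_tensorE /set_factor ffunE eqxx; congr (_ * _ * _).
  apply: eq_tprod => i ij; rewrite /nat_tensor /set_factor ffunE ifN // -val_eqE /=.
  by rewrite inordK; have := ltn_ord j; lia.
apply: eq_big_nat => i ij; rewrite /nat_tensor /set_factor ffunE ifN // -val_eqE /=.
by rewrite inordK; lia.
Qed.

Hypothesis HH : hecke_datum par B Bd z f n.+1 rA rT rX.

Lemma tprod_in_factor l x : (l < n.+1)%N ->
  tprod rA n.+1 (nat_tensor (in_factor (inord l) x)) = rA l x.
Proof.
move=> ln; apply: (tprod_delta HH) => //; rewrite /nat_tensor /in_factor /set_factor ?ffunE ?eqxx //.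
by move=> j jn jl; rewrite /nat_tensor /in_factor /set_factor !ffunE ifN // -val_eqE /= !inordK //.
Qed.

Variable XV : E.
Hypothesis rXV : rX * XV = 1 /\ XV * rX = 1.
Let rXV' : (0 < n.+1)%N -> rX * XV = 1 /\ XV * rX = 1 := fun _ => rXV.

Local Notation xx := (jm rT rX).
Local Notation yy := (yy B Bd z rA rT XV).

Definition gen_lift (g : hecke_gen A n) : E := match g with
  | inl (inl (inl a)) => tprod rA n.+1 (nat_tensor a)
  | inl (inl (inr i)) => rT i
  | inl (inr j) => xx j
  | inr j => yy j
  end.

Variable lf : free_alg k (hecke_gen A n) -> E.
Hypothesis lfh : ahom lf.
Hypothesis lf_gen : forall g, lf (gen k g) = gen_lift g.

Lemma koszulE (p q : 'I_n.+1 -> bool) :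
  koszul p q = (\sum_(0 <= i < n.+1) \sum_(0 <= j < i) (p (inord i) && q (inord j)))%N.
Proof.
rewrite /koszul big_mkord; apply: eq_bigr => i _.
rewrite big_mkord (big_ord_widen n.+1 (fun j => (p (inord i) && q (inord j)) : nat)).
  by apply: eq_bigr => j _; rewrite !inord_val.
exact: ltnW.
Qed.

Lemma lf_tensor_relation x y : tensor_relation par x y -> lf x = lf y.
Proof.
case=> {x y}.
- move=> a j x y; rewrite [RHS](ahomD lfh) !lf_gen /=.
  have [P [Q e]] := tprod_set_factor a j.
  by rewrite !e linearD mulrDr mulrDl.
- move=> a j c x; rewrite [RHS](ahomZ lfh) !lf_gen /=.
  have [P [Q e]] := tprod_set_factor a j.
  by rewrite !e linZ -pz_scalerAr -pz_scalerAl.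
- rewrite [RHS](ahom1 lfh) lf_gen /=; apply: (prod_rA1 HH) => // j jn.
  by rewrite /nat_tensor ffunE.
- move=> p q a c pa qc; rewrite [RHS](ahomZ lfh) [LHS](ahomM lfh) !lf_gen /=.
  rewrite (tprod_mul HH (p := fun j => p (inord j)) (q := fun j => q (inord j))) //.
  rewrite koszulE; congr (_ *: _); apply: eq_tprod => j jn.
  by rewrite /nat_tensor ffunE.
Qed.

Lemma lf_teleporter (i j : 'I_n.+1) :
  lf (teleporter B Bd i j) = tel B Bd (rA i) (rA j).
Proof.
rewrite /teleporter (ahom_sum lfh); apply: eq_bigr => b _.
rewrite [LHS](ahomM lfh) !lf_gen /= -{1}(inord_val i) -{1}(inord_val j).
by rewrite !tprod_in_factor.
Qed.

Lemma simple_trE (i : 'I_n) (j : nat) : (j < n.+1)%N ->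
  val (simple_tr i (inord j)) = if j == i then i.+1 else if j == i.+1 then i : nat else j.
Proof.
move=> jn; rewrite /simple_tr; case: tpermP => [|| /eqP + /eqP].
- by move=> /(congr1 val); rewrite /= inordK // => ->; rewrite eqxx.
- move=> /(congr1 val); rewrite /= inordK // /bump /= add1n => ->.
  by rewrite eqxx gtn_eqF.
- by rewrite -!val_eqE /= inordK // /bump /= add1n => /negPf -> /negPf ->.
Qed.

Lemma lf_wreath_relation x y : wreath_relation par B Bd z x y -> lf x = lf y.
Proof.
case=> {x y}.
- exact: lf_tensor_relation.
- move=> i j ij; rewrite [LHS](ahomM lfh) [RHS](ahomM lfh) !lf_gen /=.
  by apply: (TTC HH) => //; rewrite ltnS.
- move=> i j ji; rewrite [LHS](ahomM lfh) [RHS](ahomM lfh).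
  rewrite [X in X * _ = _](ahomM lfh) [X in _ = X * _](ahomM lfh).
  by rewrite !lf_gen /= ji; apply: (hd_braid HH); rewrite -ji ltnS.
- move=> i; rewrite [LHS](ahomM lfh) [RHS](ahomD lfh) [X in _ = X + _](ahomZ lfh) [X in _ = _ + X](ahom1 lfh).
  rewrite [X in _ = _ *: X + _](ahomM lfh) (lf_teleporter (lft i) (rgt i)) !lf_gen /=.
  rewrite (hd_quad HH) ?ltnS //= ; by rewrite /bump /= add1n.
- move=> i p a pa; rewrite [RHS](ahomZ lfh) [LHS](ahomM lfh) [X in _ = _ *: X](ahomM lfh) !lf_gen /=.
  have := tprod_T HH (i := i) (m := n.+1) (p := fun j => p (inord j)) (a := nat_tensor a)
    (a' := nat_tensor [ffun j => a (simple_tr i j)]).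
  rewrite ltnS => -> //.
  + congr (_ ^+ (_ && _) *: _); congr (p _); apply: val_inj => /=; rewrite inordK //.
    * by have := ltn_ord i; lia.
    * by rewrite ltnS.
  + rewrite /nat_tensor ffunE; congr (a _); apply: val_inj.
    rewrite simple_trE; last by rewrite ltnS ltnW.
    by rewrite eqxx /= inordK ?ltnS.
  + rewrite /nat_tensor ffunE; congr (a _); apply: val_inj.
    rewrite simple_trE ?ltnS // eqxx gtn_eqF // [RHS]inordK // ltnS; exact: ltnW.
  + move=> j jn ji ji1; rewrite /nat_tensor ffunE; congr (a _); apply: val_inj.
    by rewrite simple_trE // (negPf ji) (negPf ji1) /= inordK.
Qed.

Lemma lf_affine_relation x y : affine_relation par B Bd z x y -> lf x = lf y.
Proof.
have e (j : 'I_n.+1) := xxyy HA HH rXV' (ltn_ord j).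
case=> {x y}.
- exact: lf_wreath_relation.
- by move=> j; rewrite [LHS](ahomM lfh) [RHS](ahom1 lfh) !lf_gen /= (e j).1.
- by move=> j; rewrite [LHS](ahomM lfh) [RHS](ahom1 lfh) !lf_gen /= (e j).2.
- by move=> j l; rewrite [LHS](ahomM lfh) [RHS](ahomM lfh) !lf_gen /=; apply: (jm_comm HH).
- move=> i j ji jr; rewrite [LHS](ahomM lfh) [RHS](ahomM lfh) !lf_gen /=.
  apply: (jmT HH); [by rewrite ltnS | by [] | by [] |].
  by move: jr; rewrite -val_eqE /= /bump /= add1n.
- by move=> i; rewrite [LHS](ahomM lfh) [X in X * _ = _](ahomM lfh) !lf_gen.
- move=> j a; rewrite [LHS](ahomM lfh) [RHS](ahomM lfh) !lf_gen /=.
  by apply: tprod_comm => l ln; apply: (jmA HH).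
Qed.

End CycloLift.

Section CycloLift2.
Variables (k : comNzRingType) (A : pzAlgType k) (par : bool -> A -> Prop).
Variables (trA : {scalar A}) (I : finType) (B Bd : I -> A).
Hypothesis HA : dual_bases par trA B Bd.
Variables (n : nat) (z : k) (d : nat) (f : 'I_d -> A).
Variables (E : pzAlgType k) (rA : nat -> {linear A -> E}).
Variables (rT : nat -> E) (rX : E).
Hypothesis HH : hecke_datum par B Bd z f n.+1 rA rT rX.
Variable XV : E.
Hypothesis rXV : rX * XV = 1 /\ XV * rX = 1.
Local Notation xx := (jm rT rX).

(** X_j is sent to [jm j], its inverse to [yy j], and a pure tensor to the product of its labels;
    the defining relations then follow from the consequences of [hecke_datum]. *)
Lemma cyclo_lift : exists Phi : cyclo_hecke par B Bd n z f -> E,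
  [/\ ahom Phi, forall a, Phi (ctens par B Bd z f a) = tprod rA n.+1 (nat_tensor a),
      forall i, Phi (cT par B Bd z f i) = rT i &
      forall j, Phi (cX par B Bd z f j) = xx j].
Proof.
pose lf : free_alg k (hecke_gen A n) -> E := free_lift (gen_lift B Bd z rA rT rX XV).
have lfh : ahom lf by apply: free_lift_ahom.
have lf_gen g : lf (gen k g) = gen_lift B Bd z rA rT rX XV g.
  by rewrite /lf /gen free_liftU scale1r /monom_lift fmuE /= big_seq1.
clearbody lf.
have [x [u [v [uv ->]]]|Psi Psih PsiE] := quo_lift
  (S := fun x : free_alg k (hecke_gen A n) => exists u v, affine_relation par B Bd z u v /\ x = u - v) lfh.
  by rewrite (ahomB lfh) (lf_affine_relation HA HH rXV lfh lf_gen uv) subrr.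
have [_ ->|Phi Phih PhiE] := quo_lift (S := fun x : affine_hecke par B Bd n z => x = cyclo_poly par B Bd n z f) Psih.
  rewrite /cyclo_poly (ahomD Psih) (ahomX Psih) (ahom_sum Psih) -[RHS](hd_cyc HH) //.
  congr (_ + _); first by rewrite PsiE lf_gen.
  apply: eq_bigr => i _; rewrite (ahomM Psih) (ahomX Psih) !PsiE !lf_gen /=.
  by rewrite -{1}(inord_val ord0) (tprod_in_factor HH).
by exists Phi; split=> // *; rewrite PhiE PsiE lf_gen.
Qed.
End CycloLift2.

(** * The presentation by generators on each strand *)

Section FreeGen.
Variables (k : comNzRingType) (G : choiceType).

Lemma monom_gen (s : seq G) :
  (<< FMonom s >> : {malg k[{fmonom G}]}) = \prod_(g <- s) gen k g.
Proof.
elim: s => [|g s IH]; first by rewrite big_nil; congr << _ >>; apply/val_inj; rewrite /= fm1.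
rewrite big_cons -IH [RHS]malgME !msuppU1 !big_seq_fset1 !mcoeffUU mulr1.
by congr << _ *g _ >>; apply/val_inj; rewrite [RHS]fmM fmuE.
Qed.

Lemma free_gen (x : free_alg k G) :
  x = \sum_(m <- msupp (x : {malg k[{fmonom G}]}))
    mcoeff m (x : {malg k[{fmonom G}]}) *: \prod_(g <- (m : seq G)) gen k g.
Proof.
rewrite {1}[x]monalgE; apply: eq_bigr => m _; rewrite -monom_gen.
have -> : FMonom m = m by apply/val_inj.
by apply/malgP => m'; rewrite mcoeffZ !mcoeffU mulr_natr.
Qed.
End FreeGen.

Section Presented.
Variables (k : comNzRingType) (A : pzAlgType k) (par : bool -> A -> Prop).
Variables (trA : {scalar A}) (I : finType) (B Bd : I -> A).
Hypothesis HA : dual_bases par trA B Bd.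
Variables (n : nat) (z : k) (d : nat) (f : 'I_d -> A).
Variables (H : pzAlgType k) (q : free_alg k (hecke_gen A n) -> H).
Hypothesis qh : ahom q.
Hypothesis q_rel : forall x y, affine_relation par B Bd z x y -> q x = q y.
Let sA : is_superalgebra par := sym_super (db_sym HA).

Definition qt a := q (gtens a).
Definition qT i := q (gT A i).
Definition qX j := q (gX A j).
Definition qV j := q (gXV A j).

Hypothesis q_cyc : qX ord0 ^+ d + \sum_(i < d) qt (in_factor ord0 (f i)) * qX ord0 ^+ i = 0.

Lemma qt_add a j x y :
  qt (set_factor a j (x + y)) = qt (set_factor a j x) + qt (set_factor a j y).
Proof. by have := q_rel (aff_wreath (wreath_tens _ _ _ (tens_add par a j x y))); rewrite [RHS](ahomD qh). Qed.
Lemma qt_scale a j c x : qt (set_factor a j (c *: x)) = c *: qt (set_factor a j x).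
Proof. by have := q_rel (aff_wreath (wreath_tens _ _ _ (tens_scale par a j c x))); rewrite [RHS](ahomZ qh). Qed.
Lemma qt_one : qt [ffun => 1] = 1.
Proof. by have := q_rel (aff_wreath (wreath_tens _ _ _ (tens_one par n))); rewrite [RHS](ahom1 qh). Qed.
Lemma qt_mul p r a c : homog_tensor par p a -> homog_tensor par r c ->
  qt a * qt c = (-1) ^+ koszul p r *: qt [ffun j => a j * c j].
Proof.
move=> pa rc; have := q_rel (aff_wreath (wreath_tens _ _ _ (tens_mul pa rc))).
by rewrite [LHS](ahomM qh) [RHS](ahomZ qh).
Qed.
Lemma qT_comm (i j : 'I_n) : (i.+1 < j)%N || (j.+1 < i)%N -> qT i * qT j = qT j * qT i.
Proof.
by move=> ij; have := q_rel (aff_wreath (wreath_comm _ _ _ _ ij)); rewrite [LHS](ahomM qh) [RHS](ahomM qh).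
Qed.
Lemma qT_braid (i j : 'I_n) : j = i.+1 :> nat -> qT i * qT j * qT i = qT j * qT i * qT j.
Proof.
move=> ij; have e := q_rel (aff_wreath (wreath_braid _ _ _ _ ij)).
rewrite [LHS](ahomM qh) [RHS](ahomM qh) in e.
by rewrite [X in X * _ = _](ahomM qh) [X in _ = X * _](ahomM qh) in e.
Qed.
Lemma qT_quad i : qT i * qT i = z *: ((\sum_b qt (in_factor (lft i) (B b)) *
   qt (in_factor (rgt i) (Bd b))) * qT i) + 1.
Proof.
have e := q_rel (aff_wreath (wreath_quad par B Bd z i)).
rewrite [LHS](ahomM qh) [RHS](ahomD qh) [X in _ = X + _](ahomZ qh) [X in _ = _ + X](ahom1 qh) in e.
rewrite [X in _ = _ *: X + _](ahomM qh) in e; rewrite [LHS]e.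
congr (_ + _); congr (_ *: _); congr (_ * _).
by rewrite /teleporter (ahom_sum qh); apply: eq_bigr => b _; rewrite [LHS](ahomM qh).
Qed.
Lemma qT_act i p a : homog_tensor par p a ->
  qT i * qt a = (-1) ^+ (p (lft i) && p (rgt i)) *: (qt [ffun j => a (simple_tr i j)] * qT i).
Proof.
move=> pa; have e := q_rel (aff_wreath (wreath_act B Bd z i pa)).
by rewrite [LHS](ahomM qh) [RHS](ahomZ qh) [X in _ = _ *: X](ahomM qh) in e.
Qed.
Lemma qVX j : qV j * qX j = 1.
Proof. by have := q_rel (aff_VX par B Bd z j); rewrite [LHS](ahomM qh) [RHS](ahom1 qh). Qed.
Lemma qXX j l : qX j * qX l = qX l * qX j.
Proof. by have := q_rel (aff_XX par B Bd z j l); rewrite [LHS](ahomM qh) [RHS](ahomM qh). Qed.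
Lemma qTX i j : j != lft i -> j != rgt i -> qT i * qX j = qX j * qT i.
Proof.
by move=> jl jr; have := q_rel (aff_TX par B Bd z jl jr); rewrite [LHS](ahomM qh) [RHS](ahomM qh).
Qed.
Lemma qTXT i : qT i * qX (lft i) * qT i = qX (rgt i).
Proof.
by have e := q_rel (aff_TXT par B Bd z i); rewrite [LHS](ahomM qh) [X in X * _ = _](ahomM qh) in e.
Qed.
Lemma qXt j a : qX j * qt a = qt a * qX j.
Proof. by have := q_rel (aff_Xtens par B Bd z j a); rewrite [LHS](ahomM qh) [RHS](ahomM qh). Qed.

Fact q_A_subproof l : linear (fun x => qt (in_factor (inord l) x)).
Proof. by move=> c x y; rewrite /in_factor qt_add qt_scale. Qed.
Definition qA l : {linear A -> H} := mk_linear (q_A_subproof l).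
Definition qTn (i : nat) : H := if insub i is Some j then qT j else 0.
Lemma qTnE (i : 'I_n) : qTn i = qT i. Proof. by rewrite /qTn valK. Qed.
Lemma qAE (j : 'I_n.+1) x : qA j x = qt (in_factor j x).
Proof. by rewrite /= inord_val. Qed.

Definition dlt (l : 'I_n.+1) (p : bool) (j : 'I_n.+1) := (j == l) && p.
Lemma homog_in_factor l p x : par p x -> homog_tensor par (dlt l p) (in_factor l x).
Proof.
move=> px j; rewrite /in_factor /set_factor !ffunE /dlt; case: eqP => //= _.
exact: par_1 sA.
Qed.
Lemma koszul_dlt l m p r : koszul (dlt l p) (dlt m r) = [&& (m < l)%N, p & r].
Proof.
rewrite /koszul (bigD1 l) //= [X in (_ + X)%N]big1 ?addn0 => [|i il]; last first.
  by apply: big1 => j _; rewrite /dlt (negPf il).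
rewrite big_mkcond (bigD1 m) //= big1 => [|j jm].
  by rewrite /dlt !eqxx addn0 /=; case: ifP.
by rewrite /dlt (negPf jm) andbF; case: ifP.
Qed.

Lemma qA_mul l x y : qA l (x * y) = qA l x * qA l y.
Proof.
have L1 : linear (fun x : A => qA l (x * y)).
  by move=> c u v; rewrite mulrDl -pz_scalerAl linearP.
have L2 : linear (fun x : A => qA l x * qA l y).
  by move=> c u v; rewrite linearP mulrDl -pz_scalerAl.
apply: (par_linear_eq sA (g := mk_linear L1) (h := mk_linear L2)) => p {}x px /=.
have L3 : linear (fun y : A => qA l (x * y)).
  by move=> c u v; rewrite mulrDr -pz_scalerAr linearP.
have L4 : linear (fun y : A => qA l x * qA l y).
  by move=> c u v; rewrite linearP mulrDr -pz_scalerAr.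
apply: (par_linear_eq sA (g := mk_linear L3) (h := mk_linear L4)) => r {L1 L2 L3 L4}y py /=.
rewrite (qt_mul (homog_in_factor _ px) (homog_in_factor _ py)) koszul_dlt ltnn expr0 scale1r.
congr qt; apply/ffunP => j; rewrite /in_factor /set_factor !ffunE.
by case: eqP => // _; rewrite mulr1.
Qed.

Lemma qA_AC (l m : 'I_n.+1) : l != m -> scomm par (qA l) (qA m).
Proof.
move=> lm p r x y px py; rewrite !qAE.
rewrite (qt_mul (homog_in_factor _ px) (homog_in_factor _ py)) koszul_dlt.
rewrite (qt_mul (homog_in_factor _ py) (homog_in_factor _ px)) koszul_dlt scalerA.
have -> : [ffun j => in_factor l x j * in_factor m y j] = [ffun j => in_factor m y j * in_factor l x j].
  apply/ffunP => j; rewrite /in_factor /set_factor !ffunE.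
  case: eqP => [->|_]; first by rewrite (negPf lm) mulr1 mul1r.
  by rewrite mulr1 mul1r.
congr (_ *: _); move: lm; rewrite -val_eqE /=.
case: ltngtP => // _ _; case: p r {px py} => [] []; rewrite /= ?expr0 ?expr1 ?mulrNN ?mulr1 ?mul1r //.
Qed.

Lemma qT_A i l x : qT i * qA (l : 'I_n.+1) x = qA (simple_tr i l) x * qT i.
Proof.
have L1 : linear (fun x : A => qT i * qA l x).
  by move=> c u v; rewrite linearP mulrDr -pz_scalerAr.
have L2 : linear (fun x : A => qA (simple_tr i l) x * qT i).
  by move=> c u v; rewrite linearP mulrDl -pz_scalerAl.
apply: (par_linear_eq sA (g := mk_linear L1) (h := mk_linear L2)) => p {}x px.
rewrite /mk_linear [LHS]/= [RHS]/= {L1 L2} !inord_val (qT_act i (homog_in_factor _ px)).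
have -> : dlt l p (lft i) && dlt l p (rgt i) = false.
  rewrite /dlt; case: eqP => //= <-; rewrite -val_eqE /= /bump /= add1n.
  by rewrite gtn_eqF // andbF.
rewrite expr0 scale1r; congr (qt _ * _); apply/ffunP => j.
rewrite /in_factor /set_factor !ffunE; congr (if _ then _ else _).
by rewrite -(inj_eq (@perm_inj _ (simple_tr i))) /simple_tr tpermK.
Qed.

Lemma val_lft (i : 'I_n) : lft i = i :> nat. Proof. by []. Qed.
Lemma val_rgt (i : 'I_n) : rgt i = i.+1 :> nat. Proof. by []. Qed.
Lemma ord_n i : (i.+1 < n.+1)%N -> exists i' : 'I_n, i = i'.
Proof. by rewrite ltnS => iN; exists (Ordinal iN). Qed.
Lemma ord_n1 i : (i < n.+1)%N -> exists i' : 'I_n.+1, i = i'.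
Proof. by move=> iN; exists (Ordinal iN). Qed.

Lemma simple_tr_lft (i : 'I_n) : simple_tr i (lft i) = rgt i. Proof. exact: tpermL. Qed.
Lemma simple_tr_rgt (i : 'I_n) : simple_tr i (rgt i) = lft i. Proof. exact: tpermR. Qed.
Lemma simple_trD (i : 'I_n) (j : 'I_n.+1) : j != i :> nat -> j != i.+1 :> nat -> simple_tr i j = j.
Proof.
by move=> ji ji1; rewrite /simple_tr tpermD // -val_eqE eq_sym ?val_lft ?val_rgt.
Qed.

(** The converse of the universal property: the cyclotomic algebra itself satisfies the smaller
    presentation, so all results about [hecke_datum] apply to it. *)
Lemma q_datum : hecke_datum par B Bd z f n.+1 qA qTn (qX ord0).
Proof.
split.
- by move=> l _; split; [rewrite /= -qt_one; congr qt; apply/ffunP=> j; rewrite /in_factor /set_factor !ffunE; case: eqP | exact: qA_mul].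
- by move=> l m /ord_n1[l' ->] /ord_n1[m' ->]; apply: qA_AC.
- move=> i a /ord_n[{}i ->]; rewrite qTnE -val_lft qT_A simple_tr_lft val_rgt //.
- move=> i a /ord_n[{}i ->]; rewrite qTnE -val_rgt qT_A simple_tr_rgt val_lft //.
- by move=> i l a /ord_n[{}i ->] /ord_n1[{}l ->] li li1; rewrite qTnE qT_A simple_trD.
- move=> i /ord_n[{}i ->]; rewrite qTnE qT_quad; congr (_ + _); congr (_ *: _); congr (_ * _).
  by apply: eq_bigr => b _; rewrite -val_rgt -val_lft !qAE.
- move=> i iN; have [i' ei] := ord_n (ltnW iN); have [j ej] := ord_n iN.
  by rewrite ej qTnE ei qTnE; apply: qT_braid; rewrite -ei.
- move=> i j ij jN; have [i' ei] : exists i' : 'I_n, i = i' by apply: ord_n; lia.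
  have [j' ej] := ord_n jN; rewrite ei ej !qTnE; apply: qT_comm.
  by rewrite -ei -ej ij.
- by move=> l a _; apply: qXt.
- move=> i i0 /ord_n[i' ei]; rewrite ei qTnE; apply/esym/qTX.
    by rewrite -val_eqE /= -ei; lia.
  by rewrite -val_eqE /=.
(* Commutation of X_0 with X_1 = T_0 X_0 T_0. *)
- move=> /ord_n[i ei]; rewrite ei qTnE.
  have e0 : ord0 = lft i by apply: val_inj; rewrite /= -ei.
  have := qXX (lft i) (rgt i); rewrite -qTXT -e0 !mulrA //.
- move=> _; rewrite -[RHS]q_cyc; congr (_ + _); apply: eq_bigr => i _.
  by rewrite -(qAE ord0).
Qed.

Lemma qXE (j : nat) : (j < n.+1)%N -> jm qTn (qX ord0) j = qX (inord j).
Proof.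
elim: j => [|j IH] jn; first by congr qX; apply: val_inj; rewrite /= inordK.
have [i ei] := ord_n jn; rewrite [LHS]/= IH; last lia.
have -> : inord j = lft i by apply: val_inj; rewrite /= inordK; lia.
by rewrite ei qTnE qTXT; congr qX; apply: val_inj; rewrite /= inordK // -ei.
Qed.

Lemma qt_homog p a m : (m <= n.+1)%N -> homog_tensor par p a ->
  qt [ffun j : 'I_n.+1 => if (j < m)%N then a j else 1] = tprod qA m (nat_tensor a).
Proof.
move=> mn pa; elim: m mn => [|m IH] mn.
  by rewrite /tprod big_nil -qt_one; congr qt; apply/ffunP => j; rewrite !ffunE.
have [m' em] := ord_n1 mn; rewrite tprodS -IH; last lia.
have -> : qA m (nat_tensor a m) = qt (in_factor m' (a m')).
  by rewrite em qAE nat_tensorE.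
rewrite (qt_mul (p := fun j => (j < m)%N && p j) _ (homog_in_factor m' (pa m'))).
  have -> : koszul (fun j : 'I_n.+1 => (j < m)%N && p j) (dlt m' (p m')) = 0%N.
    rewrite /koszul big1 // => i _; rewrite big1 // => j ji; rewrite /dlt.
    case: eqP => [ej|_]; rewrite ?andbF //; rewrite ej -em in ji.
    by rewrite ltnNge (ltnW ji).
  rewrite expr0 scale1r; congr qt; apply/ffunP => j.
  rewrite !ffunE; case: eqP => [->|/eqP]; first by rewrite -em ltnS leqnn ltnn mul1r.
  rewrite -val_eqE /= -em mulr1 ltnS leq_eqVlt => /negPf ->; by [].
by move=> j; rewrite ffunE; case: ifP => _ //=; exact: par_1 sA.
Qed.

(** Known for homogeneous factors by [qt_homog]. The list s contains the positions whose factor may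
    be inhomogeneous; they are split into even and odd parts one at a time. *)
Lemma qtE a : qt a = tprod qA n.+1 (nat_tensor a).
Proof.
pose hom (j : 'I_n.+1) (a : {ffun 'I_n.+1 -> A}) := exists p, par p (a j).
suff h (s : seq 'I_n.+1) : forall a, (forall j, j \notin s -> hom j a) ->
    qt a = tprod qA n.+1 (nat_tensor a).
  by apply: (h (enum 'I_n.+1)) => j; rewrite mem_enum.
elim: s => [|i s IH] {}a ha.
  have /choice[p pa] : forall j, exists p, par p (a j) by move=> j; apply: ha.
  rewrite -(qt_homog (leqnn _) pa); congr qt; apply/ffunP => j.
  by rewrite ffunE ltn_ord.
have [a0 [a1 [pa0 pa1 ai]]] := par_span sA (a i).
have ea : a = set_factor a i (a0 + a1).
  by apply/ffunP => j; rewrite ffunE; case: eqP => // ->.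
have hp p x : par p x -> qt (set_factor a i x) = tprod qA n.+1 (nat_tensor (set_factor a i x)).
  move=> px; apply: IH => j js; rewrite /hom ffunE; case: eqP => [_|/eqP ji]; first by exists p.
  by apply: ha; rewrite inE negb_or ji.
have [P [Q e]] := tprod_set_factor qA a i.
rewrite ea qt_add (hp _ _ pa0) (hp _ _ pa1) !e linearD mulrDr mulrDl //.
Qed.
End Presented.

(** * Invertibility of the first polynomial generator *)

Section XInverse.
Variables (k : comNzRingType) (A : pzAlgType k) (par : bool -> A -> Prop).
Variables (trA : {scalar A}) (I : finType) (B Bd : I -> A).
Hypothesis HA : dual_bases par trA B Bd.
Variables (z : k) (d : nat) (f : 'I_d -> A).
Hypothesis centf : forall i, supercentral par false (f i).
Hypothesis d_gt0 : (0 < d)%N.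
Variable u : A.
Hypothesis fu : f (Ordinal d_gt0) * u = 1.
Hypothesis uf : u * f (Ordinal d_gt0) = 1.
Variables (H : pzAlgType k) (N : nat) (rA : nat -> {linear A -> H}).
Variables (rT : nat -> H) (rX : H).
Hypothesis HH : hecke_datum par B Bd z f N rA rT rX.
Hypothesis N_gt0 : (0 < N)%N.
Let sA : is_superalgebra par := sym_super (db_sym HA).

(** If u1 is the odd part of u and f_0 the constant coefficient, then f_0 u1 = 1 - f_0 u0 is both
    odd and even, hence 0. *)
Lemma inv_even : par false u.
Proof.
have [u0 [u1 [p0 p1 eu]]] := par_span sA u; have [pf _] := centf (Ordinal d_gt0).
suff u10 : u1 = 0 by rewrite eu u10 addr0.
rewrite -[u1]mul1r -uf -mulrA; set w := f _ * u1; suff -> : w = 0 by rewrite mulr0.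
apply: (par_direct sA); last exact: (par_M sA pf p1).
have -> : w = 1 + (-1) *: (f (Ordinal d_gt0) * u0).
  by rewrite -fu eu mulrDr scaleN1r addrAC subrr add0r.
apply: (par_D sA); first exact: par_1 sA.
by apply: (par_Z sA); apply: (par_M sA pf p0).
Qed.

(** The cyclotomic relation reads Q X = -f_0 with Q a polynomial in X of degree d-1, and f_0 is
    invertible. *)
Lemma rX_inverse : exists XV, [/\ sub par rA rT rX 1 false XV, rX * XV = 1 & XV * rX = 1].
Proof.
pose Q := rX ^+ d.-1 + \sum_(i < d | (0 < i)%N) rA 0%N (f i) * rX ^+ i.-1.
have XQ : Q * rX = - rA 0%N (f (Ordinal d_gt0)).
  have := hd_cyc HH N_gt0; rewrite (bigD1 (Ordinal d_gt0)) //= expr0 mulr1.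
  rewrite addrCA => /eqP; rewrite addrC addr_eq0 => /eqP <-.
  rewrite /Q mulrDl -exprSr prednK // mulr_suml; congr (_ + _).
  apply: eq_big => [i|i i0]; first by rewrite -val_eqE /= lt0n.
  by rewrite -mulrA -exprSr prednK.
have cA a : GRing.comm rX (rA 0%N a) by apply: (hd_XA HH).
have cQ : GRing.comm rX Q.
  apply: commrD; first exact: commrX.
  by apply: commr_sum => i _; apply: commrM => //; apply: commrX.
exists (- (rA 0%N u * Q)).
have e1 : - (rA 0%N u * Q) * rX = 1.
  by rewrite mulNr -mulrA XQ mulrN opprK -(hd_A HH N_gt0).2 uf (hd_A HH N_gt0).1.
split=> //; last by rewrite -[RHS]e1; apply/commrN/commrM.
have sXl l : sub par rA rT rX 1 false (rX ^+ l) by apply: sub_exp; apply: sub_gX.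
apply: sub_N; apply: sub_MF; first by apply: sub_gA => //; apply: inv_even.
apply: sub_add => //; apply: sub_sum => i _.
by apply: sub_MF => //; apply: sub_gA => //; have [] := centf i.
Qed.
End XInverse.

(** * Generation and grading of the quotient *)

Section Span.
Variables (k : comNzRingType) (A : pzAlgType k) (par : bool -> A -> Prop).
Variables (trA : {scalar A}) (I : finType) (B Bd : I -> A).
Hypothesis HA : dual_bases par trA B Bd.
Variables (n : nat) (z : k) (d : nat) (f : 'I_d -> A).
Hypothesis centf : forall i, supercentral par false (f i).
Hypothesis d_gt0 : (0 < d)%N.
Variable u : A.
Hypothesis fu : f (Ordinal d_gt0) * u = 1.
Hypothesis uf : u * f (Ordinal d_gt0) = 1.
Variables (H : pzAlgType k) (q : free_alg k (hecke_gen A n) -> H).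
Hypothesis qh : ahom q.
Hypothesis q_rel : forall x y, affine_relation par B Bd z x y -> q x = q y.
Hypothesis q_cyc : qX q ord0 ^+ d + \sum_(i < d) qt q (in_factor ord0 (f i)) * qX q ord0 ^+ i = 0.
Hypothesis q_surj : forall h, exists x, h = q x.
Let sA : is_superalgebra par := sym_super (db_sym HA).
Local Notation qA := (qA qh q_rel).
Local Notation qTn := (qTn q).
Let HH := q_datum HA qh q_rel q_cyc.
Local Notation sub := (sub par qA qTn (qX q ord0)).
Local Notation Sub := (Sub par qA qTn (qX q ord0)).

Lemma sub_qX j : sub n.+1 false (qX q j).
Proof.
by rewrite -[j]inord_val -(qXE qh q_rel) //; apply: sub_jm.
Qed.

Lemma sub_qV j : sub n.+1 false (qV q j).
Proof.
have [XV [sXV e1 e2]] := rX_inverse HA centf fu uf HH isT.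
have [e3 e4] := xxyy HA HH (fun _ => conj e1 e2) (ltn_ord j).
rewrite (qXE qh q_rel) // inord_val in e3 e4.
have -> : qV q j = yy B Bd z qA qTn XV j.
  by rewrite -[LHS]mulr1 -e3 mulrA (qVX qh q_rel) mul1r.
exact: (sub_yy HA z d_gt0 (fun _ => sXV) (fun _ => conj e1 e2) (ltn_ord j) (leqnn _)).
Qed.

Definition q_par p h := exists2 x, free_par (@hecke_gen_par k A par n) p x & h = q x.

Lemma sub_qt p a : homog_tensor par p a ->
  sub n.+1 (\big[addb/false]_j p j) (qt q a).
Proof.
move=> pa; rewrite (qtE HA qh q_rel).
have -> : \big[addb/false]_j p j = \big[addb/false]_(0 <= j < n.+1) p (inord j).
  by rewrite big_mkord; apply: eq_bigr => j _; rewrite inord_val.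
by apply: tprod_sub => j jn; apply: pa.
Qed.

(** The parity inherited from the free algebra is the one carried along in the inductions on the
    number of strands. *)
Lemma q_par_sub p h : q_par p h <-> sub n.+1 p h.
Proof.
split=> [[x px ->]|sh].
- elim: px => {p x h}.
  + move=> p g; case=> {p g} [p a pa|i|j|j]; first exact: sub_qt.
    * by rewrite -[q _]/(qT q i) -qTnE; apply: sub_gT; rewrite ltnS.
    * exact: sub_qX.
    * exact: sub_qV.
  + by rewrite (ahom1 qh); apply: sub_1.
  + by move=> p; rewrite (ahom0 qh); apply: sub_0.
  + by move=> p x y _ sx _ sy; rewrite (ahomD qh); apply: sub_add.
  + by move=> p c x _ sx; rewrite (ahomZ qh); apply: sub_Z.
  + by move=> p r x y _ sx _ sy; rewrite (ahomM qh); apply: (sub_M (erefl _)).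
- have pM p1 p2 x y : q_par p1 x -> q_par p2 y -> q_par (p1 (+) p2) (x * y).
    by move=> [x' px ->] [y' py ->]; exists (x' * y'); [apply: free_par_M|rewrite (ahomM qh)].
  elim: sh => {p h}.
  + by exists 1; [exact: free_par_1|rewrite (ahom1 qh)].
  + move=> l a p r x ln pa _ sx; apply: pM sx; have [l' ->] := ord_n1 ln.
    rewrite qAE; exists (gtens (in_factor l' a)) => //.
    have -> : p = \big[addb/false]_j dlt l' p j.
      rewrite (bigD1 l') //= big1 => [|j /negPf jl]; first by rewrite /dlt eqxx addbF.
      by rewrite /dlt jl.
    by apply: free_par_gen; apply: par_tens; apply: (homog_in_factor HA).
  + move=> i r x /ord_n[i' ->] _ sx; rewrite -[r]addFb; apply: pM sx.
    by rewrite qTnE; exists (gT A i') => //; apply: free_par_gen; apply: par_T.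
  + move=> r x _ _ sx; rewrite -[r]addFb; apply: pM sx.
    by exists (gX A ord0) => //; apply: free_par_gen; apply: par_X.
  + by move=> r; exists 0; [exact: free_par_0 | rewrite (ahom0 qh)].
  + move=> r c x y _ [x' px ->] _ [y' py ->]; exists (c *: x' + y'); last by rewrite (ahomP qh).
    by apply: free_par_D => //; apply: free_par_Z.
Qed.

Lemma q_all h : Sub n.+1 h.
Proof.
have [x ->] := q_surj h; rewrite (free_gen x) (ahom_sum qh).
apply: Sub_sum => m _; rewrite (ahomZ qh); apply: Sub_Z; rewrite (ahom_prod qh).
apply: (big_ind (Sub n.+1)); [exact: Sub_1 | exact: Sub_M|].
case=> [[[a|i]|j]|j] _.
- rewrite -[q _]/(qt q a) (qtE HA qh q_rel) /tprod big_nat_cond.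
  apply: (big_ind (Sub n.+1)); [exact: Sub_1 | exact: Sub_M|].
  by move=> j; rewrite andbT => /andP[_ jn]; apply: (Sub_A HA).
- by rewrite -[q _]/(qT q i) -qTnE; apply: Sub_T; rewrite ltnS.
- exact: (Sub_sub (sub_qX j)).
- exact: (Sub_sub (sub_qV j)).
Qed.
End Span.

(** * Trace of the basis *)

Section Monomials.
Variables (k : comNzRingType) (A : pzAlgType k) (par : bool -> A -> Prop).
Variables (trA : {scalar A}) (I : finType) (B Bd : I -> A).
Hypothesis HA : dual_bases par trA B Bd.
Variables (z : k) (d : nat) (f : 'I_d -> A).
Hypothesis centf : forall i, supercentral par false (f i).
Hypothesis d_gt0 : (0 < d)%N.
Variables (H : pzAlgType k) (N : nat) (rA : nat -> {linear A -> H}).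
Variables (rT : nat -> H) (rX : H).
Hypothesis HH : hecke_datum par B Bd z f N rA rT rX.
Local Notation sub := (sub par rA rT rX).
Local Notation Sub := (Sub par rA rT rX).
Local Notation xx := (jm rT rX).
Let sA : is_superalgebra par := sym_super (db_sym HA).

Definition Tw (s : seq nat) : H := \prod_(i <- s) rT i.

Lemma Tw_cat s t : Tw (s ++ t) = Tw s * Tw t.
Proof. exact: big_cat. Qed.

Lemma braid_eq_Tw s t : braid_eq s t -> all (fun i => i.+1 < N)%N s -> Tw s = Tw t.
Proof.
elim=> {s t} // [t s u e1 IH1 _ IH2 a|u v i j ij|u v i|u v i]; rewrite ?all_cat /=.
- by rewrite IH1 // IH2 // -(braid_eq_all _ e1).
- move=> /and4P[_ iN jN _]; rewrite !Tw_cat /Tw !big_cons !mulrA; congr (_ * _).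
  by rewrite -!mulrA (TTC HH ij).
- move=> /and5P[_ iN iN1 _ _]; rewrite !Tw_cat /Tw !big_cons; congr (_ * _).
  by rewrite !mulrA (hd_braid HH).
- move=> /and5P[_ iN1 iN _ _]; rewrite !Tw_cat /Tw !big_cons; congr (_ * _).
  by rewrite !mulrA (hd_braid HH).
Qed.

Lemma Sub_Tw m s : all (fun i => i.+1 < m)%N s -> Sub m (Tw s).
Proof.
move=> /allP sm; rewrite /Tw big_seq; apply: (big_ind (Sub m)); [exact: Sub_1 | exact: Sub_M|].
by move=> i /sm im; apply: Sub_T.
Qed.

Definition mono m (lam : nat -> nat) (a : nat -> A) c : H :=
  \prod_(0 <= j < m) xx j ^+ lam j * tprod rA m a * Tw c.

Lemma Sub_xx m j l : (j < m)%N -> Sub m (xx j ^+ l).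
Proof. by move=> jm; apply: (Sub_sub (p := false)); apply: sub_exp; apply: sub_jm. Qed.

Lemma Sub_comm_xx m x : (m < N)%N -> Sub m x -> GRing.comm (xx m) x.
Proof.
move=> mN; elim/Sub_par => [x1 x2|p {}x sx]; first exact: commrD.
exact: (sub_xx HH mN sx).
Qed.

Lemma Sub_mono m lam a c : canonical_word m c -> Sub m (mono m lam a c).
Proof.
move=> cc; apply: Sub_M; last exact: Sub_Tw (canon_all cc).
apply: Sub_M; rewrite ?/tprod big_nat_cond; apply: (big_ind (Sub m));
  try exact: Sub_1; try exact: Sub_M; move=> j; rewrite andbT => /andP[_ jm].
  exact: Sub_xx.
exact: (Sub_A HA).
Qed.

(** The power of X_m commutes with H_m and the label on strand m commutes with T_c, so everything on
    the last strand can be collected on the right. *)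
Lemma mono_rec m lam a c i : (m < N)%N -> canonical_word m c ->
  mono m.+1 lam a (c ++ block m i)
  = mono m lam a c * (xx m ^+ lam m * rA m (a m) * Tw (block m i)).
Proof.
move=> mN cc; rewrite /mono Tw_cat big_nat_recr //= tprodS.
have St : Sub m (tprod rA m a).
  rewrite /tprod big_nat_cond; apply: (big_ind (Sub m)); [exact: Sub_1 | exact: Sub_M|].
  by move=> j; rewrite andbT => /andP[_ jm]; apply: (Sub_A HA).
have Sc := Sub_Tw (canon_all cc).
have cT : GRing.comm (rA m (a m)) (Tw c).
  rewrite /Tw big_seq; apply: (big_ind (GRing.comm _)); [exact: commr1 | exact: commrM|].
  move=> i' /(allP (canon_all cc)) im.
  by apply/commr_sym; apply: (hd_TA HH) => //; lia.
have cX x : Sub m x -> GRing.comm (xx m ^+ lam m) x.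
  by move=> sx; apply/commr_sym/commrX/commr_sym/(Sub_comm_xx mN).
rewrite -!mulrA; congr (_ * _); rewrite !mulrA (cX _ St) -!mulrA; congr (_ * _).
by rewrite (mulrA (rA m _)) cT !mulrA (cX _ Sc).
Qed.

Section TraceMono.
Variable tr : nat -> {scalar H}.
Hypothesis tr0 : tr 0 1 = 1.
Hypothesis tr_T : forall m p q x y a, (0 < m)%N -> (m < N)%N -> sub m p x ->
  sub m q y -> tr m.+1 (x * (rT m.-1 * rA m a) * y) = 0.
Hypothesis tr_loop : forall m p q x y a j, (m < N)%N -> (j < d)%N -> sub m p x ->
  sub m q y -> tr m.+1 (x * (rA m a * loop rT rX m j) * y)
  = (j == 0%N)%:R * trA a * tr m (x * y).

(** A nonempty run starts with T_(m-1), and then the trace vanishes by [tr_xxT]; for the empty run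
    this is [trX]. *)
Lemma tr_block m x l a i : (m < N)%N -> Sub m x -> (l < d)%N -> (i <= m)%N ->
  tr m.+1 (x * (xx m ^+ l * rA m a * Tw (block m i)))
  = ((l == 0%N) && (i == m))%:R * trA a * tr m x.
Proof.
move=> mN sx ld im; elim/Sub_par: sx => [x1 x2|p {}x sx].
  by rewrite mulrDl !linearD /= => -> ->; rewrite mulrDr.
have [a0 [a1 [p0 p1 ->]]] := par_span sA a.
suff h r b : par r b -> tr m.+1 (x * (xx m ^+ l * rA m b * Tw (block m i)))
    = ((l == 0%N) && (i == m))%:R * trA b * tr m x.
  rewrite linearD mulrDr mulrDl mulrDr linearD /= (h _ _ p0) (h _ _ p1).
  by rewrite linearD /= mulrDr mulrDl.
move=> rb; rewrite (xxA HH) //; have s1 := sub_1 par rA rT rX m.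
have [->|nim] := eqVneq i m.
  rewrite block_ge // /Tw big_nil andbT mulrA mulrA.
  by rewrite (trX HA d_gt0 HH tr_T tr_loop mN ld sx s1 rb) mulr1.
rewrite andbF !mul0r.
case: m im mN sx nim {s1} => [|m] im mN sx nim; first lia.
have im' : (i <= m)%N by lia.
have SW : Sub m.+1 (Tw (block m i)).
  by apply: Sub_Tw; apply: sub_all (all_block m i) => j; lia.
rewrite block_lt // /Tw big_cons -/(Tw _).
elim/Sub_par: SW => [y1 y2 e1 e2|q y sy].
  by rewrite !mulrDr linearD e1 e2 addr0.
have -> : x * (rA m.+1 b * xx m.+1 ^+ l * (rT m * y))
  = x * rA m.+1 b * (xx m.+1 ^+ l * rT m) * y by rewrite !mulrA.
exact: (tr_xxT HA d_gt0 HH tr_T tr_loop mN ld rb sx sy).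
Qed.

Lemma tr_mono m lam a c : (m <= N)%N -> (forall j, lam j < d)%N -> canonical_word m c ->
  tr m (mono m lam a c) = ((c == [::]) && all (fun j => lam j == 0%N) (iota 0 m))%:R
    * \prod_(0 <= j < m) trA (a j).
Proof.
move=> mN ld; elim: m mN c => [|m IH] mN c.
  by move=> /= ->; rewrite /mono /tprod /Tw !big_nil !mulr1 tr0.
move=> [c' [i [cc im ->]]]; rewrite mono_rec // tr_block //; last exact: Sub_mono.
rewrite IH //; last exact: ltnW.
have -> : all (fun j => lam j == 0%N) (iota 0 m.+1)
    = all (fun j => lam j == 0%N) (iota 0 m) && (lam m == 0%N).
  by rewrite -addn1 iotaD all_cat /= andbT add0n.
rewrite big_nat_recr //=.
have -> : (c' ++ block m i == [::]) = (c' == [::]) && (i == m).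
  case: c' cc => [|//] _ /=; have [->|nim] := eqVneq i m; first by rewrite block_ge.
  by rewrite block_rcons ?(ltn_neqAle, nim) //; case: (block m i.+1).
case: (c' == [::]) (i == m) (lam m == 0%N) (all _ _) => [] [] [] [] /=;
  rewrite ?mul0r ?mulr0 ?mul1r //; exact: mulrC.
Qed.
End TraceMono.

(** * The monomials span *)

Section SpanMono.

Definition lin_closed (P : H -> Prop) :=
  P 0 /\ forall c x y, P x -> P y -> P (c *: x + y).

Lemma lin_closedD P : lin_closed P -> forall x y, P x -> P y -> P (x + y).
Proof. by move=> [_ PP] x y Px Py; rewrite -[x]scale1r; apply: PP. Qed.

(** In a term u T_(m-1) v of [mackey], decompose v by induction as s X^l a times a run. Moving
    T_(m-1) through s X^l a prolongs the run; by [T_jmX] the error terms contain no T_(m-1) and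
    carry exponents of X_m between 1 and l. *)
Lemma block_span m (P : H -> Prop) : (m < N)%N -> lin_closed P ->
  (forall s l a i, Sub m s -> (l < d)%N -> (i <= m)%N ->
     P (s * (xx m ^+ l * rA m a * Tw (block m i)))) ->
  forall x, Sub m.+1 x -> P x.
Proof.
move=> mN PL; have PD := lin_closedD PL.
elim: m P mN PL PD => [|m IH] P mN [P0 PP] PD Pb x sx.
  elim/Sub_par: sx => [|p {}x sx]; first exact: PD.
  elim: (mackey HA centf HH d_gt0 mN sx) => [p1 q1 r u v _ m0 su sv|p1 q1 r u a j _ dj su _|//|].
  - by [].
  - rewrite -mulrA -(xxA HH) // -[X in _ * X]mulr1.
    by have := Pb u j a 0%N (Sub_sub su) dj isT; rewrite block_ge // /Tw big_nil.
  - by move=> r c u v _ Pu _ Pv; apply: PP.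
elim/Sub_par: sx => [|p {}x sx]; first exact: PD.
elim: (mackey HA centf HH d_gt0 mN sx) => [p1 q1 r u v _ m0 su sv|p1 q1 r u a j _ dj su _|//|].
- have PZ c w : P w -> P (c *: w) by move=> Pw; rewrite -[_ *: _]addr0; apply: PP.
  have Psum (J : Type) (s : seq J) (F : J -> H) : (forall i, P (F i)) -> P (\sum_(i <- s) F i).
    by move=> PF; elim/big_rec: _ => // i w _ Pw; apply: PD.
  have Pxy s y a l : (l < d)%N -> Sub m.+1 s -> Sub m.+1 y -> P (s * (xx m.+1 ^+ l * rA m.+1 a) * y).
    move=> ld ss sy; elim/Sub_par: sy => [y1 y2|p2 {}y sy]; first by rewrite mulrDr; apply: PD.
    have [a0 [a1 [p0 p1' ->]]] := par_span sA a.
    suff h r' b : par r' b -> P (s * (xx m.+1 ^+ l * rA m.+1 b) * y).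
      by rewrite linearD mulrDr mulrDr mulrDl; apply: PD; [apply: h p0 | apply: h p1'].
    move=> rb; rewrite -!mulrA (sub_rA HH mN rb sy) -!pz_scalerAr; apply/PZ.
    rewrite (mulrA (_ ^+ _)) (sub_xxX HH _ mN sy) -mulrA mulrA -[X in _ * X]mulr1.
    have := Pb (s * y) l b m.+1 (Sub_M ss (Sub_sub sy)) ld (leqnn _).
    by rewrite block_ge // /Tw big_nil.
  have PL' : lin_closed (fun v => P (u * rT m * v)).
    split=> [|c w w' Pw Pw']; first by rewrite mulr0.
    by rewrite mulrDr -pz_scalerAr; apply: PP.
  apply: (IH _ _ PL' (lin_closedD PL') _ _ (Sub_sub sv)); first lia.
  move=> s l a i ss ld im; have mN' : (m < N)%N by lia.
  have cs : GRing.comm (rT m) s.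
    by elim/Sub_par: ss => [s1 s2|p2 {}s ss]; [apply: commrD | apply: (sub_T_comm HH mN ss)].
  have Su' : Sub m.+1 (u * s) by apply: Sub_M; [apply: Sub_sub su | apply: Sub_leq ss].
  have SW : Sub m.+1 (Tw (block m i)).
    by apply: Sub_Tw; apply: sub_all (all_block m i) => j; lia.
  rewrite mulrA -(mulrA u) cs !mulrA -(mulrA (u * s)) (T_jmX HA HH) //.
  set W := Tw _ in SW *; rewrite mulrBr !mulrBl; apply: PD.
    rewrite -!mulrA (mulrA (rT m)) (hd_TAl HH) // !mulrA.
    have := Pb (u * s) l a i Su' ld; rewrite block_lt // /Tw big_cons -/(Tw _) -/W.
    by rewrite !mulrA; apply; apply: leqW.
  rewrite -scaleN1r; apply/PZ; rewrite -pz_scalerAr -!pz_scalerAl; apply/PZ.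
  rewrite !mulr_sumr !mulr_suml; apply/Psum => {r} r.
  rewrite /tel mulr_suml mulr_sumr !mulr_suml; apply/Psum => b.
  have cX : xx m ^+ (l - r.+1) * xx m.+1 ^+ r.+1 = xx m.+1 ^+ r.+1 * xx m ^+ (l - r.+1).
    by apply: commrX; apply/commr_sym/commrX; apply: (jm_comm HH).
  rewrite cX -!mulrA (mulrA (rA m.+1 _)) -(xxA HH) // 2!mulrA.
  rewrite [X in P X]mulrA; apply: Pxy.
  + by have := ltn_ord r; lia.
  + by apply: Sub_M => //; apply: (Sub_A HA).
  + by apply: Sub_M; [apply: Sub_xx | apply: Sub_M => //; apply: (Sub_A HA)].
- by rewrite -mulrA -(xxA HH) //; have := Pb u j a m.+1 (Sub_sub su) dj (leqnn _);
    rewrite block_ge // /Tw big_nil mulr1.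
- by move=> r c u v _ Pu _ Pv; apply: PP.
Qed.

Lemma mono_span m (P : H -> Prop) : (m <= N)%N -> lin_closed P ->
  (forall lam a c, (forall j, lam j < d)%N -> canonical_word m c -> P (mono m lam a c)) ->
  forall x, Sub m x -> P x.
Proof.
elim: m P => [|m IH] P mN PL Pm x.
  have P1 : P 1.
    by have := Pm (fun=> 0%N) (fun=> 0) [::] (fun _ => d_gt0) (erefl _); rewrite /mono /tprod /Tw !big_nil !mulr1.
  move=> [x0 [x1 [/sub0P[c -> _] /sub0P[c' _ /(_ isT) ->] ->]]].
  by apply: PL.2 => //; case: PL.
apply: block_span => // s l a i ss ld im.
apply: (IH (fun s => P (s * (xx m ^+ l * rA m a * Tw (block m i))))) ss => [||lam a' c lamd cc].
- exact: ltnW.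
- split=> [|c u v Pu Pv]; first by rewrite mul0r; case: PL.
  by rewrite mulrDl -pz_scalerAl; apply: PL.2.
pose lam' j := if j == m then l else lam j; pose a2 j := if j == m then a else a' j.
have := Pm lam' a2 (c ++ block m i); rewrite mono_rec // /lam' /a2 eqxx.
have -> : mono m (fun j => if j == m then l else lam j) (fun j => if j == m then a else a' j) c = mono m lam a' c.
  congr (_ * _ * _); last by apply: eq_tprod => j /ltn_eqF ->.
  by apply: eq_big_nat => j /andP[_ /ltn_eqF ->].
by apply; [move=> j; case: ifP | exists c, i].
Qed.
End SpanMono.
End Monomials.

(** * The trace form *)

Section CycloTrace.
Variables (k : comNzRingType) (A : pzAlgType k) (par : bool -> A -> Prop).
Variables (trA : {scalar A}) (I : finType) (B Bd : I -> A).
Hypothesis HA : dual_bases par trA B Bd.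
Variables (n : nat) (z : k) (d : nat) (f : 'I_d -> A).
Hypothesis centf : forall i, supercentral par false (f i).
Hypothesis d_gt0 : (0 < d)%N.
Variable u : A.
Hypothesis fu : f (Ordinal d_gt0) * u = 1.
Hypothesis uf : u * f (Ordinal d_gt0) = 1.
Variables (H : pzAlgType k) (q : free_alg k (hecke_gen A n) -> H).
Hypothesis qh : ahom q.
Hypothesis q_rel : forall x y, affine_relation par B Bd z x y -> q x = q y.
Hypothesis q_cyc : qX q ord0 ^+ d + \sum_(i < d) qt q (in_factor ord0 (f i)) * qX q ord0 ^+ i = 0.
Hypothesis q_surj : forall h, exists x, h = q x.
Hypothesis q_lift : forall (E : pzAlgType k) (rA : nat -> {linear A -> E})
    (rT : nat -> E) (rX : E), hecke_datum par B Bd z f n.+1 rA rT rX ->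
  forall XV, rX * XV = 1 /\ XV * rX = 1 -> exists Phi : H -> E,
  [/\ ahom Phi, forall a, Phi (qt q a) = tprod rA n.+1 (nat_tensor a),
      forall i, Phi (qT q i) = rT i & forall j, Phi (qX q j) = jm rT rX j].
Let sA : is_superalgebra par := sym_super (db_sym HA).
Local Notation qA := (qA qh q_rel).
Local Notation qTn := (qTn q).
Let HH := q_datum HA qh q_rel q_cyc.
Local Notation sub := (sub par qA qTn (qX q ord0)).
Local Notation Sub := (Sub par qA qTn (qX q ord0)).
Local Notation q_par := (q_par par q).

Definition trace_formula (tr : {scalar H}) :=
  forall (lam : {ffun 'I_n.+1 -> nat}) (a : {ffun 'I_n.+1 -> A})
    (w : 'S_n.+1) (s : seq 'I_n),
  (forall j, lam j < d)%N -> reduced_expression w s ->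
  tr ((\prod_j qX q j ^+ lam j) * qt q a * (\prod_(i <- s) qT q i)) =
  (lam == [ffun => 0%N])%:R * (w == 1%g)%:R * \prod_j trA (a j).

Lemma q_super (dir : forall x, sub n.+1 false x -> sub n.+1 true x -> x = 0) :
  is_superalgebra q_par.
Proof.
have ps p x : q_par p x <-> sub n.+1 p x := q_par_sub HA centf fu uf qh q_rel q_cyc p x.
split.
- by move=> p; apply/ps/sub_0.
- by move=> p a b /ps sa /ps sb; apply/ps/sub_add.
- by move=> p c a /ps sa; apply/ps/sub_Z.
- by apply/ps/sub_1.
- by move=> p r a b /ps sa /ps sb; apply/ps/(sub_M (erefl _)).
- move=> a; have [a0 [a1 [s0 s1 ->]]] := q_all HA centf fu uf qh q_rel q_cyc q_surj a.
  by exists a0, a1; split=> //; apply/ps.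
- by move=> a /ps s0 /ps s1; apply: dir.
Qed.

Lemma word_mono (lam : {ffun 'I_n.+1 -> nat}) a (s : seq 'I_n) c :
  braid_eq (map (@nat_of_ord n) s) c ->
  (\prod_j qX q j ^+ lam j) * qt q a * (\prod_(i <- s) qT q i)
  = mono qA qTn (qX q ord0) n.+1 (fun j => lam (inord j)) (nat_tensor a) c.
Proof.
move=> e; rewrite /mono -(braid_eq_Tw HH e (all_word s)) -(qtE HA qh q_rel); congr (_ * _ * _).
  rewrite big_mkord; apply: eq_bigr => j _.
  by rewrite inord_val (qXE qh q_rel) // inord_val.
by rewrite /Tw big_map; apply: eq_bigr => i _; rewrite qTnE.
Qed.

Lemma trace_formula_uniq tr tr' : trace_formula tr -> trace_formula tr' -> tr' =1 tr.
Proof.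
move=> ft ft' x; apply: (mono_span HA centf d_gt0 HH (m := n.+1)
  (P := fun x => tr' x = tr x)) (q_all HA centf fu uf qh q_rel q_cyc q_surj x) => //.
  by split=> [|c y y' e e']; rewrite ?linear0 ?linearP //= e e'.
move=> lam a c ld cc; have [s es] := wordP (canon_all cc).
pose lam' := [ffun j : 'I_n.+1 => lam j]; pose a' := [ffun j : 'I_n.+1 => a j].
have -> : mono qA qTn (qX q ord0) n.+1 lam a c
  = mono qA qTn (qX q ord0) n.+1 (fun j => lam' (inord j)) (nat_tensor a') c.
  congr (_ * _ * _).
    by apply: eq_big_nat => j /andP[_ jn]; rewrite ffunE inordK.
  by apply: eq_tprod => j jn; rewrite /nat_tensor ffunE inordK.
rewrite -es in cc *; rewrite -(word_mono lam' a' (braid_eq_refl _)).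
have rs := canon_reduced cc.
have ld' j : (lam' j < d)%N by rewrite ffunE.
by rewrite (ft _ _ _ _ ld' rs) (ft' _ _ _ _ ld' rs).
Qed.

Section Tower.
Variable c : A.
Hypothesis trc : trA c = 1.

(** The algebra acts on the top stage of the tower by the universal property, X_0 being invertible
    there by the cyclotomic relation; the functionals are the [tau]. *)
Lemma q_trace : exists tr : nat -> {scalar H},
  [/\ tr 0%N 1 = 1,
   forall m p r x y a, (0 < m)%N -> (m < n.+1)%N -> sub m p x -> sub m r y ->
     tr m.+1 (x * (qTn m.-1 * qA m a) * y) = 0 &
   forall m p r x y a j, (m < n.+1)%N -> (j < d)%N -> sub m p x -> sub m r y ->
     tr m.+1 (x * (qA m a * loop qTn (qX q ord0) m j) * y)
     = (j == 0%N)%:R * trA a * tr m (x * y)].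
Proof.
have Hst := st_hd (tower HA z centf d_gt0 n.+1).
have [XV [_ e1 e2]] := rX_inverse HA centf fu uf Hst isT.
have [Phi [Ph Pt PT PX]] := q_lift Hst (conj e1 e2).
have PA l a : (l < n.+1)%N -> Phi (qA l a) = st_A (tower HA z centf d_gt0 n.+1) l a.
  by move=> ln; rewrite [qA l a]/(qt q _) Pt (tprod_in_factor Hst).
have PT' i : (i.+1 < n.+1)%N -> Phi (qTn i) = st_T (tower HA z centf d_gt0 n.+1) i.
  by move=> /ord_n[i' ->]; rewrite qTnE PT.
have PX' : (0 < n.+1)%N -> Phi (qX q ord0) = st_X (tower HA z centf d_gt0 n.+1).
  by move=> _; rewrite PX.
pose tau r := mk_scalar (tau_lin qA (ahomP Ph) c r).
exists (fun m => tau (n.+1 - m)%N); split.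
- exact: (tau_0 (ahomM Ph) (ahom1 Ph) PA PX' trc).
- move=> m p r x y a m0 mn sx sy.
  exact: (tau_T (ahomP Ph) (ahomM Ph) (ahom1 Ph) PA PT' PX' trc _ m0 mn sx sy).
- move=> m p r x y a j mn jd sx sy.
  exact: (tau_loop (ahomP Ph) (ahomM Ph) (ahom1 Ph) PA PT' PX' trc _ mn jd sx sy).
Qed.

Lemma q_symmetric : exists tr : {scalar H},
  trace_formula tr /\ is_symmetric_superalgebra q_par tr.
Proof.
have ps p x : q_par p x <-> sub n.+1 p x := q_par_sub HA centf fu uf qh q_rel q_cyc p x.
have [tr [tr0 trT trl]] := q_trace; exists (tr n.+1); split.
  move=> lam a w s ld rs; have [c' cc e] := reduced_canon rs.
  rewrite (word_mono _ _ e).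
  rewrite (tr_mono HA d_gt0 HH tr0 trT trl _ (leqnn _) _ cc); last by move=> j; apply: ld.
  rewrite -natrM mulnb (reduced_size0 rs).
  have -> : (c' == [::]) = (size s == 0%N).
    by rewrite -size_eq0 -(braid_eq_size e) size_map.
  rewrite andbC; congr ((nat_of_bool (_ && _))%:R * _).
    apply/allP/eqP => [h|-> j _]; last by rewrite ffunE.
    by apply/ffunP => j; rewrite ffunE -[j]inord_val; apply/eqP/h; rewrite mem_iota add0n ltn_ord.
  by rewrite big_mkord; apply: eq_bigr => j _; rewrite nat_tensorE.
have odd0 x : sub n.+1 true x -> tr n.+1 x = 0.
  exact: (tr_odd0 HA centf d_gt0 HH trT trl (leqnn _)).
have [XV [sXV e1 e2]] := rX_inverse HA centf fu uf HH isT.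
have [inj surj] := tr_perfect HA centf d_gt0 HH tr0 trT trl (fun _ => sXV)
  (fun _ => conj e1 e2) (leqnn n.+1).
have qall := q_all HA centf fu uf qh q_rel q_cyc q_surj.
split.
(* An element that is both even and odd has trace 0 against everything, hence vanishes. *)
- apply: q_super => x s0 s1; apply: inj => // y _.
  have [y0 [y1 [t0 t1 ->]]] := qall y; rewrite mulrDr linearD /=.
  by rewrite (odd0 _ (sub_M _ s1 t0)) // (odd0 _ (sub_M _ s0 t1)) // addr0.
- by move=> a /ps; apply: odd0.
- move=> p r a b /ps sa /ps sb.
  exact: (ssymP HA centf d_gt0 HH trT trl (leqnn _) sa sb).
- move=> phi; have [a _ ha] := surj phi; exists a; split=> [b|a' ha']; first exact: ha.
  apply/eqP; rewrite -subr_eq0; apply/eqP; apply: inj => // y _.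
  by rewrite mulrBl linearB /= ha // ha' subrr.
- move=> p a /ps sa b /ps sb; apply: odd0.
  by apply: (sub_M _ sa sb); rewrite addbN addbb.
Qed.
End Tower.

(** With an empty basis A is zero and no label has trace 1; then 1 = 0 in the algebra, and the zero
    functional is the trace. *)
Lemma q_symmetric0 : (I -> False) -> exists tr : {scalar H},
  trace_formula tr /\ is_symmetric_superalgebra q_par tr.
Proof.
move=> I0; have A0 (a : A) : a = 0.
  by rewrite (crdE HA a) big1 // => b; case: (I0 b).
have H0 (h : H) : h = 0.
  by rewrite -[h]mulr1 -(hd_A HH (ltn0Sn n)).1 (A0 1) linear0 mulr0.
have L : linear_for *%R (fun _ : H => 0 : k) by move=> c x y; rewrite mulr0 addr0.
exists (mk_scalar L); split.
  move=> lam a w s _ _; rewrite [LHS]/= big_ord_recl (A0 (a ord0)) linear0 mul0r.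
  by rewrite mulr0.
split=> //.
- by apply: q_super => x _ _.
- by move=> *; rewrite /= mulr0.
- move=> phi; exists 0; split=> [b|a _]; last by rewrite (H0 a).
  by rewrite /= (H0 b) linear0.
Qed.

Lemma cyclo_symmetric : exists tr : {scalar H},
  trace_formula tr /\ is_symmetric_superalgebra q_par tr.
Proof.
have [b _|I0] := pickP (@predT I); last by apply: q_symmetric0 => b; have := I0 b.
(* By duality b^vee b is a label of trace 1. *)
by apply: (q_symmetric (c := Bd b * B b)); rewrite (db_dual HA) eqxx.
Qed.
End CycloTrace.

Theorem theorem4p16 (k : comNzRingType) (char_k : 2%N \notin [pchar k]) (z : k)
  (A : pzAlgType k) (par : bool -> A -> Prop) (trA : {scalar A})
  (symA : is_symmetric_superalgebra par trA)
  (I : finType) (B Bd : I -> A)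
  (basisB : is_basis B)
  (homogB : forall b, exists p, par p (B b))
  (dualB : forall a b, trA (Bd a * B b) = (a == b)%:R)
  (n d : nat) (d_gt0 : (0 < d)%N) (f : 'I_d -> A)
  (centf : forall i, supercentral par false (f i))
  (unitf : exists u : A, f (Ordinal d_gt0) * u = 1 /\ u * f (Ordinal d_gt0) = 1) :
  exists tr : {scalar cyclo_hecke par B Bd n z f},
    [/\ is_cyclo_trace trA tr,
        forall tr' : {scalar cyclo_hecke par B Bd n z f},
          is_cyclo_trace trA tr' -> tr' =1 tr
      & is_symmetric_superalgebra (@cyclo_par k A par I B Bd n z d f) tr].
Proof.
have HA : dual_bases par trA B Bd by split.
have [u [fu uf]] := unitf.
pose H := cyclo_hecke par B Bd n z f.
pose q (x : free_alg k (hecke_gen A n)) : H := cyc_cls f (aff_cls par B Bd z x).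
have ahom_quo (C : pzAlgType k) (P : C -> Prop) : ahom (quo P : C -> quotient_alg P).
  by split=> [c x y|x y|]; rewrite ?quoD ?quoZ ?quoM ?quo1.
have qh : ahom q.
  exact: (ahom_comp (ahom_quo _ _) (ahom_quo _ _)).
have q_rel x y : affine_relation par B Bd z x y -> q x = q y.
  move=> xy; congr cyc_cls; apply/quoP; apply: ideal_in.
  by exists x, y.
have q_cyc : qX q ord0 ^+ d + \sum_(i < d) qt q (in_factor ord0 (f i)) * qX q ord0 ^+ i = 0.
  have ch : ahom (cyc_cls f : affine_hecke par B Bd n z -> H) := ahom_quo _ _.
  transitivity (cyc_cls f (cyclo_poly par B Bd n z f) : H).
    rewrite /cyclo_poly (ahomD ch) (ahomX ch) (ahom_sum ch); congr (_ + _).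
    by apply: eq_bigr => i _; rewrite (ahomM ch) (ahomX ch).
  rewrite -(ahom0 ch); apply/quoP; rewrite subr0; exact: ideal_in.
have q_surj (h : H) : exists x, h = q x.
  by have [y ->] := quo_surj h; have [x ->] := quo_surj y; exists x.
have q_lift := cyclo_lift HA (n := n) (z := z) (f := f).
have [tr [ft sym]] := cyclo_symmetric HA centf fu uf qh q_rel q_cyc q_surj
  (fun E rA rT rX hd XV e => q_lift E rA rT rX hd XV e).
exists tr; split=> //.
- move=> tr' ft'; exact: (trace_formula_uniq HA centf fu uf qh q_rel q_cyc q_surj ft ft').
(* The parity on the iterated quotient agrees with the one induced by the composite map from the
   free algebra. *)
- have e p h : q_par par q p h <-> @cyclo_par k A par I B Bd n z d f p h.
    split=> [[x px ->]|[y [x px ->] ->]]; last by exists x.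
    by exists (aff_cls par B Bd z x) => //; exists x.
  suff -> : @cyclo_par k A par I B Bd n z d f = q_par par q by [].
  by apply: funext => p; apply: funext => h; apply: propext; split=> /e.
Qed.
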